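(* Let $a>0$ and let $b\neq 0$ be a real number such that $b/a=\frac{\log n}{\log 2}$ or $-b/a=\frac{\log n}{\log 2}$ for some integer $n\ge 2$. Let $\omega=\{\omega_i\}_{i\in\mathbb{Z}}\in\{0,1\}^{\mathbb{Z}}$ be the bilateral Morse sequence or an Oxtoby sequence. Then the continuous hull $\mathcal{M}(a,b,\omega)$ of the decorated tiling $\hat{\mathcal{T}}(\omega)$ of $Sol(a,b)$ is a nonempty compact metric space on which the right action $\mathcal{S}\cdot g=g^{-1}(\mathcal{S})$ of $Sol(a,b)$ is free and minimal. With the foliation given by the orbits of this action, $\mathcal{M}(a,b,\omega)$ has the structure of a transversely Cantor lamination.
   Context: **The group.** For real $a>0$ and $b\ne 0$, $Sol(a,b)=\mathbb{R}^2\rtimes\mathbb{R}$ is $\mathbb{R}^3$ with product $(x,y,z)\cdot(x',y',z')=(x+e^{az}x',\,y+e^{-bz}y',\,z+z')$, with identity $e$ and the left invariant Riemannian metric $e^{-2az}dx^2+e^{2bz}dy^2+dz^2$. **The tile.** In the upper half-plane $\mathbb{H}=\{\alpha+i\beta:\beta>0\}$, let $P$ be the hyperbolic pentagon with vertices $i,\ \tfrac12+i,\ 1+i,\ 1+2i,\ 2i$ and geodesic sides: explicitly, with $\tau(\alpha)=\sqrt{4+\alpha(1-\alpha)}$ on $[0,1]$, $P$ is the set of $\alpha+i\beta$ with $0\le\alpha\le1$, $\beta\le\tau(\alpha)$, and $\beta\ge\frac12\tau(2\alpha)$ if $\alpha\le\frac12$, $\beta\ge\frac12\tau(2\alpha-1)$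 if $\alpha\ge\frac12$. The thickened tile is $\hat P=\{(\alpha,s,\tfrac{\log\beta}{a}) : \alpha+i\beta\in P,\ s\in[0,1]\}\subset Sol(a,b)$. **The tiling.** Let $\hat R,\hat S,\hat T_s$ be the left translations by $(0,0,\tfrac{\log 2}{a})$, $(1,0,0)$, $(0,s,0)$ respectively. Put $\hat{\mathcal T}=\{\hat R^i\circ\hat S^j\circ\hat T_k(\hat P): i,j,k\in\mathbb{Z}\}$. For $\omega\in\{0,1\}^{\mathbb Z}$, the decorated tiling $\hat{\mathcal T}(\omega)$ is obtained by labelling each tile $\hat R^i\circ\hat S^j\circ\hat T_k(\hat P)$ with the color $\omega_i$. **The sequences.** The bilateral Morse sequence: for $i\ge0$, $\omega_i$ is the parity of the sum of the binary digits of $i$, and $\omega_{-1-i}=\omega_i$. An Oxtoby sequence: given integers $p_i\ge 3$ ($i\ge1$) with $p_i\mid p_{i+1}$ and $\sum_i p_i/p_{i+1}\le 1/12$, let $E_i=\bigcup_{k\in\mathbb Z}\{m\in\mathbb Z: |m-kp_{i+1}|\le p_i\}$, $p(m)=\min\{i: m\in E_i\}$, and $\omega_m=0$ or $1$ according to the parity of $p(m)$. **Tiling space and hull.** Consider all tilings of $Sol(a,b)$ by left translates of the two decorated prototiles $(\hat P,0),(\hat P,1)$ (tiles cover, with pairwise disjoint interiors). $Sol(a,b)$ acts on left by translating tiles with their labels, and on the right by $\mathcal{S}\cdot g=g^{-1}(\mathcal{S})$. Topology: two tilings are close if, after left translating them by elements close to $e$, they have the same decorated tiles meeting a large ball centered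 at $e$ (this topology is metrizable). The continuous hull $\mathcal{M}(a,b,\omega)$ is the closure of the orbit $\{\hat{\mathcal T}(\omega)\cdot g: g\in Sol(a,b)\}$. **Lamination.** The foliation of $\mathcal{M}(a,b,\omega)$ by orbits is a transversely Cantor lamination if $\mathcal{M}(a,b,\omega)$ is covered by open flow boxes homeomorphic to $D\times T$, with $D$ an open ball in $\mathbb{R}^3$ and $T$ homeomorphic to an open subset of the Cantor set, whose plaques $D\times\{t\}$ lie in orbits and whose coordinate changes send plaques to plaques (smoothly along plaques), the leaves being the orbits. A minimal action is one with all orbits dense. *)

(* Defs.v *)
From HB Require Import structures.
From mathcomp Require Import all_boot all_order all_algebra.
From mathcomp Require Import all_classical all_reals all_analysis.

Set Implicit Arguments.
Unset Strict Implicit.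
Unset Printing Implicit Defensive.

Import Order.TTheory GRing.Theory Num.Theory.
Import numFieldNormedType.Exports.

Local Open Scope classical_set_scope.
Local Open Scope ring_scope.

Notation space3 R := (R * R * R)%type.

Definition Sol (R : realType) (a b : R) : Type := space3 R.

HB.instance Definition _ (R : realType) (a b : R) :=
  Topological.copy (Sol a b) (space3 R).

Definition sol_mul (R : realType) (a b : R) (g h : Sol a b) : Sol a b :=
  (g.1.1 + expR (a * g.2) * h.1.1,
   g.1.2 + expR (- b * g.2) * h.1.2,
   g.2 + h.2).

Definition sol_one (R : realType) (a b : R) : Sol a b := (0, 0, 0).

Definition sol_inv (R : realType) (a b : R) (g : Sol a b) : Sol a b :=
  (- expR (- a * g.2) * g.1.1, - expR (b * g.2) * g.1.2, - g.2).

Lemma sol_mulA (R : realType) (a b : R) : associative (@sol_mul R a b).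
Proof.
move=> g h k; rewrite /sol_mul /= !mulrDr !expRD !mulrA !addrA //.
Qed.

Lemma sol_mul1 (R : realType) (a b : R) :
  left_id (sol_one a b) (@sol_mul R a b).
Proof.
by case=> [[x y] z]; rewrite /sol_mul /= !mulr0 expR0 !mul1r !add0r.
Qed.

Lemma sol_1mul (R : realType) (a b : R) :
  right_id (sol_one a b) (@sol_mul R a b).
Proof.
by case=> [[x y] z]; rewrite /sol_mul /= !mulr0 !addr0.
Qed.

Lemma sol_mulV (R : realType) (a b : R) :
  left_inverse (sol_one a b) (@sol_inv R a b) (@sol_mul R a b).
Proof.
case=> [[x y] z]; rewrite /sol_mul /sol_inv /sol_one /=.
by rewrite !mulNr !mulrN opprK !addNr.
Qed.

Lemma sol_Vmul (R : realType) (a b : R) :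
  right_inverse (sol_one a b) (@sol_inv R a b) (@sol_mul R a b).
Proof.
case=> [[x y] z]; rewrite /sol_mul /sol_inv /sol_one /=.
rewrite !mulNr !mulrN !mulrA -!expRD !addrN.
by rewrite addNr expR0 !mul1r !addrN.
Qed.

HB.instance Definition _ (R : realType) (a b : R) :=
  isGroup.Build (Sol a b) (@sol_mulA R a b) (@sol_mul1 R a b)
    (@sol_1mul R a b) (@sol_mulV R a b) (@sol_Vmul R a b).

Definition C1_fun (R : realType) (f : R -> R) : Prop :=
  (forall t, derivable f t 1) /\ continuous (derive1 f).

(* Every C^1 arc on [0, 1] extends to a C^1 curve on R, so curves are taken
   on R and only their restriction to [0, 1] is measured. *)
Definition C1_curve (R : realType) (a b : R) (c : R -> Sol a b) : Prop :=
  [/\ C1_fun (fun t => (c t).1.1), C1_fun (fun t => (c t).1.2)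
    & C1_fun (fun t => (c t).2)].

Definition sol_length (R : realType) (a b : R) (c : R -> Sol a b) : R :=
  let x t := (c t).1.1 in let y t := (c t).1.2 in let z t := (c t).2 in
  Rintegral lebesgue_measure `[0, 1]
    (fun t => Num.sqrt (expR (- 2 * a * z t) * (derive1 x t) ^+ 2
                        + expR (2 * b * z t) * (derive1 y t) ^+ 2
                        + (derive1 z t) ^+ 2)).

Definition sol_dist (R : realType) (a b : R) (g h : Sol a b) : R :=
  inf [set sol_length c | c in
        [set c : R -> Sol a b | [/\ C1_curve c, c 0 = g & c 1 = h]]].

Definition sol_ball (R : realType) (a b r : R) : set (Sol a b) :=
  [set g | sol_dist 1%g g < r].
Arguments sol_ball {R} a b r.

Definition tau (R : realType) (x : R) : R := Num.sqrt (4 + x * (1 - x)).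

(* (alpha, beta) stands for the point alpha + i beta of the half-plane. *)
Definition pentagon (R : realType) : set (R * R) :=
  [set w | let: (alpha, beta) := w in
    [/\ 0 <= alpha <= 1,
        beta <= tau alpha,
        alpha <= 1 / 2 -> tau (2 * alpha) / 2 <= beta
      & 1 / 2 <= alpha -> tau (2 * alpha - 1) / 2 <= beta]].

Definition tile (R : realType) (a b : R) : set (Sol a b) :=
  [set g | exists alpha beta s, [/\ pentagon (alpha, beta), 0 <= s <= 1
                                  & g = (alpha, s, ln beta / a)]].
Arguments tile {R} a b.

Definition dtile (R : realType) (a b : R) : Type := (set (Sol a b) * bool)%type.

Definition ltrans (R : realType) (a b : R) (g : Sol a b) (A : set (Sol a b)) :
  set (Sol a b) := [set (g * h)%g | h in A].

Definition dltrans (R : realType) (a b : R) (g : Sol a b) (t : dtile a b) :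
  dtile a b := (ltrans g t.1, t.2).

Definition is_tiling (R : realType) (a b : R) (S : set (dtile a b)) : Prop :=
  [/\ forall t, S t -> exists g c, t = dltrans g (tile a b, c),
      \bigcup_(t in S) t.1 = setT
    & forall t t', S t -> S t' -> t <> t' -> t.1^° `&` t'.1^° = set0].

Record tiling (R : realType) (a b : R) := Tiling {
  tiles : set (dtile a b);
  tilingP : is_tiling tiles }.

Lemma tiling_eq (R : realType) (a b : R) (S S' : tiling a b) :
  tiles S = tiles S' -> S = S'.
Proof.
case: S S' => [S p] [S' p'] /= E; subst S'; congr Tiling.
exact: Prop_irrelevance.
Qed.

HB.instance Definition _ (R : realType) (a b : R) := gen_eqMixin (tiling a b).
HB.instance Definition _ (R : realType) (a b : R) :=
  gen_choiceMixin (tiling a b).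


Lemma continuous_mulg (R : realType) (a b : R) (g : Sol a b) :
  continuous (fun h : Sol a b => (g * h)%g).
Proof.
have cz : continuous (fun h : space3 R => h.2) by move=> h; exact: cvg_snd.
have cx : continuous (fun h : space3 R => h.1.1).
  by move=> h; apply: (@continuous_comp _ _ _ fst fst); exact: cvg_fst.
have cy : continuous (fun h : space3 R => h.1.2).
  by move=> h; apply: (@continuous_comp _ _ _ fst snd); [exact: cvg_fst|exact: cvg_snd].
suff H : continuous (fun h : space3 R => ((g.1.1 + expR (a * g.2) * h.1.1,
   g.1.2 + expR (- b * g.2) * h.1.2), g.2 + h.2) : space3 R) by exact: H.
move=> h.
have Hx : (g.1.1 + expR (a * g.2) * h0.1.1) @[h0 --> h] -->
    g.1.1 + expR (a * g.2) * h.1.1.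
  by apply: cvgD; [exact: cvg_cst|apply: cvgM; [exact: cvg_cst|exact: cx]].
have Hy : (g.1.2 + expR (- b * g.2) * h0.1.2) @[h0 --> h] -->
    g.1.2 + expR (- b * g.2) * h.1.2.
  by apply: cvgD; [exact: cvg_cst|apply: cvgM; [exact: cvg_cst|exact: cy]].
have Hz : (g.2 + h0.2) @[h0 --> h] --> g.2 + h.2.
  by apply: cvgD; [exact: cvg_cst|exact: cz].
exact: (cvg_pair (cvg_pair Hx Hy) Hz).
Qed.

Lemma interior_ltrans (R : realType) (a b : R) (g : Sol a b)
    (A : set (Sol a b)) :
  (ltrans g A)^° `<=` ltrans g A^°.
Proof.
move=> x xA; exists (g^-1 * x)%g; last by rewrite mulgA mulgV mul1g.
have : nbhs (g * (g^-1 * x))%g (ltrans g A) by rewrite mulgA mulgV mul1g.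
move=> xA'; have : nbhs (g^-1 * x)%g [set y | ltrans g A (g * y)%g].
  exact: continuous_mulg xA'.
by apply: filterS => y [h Ah] /mulgI <-.
Qed.

Lemma dltrans1 (R : realType) (a b : R) (t : dtile a b) : dltrans 1%g t = t.
Proof.
case: t => A c; rewrite /dltrans /ltrans /=; congr pair.
by under eq_imagel do rewrite mul1g; rewrite image_id.
Qed.

Lemma dltransM (R : realType) (a b : R) (g h : Sol a b) (t : dtile a b) :
  dltrans (g * h)%g t = dltrans g (dltrans h t).
Proof.
case: t => A c; rewrite /dltrans /ltrans /=; congr pair.
by rewrite image_comp; apply: eq_imagel => k _; rewrite /= mulgA.
Qed.

Lemma ltrans_is_tiling (R : realType) (a b : R) (g : Sol a b)
    (S : set (dtile a b)) :
  is_tiling S -> is_tiling (dltrans g @` S).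
Proof.
case=> tr cov disj; split.
- move=> _ [t /tr [h [c ->]] <-]; exists (g * h)%g, c; exact/esym/dltransM.
- apply/seteqP; split=> // x _.
  have [t St tx] : (\bigcup_(t in S) t.1) (g^-1 * x)%g by rewrite cov.
  exists (dltrans g t); first by exists t.
  by exists (g^-1 * x)%g => //; rewrite mulgA mulgV mul1g.
- move=> _ _ [t St <-] [t' St' <-] ne; apply/seteqP; split=> // x [].
  move=> /interior_ltrans [y ty <-] /interior_ltrans [y' ty' /mulgI E].
  have tt' : t <> t' by move=> E'; apply: ne; rewrite E'.
  have : (t.1^° `&` t'.1^°) y by split=> //; rewrite -E.
  by rewrite (disj _ _ St St' tt').
Qed.

Definition ltiling (R : realType) (a b : R) (g : Sol a b) (S : tiling a b) :
  tiling a b := Tiling (ltrans_is_tiling g (tilingP S)).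

Definition ract (R : realType) (a b : R) (S : tiling a b) (g : Sol a b) :
  tiling a b := ltiling g^-1%g S.

Lemma ract1 (R : realType) (a b : R) (S : tiling a b) : ract S 1%g = S.
Proof.
apply: tiling_eq; rewrite /= invg1.
by under eq_imagel do rewrite dltrans1; rewrite image_id.
Qed.

Lemma ractM (R : realType) (a b : R) (S : tiling a b) (g h : Sol a b) :
  ract S (g * h)%g = ract (ract S g) h.
Proof.
apply: tiling_eq; rewrite /= invgM image_comp.
by apply: eq_imagel => t _; rewrite dltransM.
Qed.

Definition same_near (R : realType) (a b r : R) (S S' : tiling a b) : Prop :=
  forall t : dtile a b, t.1 `&` sol_ball a b r !=set0 -> (tiles S t <-> tiles S' t).

Definition close (R : realType) (a b eps : R) (S S' : tiling a b) : Prop :=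
  exists g g', [/\ sol_ball a b eps g, sol_ball a b eps g'
                 & same_near eps^-1 (ltiling g S) (ltiling g' S')].

(* The topology is the one for which the sets close eps S are the basic
   neighbourhoods of S. *)
Definition open_tilings (R : realType) (a b : R) (U : set (tiling a b)) :
  Prop :=
  forall S, U S -> exists2 eps : R, 0 < eps & forall S', close eps S S' -> U S'.

Lemma close_le (R : realType) (a b e e' : R) (S S' : tiling a b) :
  0 < e -> e <= e' -> close e S S' -> close e' S S'.
Proof.
move=> e0 ee' [g [g' [/= gB gB' sn]]]; exists g, g'; split.
- exact: lt_le_trans gB ee'.
- exact: lt_le_trans gB' ee'.
- move=> t [x [tx /= xB]]; apply: sn; exists x; split=> //=.
  apply: lt_le_trans xB _; rewrite lef_pV2 ?posrE //; exact: lt_le_trans ee'.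
Qed.

Lemma open_tilingsT (R : realType) (a b : R) :
  open_tilings (@setT (tiling a b)).
Proof. by move=> S _; exists 1. Qed.

Lemma open_tilingsI (R : realType) (a b : R) :
  setI_closed (@open_tilings R a b).
Proof.
move=> U V oU oV S [/oU [e e0 eU] /oV [d d0 dV]].
have m0 : 0 < Num.min e d by rewrite lt_min e0.
exists (Num.min e d) => // S' cS; split.
  by apply: eU; apply: close_le cS => //; rewrite ge_min lexx.
by apply: dV; apply: close_le cS => //; rewrite ge_min lexx orbT.
Qed.

Lemma open_tilingsU (R : realType) (a b : R) (I : Type)
    (f : I -> set (tiling a b)) :
  (forall i, open_tilings (f i)) -> open_tilings (\bigcup_i f i).
Proof.
move=> of_ S [i _ /of_ [e e0 eU]]; exists e => // S' /eU fS'.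
by exists i.
Qed.

HB.instance Definition _ (R : realType) (a b : R) :=
  isOpenTopological.Build (tiling a b)
    (@open_tilingsT R a b) (@open_tilingsI R a b) (@open_tilingsU R a b).

Definition expgz (G : groupType) (g : G) (i : int) : G :=
  match i with Posz n => (g ^+ n)%g | Negz n => (g ^- n.+1)%g end.

Definition gen_R (R : realType) (a b : R) : Sol a b := (0, 0, ln 2 / a).
Definition gen_S (R : realType) (a b : R) : Sol a b := (1, 0, 0).
Definition gen_T (R : realType) (a b s : R) : Sol a b := (0, s, 0).
Arguments gen_R {R} a b.
Arguments gen_S {R} a b.
Arguments gen_T {R} a b s.

Definition decorated_tiling (R : realType) (a b : R) (w : int -> bool) :
  set (dtile a b) :=
  [set t | exists i j k : int,
     t = dltrans (expgz (gen_R a b) i * expgz (gen_S a b) j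
                  * gen_T a b k%:~R)%g (tile a b, w i)].
Arguments decorated_tiling {R} a b w.

(* Stated on underlying tile sets, so that no proof that the model is a tiling
   is needed here: were it not one, the orbit and the hull would be empty. *)
Definition model_orbit (R : realType) (a b : R) (w : int -> bool) :
  set (tiling a b) :=
  [set S | exists g : Sol a b,
     tiles S = dltrans g^-1%g @` decorated_tiling a b w].

Definition hull (R : realType) (a b : R) (w : int -> bool) :
  set (tiling a b) := closure (model_orbit w).
Arguments hull {R} a b w.

(* Colours 0 and 1 are encoded as false and true. Bits of index at least i
   vanish because i < 2 ^ i. *)
Definition thue_morse (i : nat) : bool := odd (\sum_(k < i) (i %/ 2 ^ k) %% 2).

(* Negz n is the integer - 1 - n. *)
Definition morse (i : int) : bool :=
  match i with Posz n => thue_morse n | Negz n => thue_morse n end.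

Definition oxtoby_set (p : nat -> nat) (i : nat) : set int :=
  [set m | exists k : int, `|m - k * (p i.+1)%:Z| <= (p i)%:Z].

Definition oxtoby (R : realType) (w : int -> bool) : Prop :=
  exists p : nat -> nat,
    [/\ forall i, (1 <= i)%N -> (3 <= p i)%N /\ (p i %| p i.+1)%N,
        (\sum_(1 <= i <oo) ((p i)%:R / (p i.+1)%:R : R)%:E <= (12^-1)%:E)%E
      & forall m : int, exists i : nat,
          [/\ (1 <= i)%N, oxtoby_set p i m,
              forall j, (1 <= j < i)%N -> ~ oxtoby_set p j m
            & w m = odd i]].

Definition metrizable (R : realType) (M : topologicalType) : Prop :=
  exists (X : metricType R) (f : M -> X) (g : X -> M),
    [/\ cancel f g, cancel g f, continuous f & continuous g].

Definition space_ball (R : realType) (c : space3 R) (r : R) : set (space3 R) :=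
  [set v | (v.1.1 - c.1.1) ^+ 2 + (v.1.2 - c.1.2) ^+ 2 + (v.2 - c.2) ^+ 2
           < r ^+ 2].

Definition iter_derive (R : realType) (vs : seq (space3 R))
    (f : space3 R -> space3 R) : space3 R -> space3 R :=
  foldr (fun v h => fun x => 'D_v h x) f vs.

Definition smooth_on (R : realType) (U : set (space3 R))
    (f : space3 R -> space3 R) : Prop :=
  forall vs x, U x ->
    {for x, continuous (iter_derive vs f)} /\
    forall v, derivable (iter_derive vs f) x v.

(* fb_map and fb_inv are mutually inverse homeomorphisms between fb_dom and
   the product of an open Euclidean ball with an open part of the Cantor
   space; their values elsewhere are irrelevant. *)
Record flow_box (R : realType) (M : topologicalType) := FlowBox {
  fb_dom : set M;
  fb_center : space3 R;
  fb_radius : R;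
  fb_trans : set cantor_space;
  fb_map : M -> space3 R * cantor_space;
  fb_inv : space3 R * cantor_space -> M;
  fb_dom_open : open fb_dom;
  fb_radius_gt0 : 0 < fb_radius;
  fb_trans_open : open fb_trans;
  fb_map_fun : set_fun fb_dom (space_ball fb_center fb_radius `*` fb_trans)
                 fb_map;
  fb_inv_fun : set_fun (space_ball fb_center fb_radius `*` fb_trans) fb_dom
                 fb_inv;
  fb_mapK : {in fb_dom, cancel fb_map fb_inv};
  fb_invK : {in space_ball fb_center fb_radius `*` fb_trans,
              cancel fb_inv fb_map};
  fb_map_cont : {within fb_dom, continuous fb_map};
  fb_inv_cont : {within space_ball fb_center fb_radius `*` fb_trans,
                  continuous fb_inv} }.

Definition plaque (R : realType) (M : topologicalType) (B : flow_box R M)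
    (t : cantor_space) : set M :=
  [set fb_inv B (x, t) | x in space_ball (fb_center B) (fb_radius B)].

(* The coordinate change has the form (x, t) |-> (f x t, h t), and is smooth
   in x for each fixed t. *)
Definition compatible (R : realType) (M : topologicalType)
    (B B' : flow_box R M) : Prop :=
  {in fb_dom B `&` fb_dom B' &, forall q q',
     (fb_map B q).2 = (fb_map B q').2 -> (fb_map B' q).2 = (fb_map B' q').2} /\
  (forall t, fb_trans B t ->
     smooth_on [set x | space_ball (fb_center B) (fb_radius B) x /\
                        fb_dom B' (fb_inv B (x, t))]
       (fun x => (fb_map B' (fb_inv B (x, t))).1)).

Inductive leaf (R : realType) (M : topologicalType) (atlas : set (flow_box R M))
    (p : M) : M -> Prop :=
  | leaf_refl : leaf atlas p p
  | leaf_plaque B t q q' : leaf atlas p q -> atlas B -> fb_trans B t ->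
      plaque B t q -> plaque B t q' -> leaf atlas p q'.

Definition transversely_Cantor_lamination (R : realType) (M : topologicalType)
    (orb : M -> set M) : Prop :=
  exists atlas : set (flow_box R M),
    [/\ \bigcup_(B in atlas) fb_dom B = setT,
        forall B t, atlas B -> fb_trans B t -> exists p, plaque B t `<=` orb p,
        forall B B', atlas B -> atlas B' -> compatible B B'
      & forall p, leaf atlas p = orb p].

Definition hull_orbit (R : realType) (a b : R) (w : int -> bool)
    (S : hull a b w) : set (hull a b w) :=
  [set S' | exists g, set_val S' = ract (set_val S) g].

(* Main.v *)
(* Write lam = ln 2 / a and nu = exp (- b lam), so that nu is n or 1/n. Up to a left translation,
   a limit of translates of the model tiling is made of layers indexed by Z: layer i is a copy of
   the planar pattern, scaled by 2^i in x and by nu^i in y, with colour eta_i and placed at an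
   offset (u_i, v_i) modulo 2^i Z x nu^i Z. Here eta runs over the orbit closure X of w under the
   shift, and the compatibility of consecutive offsets makes u and v points of a 2-adic and an
   n-adic solenoid. Normalizing u_0 = v_0 = 0 leaves the transversal X x Z_2 x Z_n, coded by
   sequences of finitely many symbols; it has no isolated point because of the factor Z_2, hence
   it is a Cantor set. The map Phi (p, x) = p L(x), for L(x) the layered tiling of code x, is
   continuous, open onto the hull, onto already for p in a compact box, and injective for p in a
   small ball: it provides compactness and the flow boxes, in which changes of coordinates are
   right translations. Both sequences are uniformly recurrent and aperiodic. Recurrence, with
   the approximation of a solenoid point by a single translation, gives minimality. For
   freeness, an element fixing a tiling cannot shift the layers, by aperiodicity, and then it
   translates by an element of all the lattices 2^i Z x nu^i Z, which is 0. *)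
Require Import Defs.
From HB Require Import structures.
From mathcomp Require Import all_boot all_order all_algebra.
From mathcomp Require Import all_classical all_reals all_analysis.
From mathcomp Require Import zify ring lra.
(* After the libraries, whose [close] would otherwise hide the relation on tilings. *)
Import Defs.

Set Implicit Arguments.
Unset Strict Implicit.
Unset Printing Implicit Defensive.

Import Order.TTheory GRing.Theory Num.Theory.
Import numFieldNormedType.Exports.

Local Open Scope classical_set_scope.
Local Open Scope ring_scope.

(** * The left invariant metric and Euclidean boxes *)

Section Speed.
Context {R : realType}.
Implicit Types (f F s : R -> R).

(** Three obstacles shape the proof. The metric is an infimum of lengths; it enters only through the
    comparison of its balls about the identity with coordinate boxes, after which all estimates are
    explicit computations in the group. The relation [close] is not a distance, and it moves both
    tilings; its transitivity and its separation of tilings are therefore proved directly, and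
    metrizability comes from the uniformity they define, which has a countable base. Finally, the
    hull is a closure in a space of tilings about which little is known: it is identified as the
    image of a compact set under [Phi], closed because distinct tilings have disjoint
    neighbourhoods. The two coordinates play different roles. In x, compatibility of the offsets is
    what makes the two bottom arcs of a tile fit the tops of two tiles of the layer below. In y, it
    is a trace of the model tiling that survives in its limits. Both are handled by the same
    solenoid lemmas, stated for a ratio N or 1/N. *)

Lemma continuous_itv_integrable f (x y : R) : continuous f ->
  (@lebesgue_measure R).-integrable `[x, y] (EFin \o f).
Proof.
move=> cf; apply: continuous_compact_integrable; first exact: segment_compact.
exact: continuous_subspaceT.
Qed.

Lemma C1_fun_continuous F : C1_fun F -> continuous F.
Proof. by move=> [dF _] x; apply: differentiable_continuous; apply/derivable1_diffP/dF. Qed.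

Lemma C1_fun_FTC F (t : R) : 0 < t -> C1_fun F ->
  Rintegral lebesgue_measure `[0, t] (derive1 F) = F t - F 0.
Proof.
move=> t0 CF; have [dF cF] := CF; rewrite /Rintegral.
rewrite (@continuous_FTC2 _ (derive1 F) F) ?EFinB//.
- exact: continuous_subspaceT.
- split; first by move=> x _; exact: dF.
  + exact/cvg_at_right_filter/C1_fun_continuous.
  + exact/cvg_at_left_filter/C1_fun_continuous.
Qed.

(** Intermediate times t are allowed because the bound on z is needed along the whole curve: it
    controls the exponential weights of the x and y components. *)
Lemma C1_fun_le_speed F s (K t : R) : 0 <= K -> C1_fun F -> continuous s ->
  (forall u, 0 <= s u) -> 0 <= t <= 1 ->
  (forall u, 0 <= u <= t -> `|derive1 F u| <= K * s u) ->
  `|F t - F 0| <= K * Rintegral lebesgue_measure `[0, 1] s.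
Proof.
move=> K0 CF cs s0 /andP[t0 t1] Fs.
have I0 : 0 <= Rintegral lebesgue_measure `[0, 1] s by exact: Rintegral_ge0.
move: t0; rewrite le_eqVlt => /predU1P[<-|t0].
  by rewrite subrr normr0 mulr_ge0.
rewrite -(C1_fun_FTC t0 CF).
have cD := CF.2.
apply: le_trans; first exact/le_normr_Rintegral/continuous_itv_integrable.
have -> : K * Rintegral lebesgue_measure `[0, 1] s =
  Rintegral lebesgue_measure `[0, 1] (fun u => K * s u).
  by rewrite RintegralZl//; exact: continuous_itv_integrable.
have cKs : continuous (fun u => K * s u).
  by move=> u; apply: cvgM; [exact: cvg_cst|exact: cs].
apply: (@le_trans _ _ (Rintegral lebesgue_measure `[0, t] (fun u => K * s u))).
  apply: le_Rintegral => //.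
  - apply: (@continuous_itv_integrable (fun u => `|derive1 F u|)) => u.
    by apply: continuous_comp; [exact: cD|exact: norm_continuous].
  - exact: continuous_itv_integrable.
rewrite /Rintegral fine_le//.
- by apply: integrable_fin_num => //; exact: continuous_itv_integrable.
- by apply: integrable_fin_num => //; exact: continuous_itv_integrable.
apply: ge0_subset_integral => //.
- by apply: measurable_int; apply: (@continuous_itv_integrable (fun u => K * s u)).
- by move=> u _; rewrite lee_fin mulr_ge0.
- by move=> u /=; rewrite !in_itv/= => /andP[-> /le_trans->].
Qed.

End Speed.

Section Boxes.
Context {R : realType} {a b : R}.
Hypothesis a0 : 0 < a.
Local Notation Sol := (Sol a b).
Local Notation K := (a + `|b|).

Definition box (c : R) : set Sol :=
  [set g | [/\ `|g.1.1| < c, `|g.1.2| < c & `|g.2| < c]].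

Lemma box_le c d : c <= d -> box c `<=` box d.
Proof. by move=> cd g [x y z]; split; exact: lt_le_trans cd. Qed.

Let speed (c : R -> Sol) (t : R) := Num.sqrt
  (expR (- 2 * a * (c t).2) * (derive1 (fun t => (c t).1.1) t) ^+ 2
   + expR (2 * b * (c t).2) * (derive1 (fun t => (c t).1.2) t) ^+ 2
   + (derive1 (fun t => (c t).2) t) ^+ 2).

Let continuous_speed c : C1_curve c -> continuous (speed c).
Proof.
move=> [Cx Cy Cz] t; rewrite /speed /continuous_at /=.
apply: (@cvg_comp _ _ _ _ (@Num.sqrt R)); last exact: sqrt_continuous.
have cz := C1_fun_continuous Cz.
apply: cvgD; first apply: cvgD.
- apply: cvgM; last by apply: cvgM; exact: Cx.2.
  apply: continuous_comp; last exact: continuous_expR.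
  by apply: cvgM; [exact: cvg_cst|exact: cz].
- apply: cvgM; last by apply: cvgM; exact: Cy.2.
  apply: continuous_comp; last exact: continuous_expR.
  by apply: cvgM; [exact: cvg_cst|exact: cz].
- by apply: cvgM; exact: Cz.2.
Qed.

(** A curve of length less than r keeps |z| < r, so the weights e^(- a z) and e^(b z) of the speed
    are at least e^(- K r); hence the derivatives of x and y are at most e^(K r) times the speed. *)
Let length_box (c : R -> Sol) (r : R) : C1_curve c -> c 0 = 1%g ->
  sol_length c < r -> `|(c 1).2| < r /\
   `|(c 1).1.1| <= expR (K * r) * r /\ `|(c 1).1.2| <= expR (K * r) * r.
Proof.
move=> Cc c0 cr; have [Cx Cy Cz] := Cc; have cs := continuous_speed Cc.
have s0 u : 0 <= speed c u by exact: sqrtr_ge0.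
have lE : sol_length c = Rintegral lebesgue_measure `[0, 1] (speed c) by [].
have L0 : 0 <= sol_length c by rewrite lE; exact: Rintegral_ge0.
have e1 x : 0 <= expR x * 1 ^+2 by rewrite mulr_ge0 ?expR_ge0// expr1n.
have zle t : 0 <= t <= 1 -> `|(c t).2| <= sol_length c.
  move=> t01.
  have := @C1_fun_le_speed R (fun t => (c t).2) (speed c) 1 t ler01 Cz cs s0 t01.
  rewrite lE mul1r c0/= subr0; apply => u _.
  rewrite mul1r -sqrtr_sqr ler_wsqrtr// lerDr addr_ge0// mulr_ge0 ?sqr_ge0 ?expR_ge0//.
have K0 : 0 <= K by rewrite addr_ge0// ltW.
have r0 : 0 < r by exact: le_lt_trans cr.
split; first by apply: le_lt_trans cr; apply: zle; rewrite ler01 lexx.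
have aux (F : R -> R) (d : R) : `|d| <= K -> C1_fun F -> F 0 = 0 ->
   (forall u, 0 <= u <= 1 -> expR (d * (c u).2) * `|derive1 F u| <= speed c u) ->
   `|F 1| <= expR (K * r) * r.
  move=> dK CF F0 H; rewrite -[F 1]subr0 -F0.
  apply: (@le_trans _ _ (expR (K * r) * sol_length c)); last first.
    by rewrite ler_wpM2l ?expR_ge0// ltW.
  rewrite lE; apply: C1_fun_le_speed; rewrite ?expR_ge0 ?ler01 ?lexx// => u u01; apply: (@le_trans _ _ (expR (K * r) * (expR (d * (c u).2) * `|derive1 F u|))).
    rewrite mulrA -expRD ler_peMl//.
    rewrite -expR0 ler_expR -lerBlDr sub0r.
    apply: (@le_trans _ _ `|d * (c u).2|); first by rewrite -normrN; exact: ler_norm.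
    by rewrite normrM ler_pM// (le_trans (zle _ u01))// ltW.
  by rewrite ler_wpM2l ?expR_ge0// H.
split.
- apply: (aux (fun t => (c t).1.1) (-a)) => //.
  + by rewrite normrN gtr0_norm// lerDl.
  + by rewrite c0.
  move=> u _; rewrite -[leLHS]ger0_norm ?mulr_ge0 ?expR_ge0// -sqrtr_sqr ler_wsqrtr//.
  rewrite exprMn -expRM_natl real_normK ?num_real// -addrA.
  have -> : 2 * (- a * (c u).2) = - 2 * a * (c u).2 by ring.
  by rewrite lerDl addr_ge0 ?sqr_ge0// mulr_ge0 ?sqr_ge0 ?expR_ge0.
- apply: (aux (fun t => (c t).1.2) b) => //.
  + by rewrite lerDr ltW.
  + by rewrite c0.
  move=> u _; rewrite -[leLHS]ger0_norm ?mulr_ge0 ?expR_ge0// -sqrtr_sqr ler_wsqrtr//.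
  rewrite exprMn -expRM_natl real_normK ?num_real// addrAC.
  have -> : 2 * (b * (c u).2) = 2 * b * (c u).2 by ring.
  by rewrite lerDr addr_ge0 ?sqr_ge0// mulr_ge0 ?sqr_ge0 ?expR_ge0.
Qed.

(** Not a geodesic in general; an upper bound on the distance requires no more than one explicit
    curve. *)
Let line (g : Sol) (t : R) : Sol := (t * g.1.1, t * g.1.2, t * g.2).

Let C1_scale (x : R) : C1_fun (fun t : R => t * x) /\ forall t, derive1 (fun t : R => t * x) t = x.
Proof.
have H t : is_derive t (1:R) (fun t : R => t * x) x.
  by apply: is_derive_eq; rewrite /GRing.scale/= mulr0 add0r mulr1.
have E t : derive1 (fun t : R => t * x) t = x by rewrite derive1E derive_val.
split=> //; split; first by move=> t; apply: ex_derive.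
by rewrite (_ : derive1 _ = cst x); [exact: cst_continuous|apply/funext].
Qed.

Let lineP (g : Sol) : [/\ C1_curve (line g), line g 0 = 1%g & line g 1 = g].
Proof.
split.
- by split; exact: (C1_scale _).1.
- by rewrite /line !mul0r.
- by case: g => [[x y] z]; rewrite /line !mul1r.
Qed.

Let length_line (g : Sol) c : box c g -> sol_length (line g) <= expR (K * c) * (3 * c).
Proof.
move=> [gx gy gz]; have [[Cx Cy Cz] _ _] := lineP g.
have [Cc _ _] := lineP g.
have c0 : 0 < c by exact: le_lt_trans gx.
rewrite -[leRHS]mulr1.
have <- : Rintegral lebesgue_measure `[(0:R), 1] (cst (expR (K * c) * (3 * c))) =
  expR (K * c) * (3 * c) * 1.
  by rewrite Rintegral_cst//= lebesgue_measure_itv/= lte_fin ltr01/= subr0.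
apply: le_Rintegral => //.
- by apply: (@continuous_itv_integrable _ (speed (line g))); exact: continuous_speed.
- by apply: continuous_itv_integrable => x; exact: cvg_cst.
move=> t /=; rewrite in_itv/= => /andP[t0 t1].
have M0 : 0 <= expR (K * c) * (3 * c) by rewrite mulr_ge0 ?expR_ge0// mulr_ge0// ltW.
rewrite -(ger0_norm M0) -sqrtr_sqr ler_wsqrtr//.
rewrite !(C1_scale _).2 exprMn -expRM_natl.
have tz : `|t * g.2| <= c.
  by rewrite normrM (ger0_norm t0) -[c]mul1r ler_pM// ltW.
have sq x : `|x| < c -> x ^+ 2 <= c ^+ 2.
  by move=> xc; rewrite -real_normK ?num_real// ler_sqr ?nnegrE// ltW.
have K0 : 0 <= K by rewrite addr_ge0// ltW.
have E d : `|d| <= K -> expR (2 * d * (t * g.2)) <= expR (2 * (K * c)).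
  move=> dK; rewrite ler_expR -mulrA ler_pM2l//.
  by rewrite (le_trans (ler_norm _))// normrM ler_pM.
have E0 : 1 <= expR (2 * (K * c)).
  by rewrite -expR0 ler_expR mulr_ge0// mulr_ge0// ltW.
have c2 : 0 <= c ^+ 2 by exact: sqr_ge0.
have H1 : expR (- 2 * a * (t * g.2)) * g.1.1 ^+ 2 <= expR (2 * (K * c)) * c ^+ 2.
  rewrite ler_pM ?expR_ge0 ?sqr_ge0 ?sq// (_ : - 2 * a = 2 * - a) ?E//; last by ring.
  by rewrite normrN gtr0_norm// lerDl.
have H2 : expR (2 * b * (t * g.2)) * g.1.2 ^+ 2 <= expR (2 * (K * c)) * c ^+ 2.
  by rewrite ler_pM ?expR_ge0 ?sqr_ge0 ?sq// E// lerDr ltW.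
have H3 : g.2 ^+ 2 <= expR (2 * (K * c)) * c ^+ 2.
  by rewrite -[leLHS]mul1r ler_pM ?sqr_ge0 ?sq.
apply: (le_trans (lerD (lerD H1 H2) H3)).
(* The bound 3 c, rather than sqrt 3 times c, avoids a square root: the three terms are compared
   with 9 of them. *)
rewrite exprMn [leRHS](_ : _ = expR (2 * (K * c)) * c ^+ 2 * 9); last by ring.
have : 0 <= expR (2 * (K * c)) * c ^+ 2 by rewrite mulr_ge0 ?expR_ge0.
lra.
Qed.

Let dist_set (g : Sol) := [set sol_length c | c in
  [set c : R -> Sol | [/\ C1_curve c, c 0 = 1%g & c 1 = g]]].

Let has_inf_dist g : has_inf (dist_set g).
Proof.
split; first by exists (sol_length (line g)), (line g) => //; exact: lineP.
by exists 0 => _ [c _ <-]; apply: Rintegral_ge0 => t _; exact: sqrtr_ge0.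
Qed.

Lemma sol_ball_box (r : R) : 0 < r ->
  sol_ball a b r `<=` box (expR (K * r) * (2 * r)).
Proof.
move=> r0 g; rewrite /sol_ball/= => /(inf_lt (has_inf_dist g).1) [_ [c [Cc c0 c1] <-]].
move=> /(length_box Cc c0); rewrite c1 => -[gz [gx gy]].
have E0 : 1 <= expR (K * r).
  by rewrite -expR0 ler_expR mulr_ge0// ?addr_ge0// ltW.
(* The factor 2 turns the weak bounds of [length_box] on x and y into strict ones. *)
have Er : expR (K * r) * r < expR (K * r) * (2 * r).
  by rewrite ltr_pM2l ?expR_gt0// mulr_natl mulr2n ltrDl.
split; [exact: le_lt_trans gx _|exact: le_lt_trans gy _|].
by apply: lt_trans gz _; apply: le_lt_trans Er; rewrite ler_peMl// ltW.
Qed.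

Lemma box_sol_ball (c r : R) : expR (K * c) * (3 * c) < r ->
  box c `<=` sol_ball a b r.
Proof.
move=> cr g gc; apply: le_lt_trans cr; apply: le_trans (length_line gc).
by apply: inf_lbound; [exact: (has_inf_dist g).2|exists (line g) => //; exact: lineP].
Qed.
End Boxes.

(** * Continuity of the group operations *)

Section Group.
Context {R : realType} {a b : R}.
Local Notation Sol := (Sol a b).

Lemma sol_mulE (g h : Sol) : (g * h)%g =
  (g.1.1 + expR (a * g.2) * h.1.1, g.1.2 + expR (- b * g.2) * h.1.2, g.2 + h.2).
Proof. by []. Qed.

Lemma sol_invE (g : Sol) : (g^-1)%g =
  (- expR (- a * g.2) * g.1.1, - expR (b * g.2) * g.1.2, - g.2).
Proof. by []. Qed.

Lemma sol_divE (g h : Sol) : (g^-1 * h)%g =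
  (expR (- a * g.2) * (h.1.1 - g.1.1), expR (b * g.2) * (h.1.2 - g.1.2), h.2 - g.2).
Proof.
rewrite sol_mulE sol_invE/=.
have -> : a * - g.2 = - a * g.2 by ring.
have -> : - b * - g.2 = b * g.2 by ring.
by congr (_, _, _); ring.
Qed.

Lemma cvg_sol T (F : set_system T) (FF : Filter F) (f : T -> Sol) (g : Sol) :
  (f t).1.1 @[t --> F] --> g.1.1 -> (f t).1.2 @[t --> F] --> g.1.2 ->
  (f t).2 @[t --> F] --> g.2 -> f @ F --> g.
Proof.
move=> fx fy fz; have := cvg_pair (cvg_pair fx fy) fz.
rewrite (_ : (fun t => _) = f); last by apply/funext => t; case: (f t) => [[]].
move=> H; have -> : g = (g.1.1, g.1.2, g.2) by case: (g) => [[]].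
exact: H.
Qed.

Lemma cvg_solP T (F : set_system T) (FF : Filter F) (f : T -> Sol) (g : Sol) :
  f @ F --> g -> [/\ (f t).1.1 @[t --> F] --> g.1.1,
    (f t).1.2 @[t --> F] --> g.1.2 & (f t).2 @[t --> F] --> g.2].
Proof.
move=> fg; have fg1 : (f t).1 @[t --> F] --> g.1.
  by apply: (@cvg_comp _ _ _ f fst); [exact: fg|exact: cvg_fst].
split.
- by apply: (@cvg_comp _ _ _ (fst \o f) fst); [exact: fg1|exact: cvg_fst].
- by apply: (@cvg_comp _ _ _ (fst \o f) snd); [exact: fg1|exact: cvg_snd].
- by apply: (@cvg_comp _ _ _ f snd); [exact: fg|exact: cvg_snd].
Qed.

Lemma cvg_solM T (F : set_system T) (FF : Filter F) (f f' : T -> Sol) (g g' : Sol) :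
  f @ F --> g -> f' @ F --> g' -> (f t * f' t)%g @[t --> F] --> (g * g')%g.
Proof.
move=> /cvg_solP[fx fy fz] /cvg_solP[fx' fy' fz'].
have ce (c : R) : expR (c * (f t).2) @[t --> F] --> expR (c * g.2).
  apply: continuous_cvg; first exact: continuous_expR.
  by apply: cvgM => //; exact: cvg_cst.
apply: cvg_sol; rewrite !sol_mulE/=.
- by apply: cvgD => //; apply: cvgM => //; exact: ce.
- by apply: cvgD => //; apply: cvgM => //; exact: ce.
- exact: cvgD.
Qed.

Lemma cvg_solV T (F : set_system T) (FF : Filter F) (f : T -> Sol) (g : Sol) :
  f @ F --> g -> ((f t)^-1)%g @[t --> F] --> (g^-1)%g.
Proof.
move=> /cvg_solP[fx fy fz].
have ce (c : R) : expR (c * (f t).2) @[t --> F] --> expR (c * g.2).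
  apply: continuous_cvg; first exact: continuous_expR.
  by apply: cvgM => //; exact: cvg_cst.
apply: cvg_sol; rewrite !sol_invE/=.
- by apply: cvgM => //; apply: cvgN; exact: ce.
- by apply: cvgM => //; apply: cvgN; exact: ce.
- exact: cvgN.
Qed.

Lemma nbhs_box (c : R) : 0 < c -> nbhs (1%g : Sol) (box c).
Proof.
move=> c0; have [cx cy cz] := @cvg_solP Sol (nbhs (1%g : Sol)) _ id 1%g (@cvg_id _ _).
have B (f : Sol -> R) : f t @[t --> (1%g : Sol)] --> (0 : R) -> \forall t \near (1%g : Sol), `|f t| < c.
  by move=> /cvgr0_norm_lt; apply.
near=> g; split; near: g; exact: B.
Unshelve. all: by end_near. Qed.

Lemma nbhs1P (U : set Sol) : nbhs (1%g : Sol) U -> exists2 c : R, 0 < c & box c `<=` U.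
Proof.
move=> U1; have : nbhs ((0, 0, 0) : space3 R) U by exact: U1.
move=> /nbhs_ballP [c /= c0 cU]; exists c => // g [gx gy gz]; apply: cU.
by split; [split|]; rewrite /ball/= sub0r normrN.
Qed.

Lemma ltiling_tiles (g : Sol) (S : tiling a b) t :
  tiles (ltiling g S) t <-> tiles S (dltrans g^-1%g t).
Proof.
split=> [[t' St' <-]|St]; first by rewrite -dltransM mulVg dltrans1.
by exists (dltrans g^-1%g t) => //; rewrite -dltransM mulgV dltrans1.
Qed.

Lemma ltilingM (g h : Sol) (S : tiling a b) : ltiling (g * h)%g S = ltiling g (ltiling h S).
Proof.
apply: tiling_eq => /=; rewrite image_comp.
by apply: eq_imagel => t _; rewrite dltransM.
Qed.

Lemma ltiling1 (S : tiling a b) : ltiling 1%g S = S.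
Proof.
apply: tiling_eq; rewrite /=.
by under eq_imagel do rewrite dltrans1; rewrite image_id.
Qed.

Lemma sol_ball_le (r s : R) : r <= s -> sol_ball a b r `<=` sol_ball a b s.
Proof. by move=> rs g /= gr; exact: lt_le_trans rs. Qed.

End Group.

(** * Closeness of tilings as a uniform structure *)

Section Close.
Context {R : realType} {a b : R}.
Hypothesis a0 : 0 < a.
Local Notation Sol := (Sol a b).
Local Notation K := (a + `|b|).

Let K0 : 0 < K. Proof. by rewrite ltr_pwDl. Qed.

Lemma sol_ball_small (c : R) : 0 < c -> exists2 r, 0 < r & sol_ball a b r `<=` box c.
Proof.
move=> c0; pose r := Num.min 1 (c / (2 * expR K)).
have r0 : 0 < r by rewrite lt_min ltr01 divr_gt0// mulr_gt0// expR_gt0.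
exists r => //; apply: subset_trans (sol_ball_box a0 r0) _; apply: box_le.
have r1 : r <= 1 by rewrite ge_min lexx.
have : r <= c / (2 * expR K) by rewrite ge_min lexx orbT.
rewrite ler_pdivlMr ?mulr_gt0 ?expR_gt0// => rc; apply: le_trans rc.
rewrite mulrC mulrA (mulrC 2) ler_wpM2l ?mulr_ge0 ?(ltW r0)// ler_expR.
by rewrite ler_piMr// ltW.
Qed.

Lemma sol_ball_bounded (r : R) : exists2 c, 0 < c & sol_ball a b r `<=` box c.
Proof.
pose r' := Num.max 1 r; have r0 : 0 < r' by rewrite lt_max ltr01.
exists (expR (K * r') * (2 * r')); first by rewrite mulr_gt0 ?expR_gt0// mulr_gt0.
apply: subset_trans (sol_ball_box a0 r0); apply: sol_ball_le.
by rewrite le_max lexx orbT.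
Qed.

Lemma box_ball_small (r : R) : 0 < r -> exists2 c, 0 < c & box c `<=` sol_ball a b r.
Proof.
move=> r0; pose c := Num.min 1 (r / (4 * expR K)).
have c0 : 0 < c by rewrite lt_min ltr01 divr_gt0// mulr_gt0// expR_gt0.
exists c => //; apply: (box_sol_ball a0).
have c1 : c <= 1 by rewrite ge_min lexx.
have : c <= r / (4 * expR K) by rewrite ge_min lexx orbT.
rewrite ler_pdivlMr ?mulr_gt0 ?expR_gt0// => rc; apply: lt_le_trans rc.
rewrite mulrC [ltRHS]mulrA; apply: (@le_lt_trans _ _ (3 * c * expR K)).
  by rewrite ler_wpM2l ?mulr_ge0 ?(ltW c0)// ler_expR ler_piMr// ltW.
by rewrite ltr_pM2r ?expR_gt0// mulrC ltr_pM2l// ltr_nat.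
Qed.

Lemma box_ball_large (c : R) : exists2 r, 0 < r & box c `<=` sol_ball a b r.
Proof.
exists (`|expR (K * c) * (3 * c)| + 1); first by rewrite ltr_wpDl.
by apply: (box_sol_ball a0); apply: le_lt_trans (ler_norm _) _; rewrite ltrDl.
Qed.

Lemma sol_ball1 (r : R) : 0 < r -> sol_ball a b r 1%g.
Proof.
by move=> /box_ball_small[c c0]; apply; split => /=; rewrite normr0.
Qed.

Lemma close_sym (eps : R) (S S' : tiling a b) : close eps S S' -> close eps S' S.
Proof.
move=> [g [g' [gB gB' sn]]]; exists g', g; split=> // t tB.
by apply: iff_sym; exact: sn.
Qed.

Lemma close_refl (eps : R) (S : tiling a b) : 0 < eps -> close eps S S.
Proof. by move=> e0; exists 1%g, 1%g; split=> //; exact: sol_ball1. Qed.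

(** Takes the place of the triangle inequality for [sol_dist], whose proof would require joining two
    C^1 curves into one: tiles seen in a bounded region stay in a bounded region after a small left
    translation. *)
Lemma box_mul_bounded (c : R) : exists C, forall g h k : Sol,
  box 1 g -> box 1 h -> box c k -> box C (h * g^-1 * k)%g.
Proof.
exists (expR (4 * K) * (4 + `|c|)) => g h k [g1 g2 g3] [h1 h2 h3] [k1 k2 k3].
have c0 : 0 < c by exact: le_lt_trans k1.
have E (d z : R) : `|d| <= K -> `|z| <= 2 -> expR (d * z) <= expR (4 * K) .
  move=> dK z2; rewrite ler_expR (le_trans (ler_norm _))// normrM mulrC.
  apply: (@le_trans _ _ (2 * K)); first by rewrite ler_pM.
  by rewrite ler_pM2r// ler_nat.
have E1 : 1 <= expR (4 * K) by rewrite -expR0 ler_expR mulr_ge0// ltW.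
have E0 : 0 < expR (4 * K) by exact: expR_gt0.
rewrite -mulgA sol_divE sol_mulE (gtr0_norm c0).
have aK : `|a| <= K by rewrite gtr0_norm// lerDl.
have bK : `|- b| <= K by rewrite normrN lerDr ltW.
have H (d h1' g1' k1' : R) : `|d| <= K -> `|h1'| < 1 -> `|g1'| < 1 -> `|k1'| < c ->
   `|h1' + expR (d * h.2) * (expR (- d * g.2) * (k1' - g1'))| < expR (4 * K) * (4 + c).
  move=> dK hh gg kk; rewrite mulrA -expRD.
  have -> : d * h.2 + - d * g.2 = d * (h.2 - g.2) by ring.
  apply: (le_lt_trans (ler_normD _ _)); rewrite normrM (ger0_norm (expR_ge0 _)).
  have := E d (h.2 - g.2) dK; move=> /(_ _) EE.
  have : expR (d * (h.2 - g.2)) <= expR (4 * K).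
    by apply: EE; apply: (le_trans (ler_normB _ _)); rewrite -[2]/(1 + 1) lerD// ltW.
  have := ler_normB k1' g1'; move: (expR_gt0 (d * (h.2 - g.2))).
  move: (normr_ge0 (k1' - g1')).
  move: (expR (d * _)) (expR (4 * K)) E0 E1 `|k1' - g1'| `|h1'| `|k1'| `|g1'| gg hh kk.
  move=> X Y Y0 Y1 n1 n2 n3 n4 ? ? ? ? ? ? ?.
  have : X * n1 <= Y * (1 + c) by rewrite ler_pM// ?ltW//; lra.
  have : Y * 1 <= Y * 4 by rewrite ler_wpM2l; lra.
  rewrite !mulrDr; lra.
split=> /=.
- exact: (H a _ _ _ aK h1 g1 k1).
- by have := H (- b) _ _ _ bK h2 g2 k2; rewrite opprK.
- apply: (@lt_le_trans _ _ (4 + c)); last by rewrite ler_peMl// addr_ge0// ltW.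
  have := ler_normD h.2 (k.2 - g.2); have := ler_normB k.2 g.2; lra.
Qed.

(** If g1 S agrees with g1' S', and g2 S' with g2' S'', put k = g2 g1'^-1. Then k g1 S agrees with k
    g1' S' = g2 S', hence with g2' S''. Moving the first agreement by k displaces the ball on which
    it holds, so the radius r covers both the ball (in the box C) and its image under k^-1 (in the
    box C'). *)
Lemma close_trans (eps : R) : 0 < eps -> exists2 d : R, 0 < d &
  forall S S' S'' : tiling a b, close d S S' -> close d S' S'' -> close eps S S''.
Proof.
move=> e0; have [c0 c00 c0B] := box_ball_small e0.
have [c1 c10 c1B] : exists2 c : R, 0 < c & forall g h k : Sol,
    box c g -> box c h -> box c k -> box c0 (g * h^-1 * k)%g.
  have : ((x.1.1 * x.1.2^-1 * x.2)%g : Sol) @[x --> ((1%g, 1%g, 1%g) : Sol * Sol * Sol)] -->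
      (1 * 1^-1 * 1 : Sol)%g.
    have F1 : (x.1.1 : Sol) @[x --> ((1%g, 1%g, 1%g) : Sol * Sol * Sol)] --> (1%g : Sol).
      by apply: (@cvg_comp _ _ _ fst fst); exact: cvg_fst.
    have F2 : (x.1.2 : Sol) @[x --> ((1%g, 1%g, 1%g) : Sol * Sol * Sol)] --> (1%g : Sol).
      by apply: (@cvg_comp _ _ _ fst snd); [exact: cvg_fst|exact: cvg_snd].
    have F3 : (x.2 : Sol) @[x --> ((1%g, 1%g, 1%g) : Sol * Sol * Sol)] --> (1%g : Sol).
      exact: cvg_snd.
    by apply: cvg_solM => //; apply: cvg_solM => //; exact: cvg_solV.
  rewrite mulgV mulg1 => /(_ _ (nbhs_box c00)) [[A B] [[[A1 A2] [nA1 nA2 sA] nB]] sAB].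
  have /nbhs1P[c c_0 cU] : nbhs (1%g : Sol) (A1 `&` A2 `&` B).
    by apply: filterI => //; exact: filterI.
  exists c => // g h k /cU [[? _] _] /cU [[_ ?] _] /cU [_ ?].
  by apply: (sAB (g, h, k)); split => //; apply: sA.
have [C C0 CB] := sol_ball_bounded eps^-1.
have [C' C'B] := box_mul_bounded C.
have [r r0 rB] := box_ball_large (Num.max C C').
have minE : 0 < Num.min 1 c1 by rewrite lt_min ltr01.
have [d d0 dB] := sol_ball_small minE.
pose d' := Num.min d (Num.min r^-1 eps).
have d'0 : 0 < d' by rewrite !lt_min d0 invr_gt0 r0.
have d'd : d' <= d by rewrite ge_min lexx.
have d'r : r <= d'^-1.
  by rewrite -[r]invrK lef_pV2 ?posrE ?invr_gt0// /d' !ge_min lexx orbT.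
exists d' => // S S' S'' [g1 [g1' [/(sol_ball_le d'd)/dB B1 /(sol_ball_le d'd)/dB B1' sn1]]].
move=> [g2 [g2' [/(sol_ball_le d'd)/dB B2 B2' sn2]]].
have le1 : @box R a b (Num.min 1 c1) `<=` box 1 by apply: box_le; rewrite ge_min lexx.
have lec : @box R a b (Num.min 1 c1) `<=` box c1 by apply: box_le; rewrite ge_min lexx orbT.
have d'e : d' <= eps by rewrite /d' !ge_min lexx !orbT.
exists (g2 * g1'^-1 * g1)%g, g2'; split.
- by apply: c0B; apply: c1B; exact: lec.
- exact: sol_ball_le B2'.
move=> t [x [tx /CB xC]].
have dr : sol_ball a b r `<=` sol_ball a b d'^-1 by exact: sol_ball_le.
transitivity (tiles (ltiling g2 S') t); last first.
  apply: sn2; exists x; split=> //; apply/dr/rB.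
  by apply: box_le xC; rewrite le_max lexx.
pose k := (g2 * g1'^-1)%g.
have -> : ltiling g2 S' = ltiling k (ltiling g1' S').
  by rewrite -ltilingM /k -mulgA mulVg mulg1.
rewrite -/k ltilingM !(ltiling_tiles k); apply: sn1.
exists (k^-1 * x)%g; split; first by exists x.
apply/dr/rB; apply: (@box_le _ _ _ C'); first by rewrite le_max lexx orbT.
by rewrite /k invgM invgK; apply: C'B => //; exact: le1.
Qed.

(** The set of tilings close to S is not known to be open. Its candidate interior, the tilings all
    of whose sufficiently close neighbours are close to S, is open by [close_trans]. *)
Lemma nbhs_closeP (S : tiling a b) (U : set (tiling a b)) :
  nbhs S U <-> exists2 eps : R, 0 < eps & forall S', close eps S S' -> U S'.
Proof.
split.
  rewrite nbhsE => -[V [oV VS] VU].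
  have [e e0 eV] : exists2 eps : R, 0 < eps & forall S', close eps S S' -> V S' by exact: oV.
  by exists e => // S' /eV /VU.
move=> [e e0 eU]; rewrite nbhsE.
exists [set S' | exists2 d : R, 0 < d & forall S'', close d S' S'' -> close e S S''].
  split; last by exists e.
  suff H : open_tilings [set S' | exists2 d : R, 0 < d & forall S'', close d S' S'' -> close e S S''] by exact: H.
  move=> S' [d d0 dE]; have [d' d'0 d'E] := close_trans d0.
  exists d' => // S'' SS'; exists d' => // S''' SS''; apply: dE; exact: d'E SS' SS''.
by move=> S' [d d0 dE]; apply: eU; apply: dE; exact: close_refl.
Qed.

End Close.

(** * The tile *)

Section Tau.
Context {R : realType}.

Lemma tau_ge2 (x : R) : 0 <= x <= 1 -> 2 <= tau x.
Proof.
move=> /andP[x0 x1]; rewrite -[2]ger0_norm// -sqrtr_sqr ler_wsqrtr//.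
by have : 0 <= x * (1 - x); [rewrite mulr_ge0//; lra|lra].
Qed.

(** The maximum is sqrt (17 / 4), about 2.06. A rational bound below 4 keeps each tile within two
    layer heights, and its half 11 / 10 stays below 3 / 2. *)
Lemma tau_le (x : R) : tau x <= 11 / 5.
Proof.
rewrite -[11/5]ger0_norm// -sqrtr_sqr ler_wsqrtr//.
have := sqr_ge0 (x - 1 / 2); rewrite !expr2; lra.
Qed.

Lemma tau01 : tau 0 = tau 1 :> R.
Proof. by rewrite /tau mul0r subrr mulr0. Qed.

(* The top and bottom sides of all tiles of a row fit together into graphs of rescalings
   of this 1-periodic extension of tau. *)
Definition tau_per (x : R) : R := tau (x - (Num.floor x)%:~R).

Lemma floor_itv01 (x : R) : 0 <= x - (Num.floor x)%:~R < 1.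
Proof.
have := floor_le x; have := floorD1_gt x; rewrite intrD => *.
by apply/andP; split; lra.
Qed.

(** At the right end x = k + 1 the floor is k + 1 instead of k; the values agree because tau 0 = tau
    1. *)
Lemma tau_perE (x : R) (k : int) : 0 <= x - k%:~R <= 1 -> tau_per x = tau (x - k%:~R).
Proof.
move=> /andP[x0]; rewrite le_eqVlt => /predU1P[x1|x1].
  rewrite x1 -tau01 /tau_per (_ : Num.floor x = k + 1) ?intrD ?x1; last first.
    by apply/floor_def; rewrite !intrD; apply/andP; split; lra.
  by congr tau; lra.
rewrite /tau_per (_ : Num.floor x = k)//.
by apply/floor_def; rewrite !intrD; apply/andP; split; lra.
Qed.

Lemma tau_per_ge2 (x : R) : 2 <= tau_per x.
Proof. by apply: tau_ge2; have /andP[-> /ltW] := floor_itv01 x. Qed.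

Lemma tau_per_le (x : R) : tau_per x <= 11 / 5.
Proof. exact: tau_le. Qed.

Lemma tau_perD (x : R) (k : int) : tau_per (x + k%:~R) = tau_per x.
Proof.
have H := floor_itv01 x.
rewrite (@tau_perE _ (Num.floor x + k)); last by rewrite intrD; case/andP: H => *; apply/andP; split; lra.
by rewrite /tau_per intrD; congr tau; ring.
Qed.

(** The two bottom sides form a single graph, the periodic top side scaled by one half. This is what
    makes rows of tiles stack. *)
Lemma pentagonE (x y : R) : pentagon (x, y) <->
  0 <= x <= 1 /\ tau_per (2 * x) / 2 <= y <= tau_per x.
Proof.
have H0 : 0 <= x <= 1 -> tau_per x = tau x.
  by move=> x01; rewrite (@tau_perE x 0) ?subr0.
have H1 : 0 <= x <= 1 -> x <= 1 / 2 -> tau_per (2 * x) = tau (2 * x).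
  move=> /andP[x0 x1] x2; rewrite (@tau_perE _ 0) ?subr0//; apply/andP; split; lra.
have H2 : 0 <= x <= 1 -> 1 / 2 <= x -> tau_per (2 * x) = tau (2 * x - 1).
  by move=> /andP[x0 x1] x2; rewrite (@tau_perE _ 1)//; apply/andP; split; lra.
split.
  move=> [x01 yt l1 l2]; split=> //; rewrite (H0 x01) yt andbT.
  by case: (lerP x (1/2)) => [x2|/ltW x2]; [rewrite H1// l1|rewrite H2// l2].
move=> [x01 /andP[yb yt]]; split=> //; first by rewrite -H0.
- by move=> x2; rewrite -H1.
- by move=> x2; rewrite -H2.
Qed.

End Tau.

Section Tile.
Context {R : realType} {a b : R}.
Hypothesis a0 : 0 < a.
Local Notation Sol := (Sol a b).

Lemma tileP (g : Sol) : tile a b g <->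
  [/\ 0 <= g.1.1 <= 1, 0 <= g.1.2 <= 1
    & tau_per (2 * g.1.1) / 2 <= expR (a * g.2) <= tau_per g.1.1].
Proof.
case: g => [[x y] z] /=; split.
  move=> [x' [be [y' [/pentagonE[x01 be2] y01 [-> -> ->]]]]]; split=> //.
  have be0 : 0 < be.
    case/andP: be2 => [bel _]; apply: lt_le_trans bel.
    by rewrite divr_gt0//; apply: lt_le_trans (tau_per_ge2 _).
  by rewrite mulrCA divff ?gt_eqF// mulr1 lnK ?posrE.
move=> [x01 y01 be]; exists x, (expR (a * z)), y; split=> //; first exact/pentagonE.
by rewrite expRK mulrAC divff ?gt_eqF// mul1r.
Qed.

Lemma tile_bound (g : Sol) : tile a b g ->
  [/\ 0 <= g.1.1 <= 1, 0 <= g.1.2 <= 1 & 0 <= g.2 <= 2 * (ln 2 / a)].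
Proof.
move=> /tileP[x01 y01 /andP[z0 z1]]; split=> //.
have := tau_per_ge2 (2 * g.1.1); have := tau_per_le g.1.1 => tl t2.
have e1 : 1 <= expR (a * g.2) by lra.
have e2 : expR (a * g.2) <= 2 ^+ 2 by lra.
apply/andP; split; first by move: e1; rewrite -expR0 ler_expR pmulr_rge0.
rewrite mulrA ler_pdivlMr// mulrC -ler_expR; apply: le_trans e2 _.
by rewrite expRM_natl lnK ?posrE.
Qed.

Lemma tile1 : tile a b (1%g : Sol).
Proof.
apply/tileP; split => /=; rewrite ?lexx ?ler01// !mulr0 expR0 (@tau_perE _ _ 0) subr0 ?lexx ?ler01//.
rewrite /tau mul0r addr0 (_ : 4 = 2 ^+ 2 :> R); last by ring.
by rewrite sqrtr_sqr ger0_norm//; apply/andP; split; lra.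
Qed.

(** The identity is a point of the tile and is minimal in each of the three coordinates, so the
    origin of a translate is determined by its set of points. *)
Lemma tile_inj (g g' : Sol) : ltrans g (tile a b) = ltrans g' (tile a b) -> g = g'.
Proof.
have H (h h' : Sol) : ltrans h (tile a b) = ltrans h' (tile a b) ->
    [/\ h'.1.1 <= h.1.1, h'.1.2 <= h.1.2 & h'.2 <= h.2].
  move=> E; have : ltrans h' (tile a b) h.
    by rewrite -E; exists 1%g; [exact: tile1|rewrite mulg1].
  move=> [k /tile_bound [/andP[k1 _] /andP[k2 _] /andP[k3 _]] <-]; rewrite sol_mulE /=.
  by split; rewrite lerDl// mulr_ge0// expR_ge0.
move=> E; have [h1 h2 h3] := H _ _ E; have [k1 k2 k3] := H _ _ (esym E).
case: g g' h1 h2 h3 k1 k2 k3 {E} => [[x y] z] [[x' y'] z'] /= *.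
by congr (_, _, _); apply/eqP; rewrite eq_le; apply/andP.
Qed.

Lemma dltrans_inj (g g' : Sol) c c' :
  dltrans g (tile a b, c) = dltrans g' (tile a b, c') -> g = g' /\ c = c'.
Proof. by move=> [/tile_inj -> ->]. Qed.

Lemma nbhs_sol_itv (g : Sol) (l u l' u' l'' u'' : R) :
  l < g.1.1 < u -> l' < g.1.2 < u' -> l'' < g.2 < u'' ->
  \forall h \near g, [/\ l < h.1.1 < u, l' < h.1.2 < u' & l'' < h.2 < u''].
Proof.
move=> gx gy gz.
have [cx cy cz] := @cvg_solP R a b Sol (nbhs g) _ id g (@cvg_id _ _).
have B (f : Sol -> R) v w : v < f g < w -> f t @[t --> g] --> f g ->
    \forall t \near g, v < f t < w.
  move=> /andP[v1 w1] fc; near=> t; apply/andP; split; near: t.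
  - exact: (cvgr_gt _ fc).
  - exact: (cvgr_lt _ fc).
near=> h; split; near: h; exact: B.
Unshelve. all: by end_near. Qed.

Lemma tile_interior : exists q : Sol, nbhs q (tile a b).
Proof.
(* In the variable e^(a z) the bottom is at most 11 / 10 and the top at least 2, which leaves room
   around 3 / 2. *)
exists (1 / 4, 1 / 2, ln (3 / 2) / a).
have H : \forall h \near ((1 / 4, 1 / 2, ln (3 / 2) / a) : Sol),
   [/\ 0 < h.1.1 < 1, 0 < h.1.2 < 1 & ln (11 / 10) / a < h.2 < ln 2 / a].
  apply: nbhs_sol_itv => /=; try by apply/andP; split; lra.
  by rewrite !ltr_pM2r ?invr_gt0// !ltr_ln ?posrE//; apply/andP; split; lra.
apply: filterS H => h [/andP[x0 x1] /andP[y0 y1]].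
rewrite ltr_pdivrMr// ltr_pdivlMr// (mulrC h.2) => /andP[z0 z1].
apply/tileP; rewrite !(ltW x0) !(ltW y0) !(ltW x1) !(ltW y1); split=> //.
have l1 := tau_per_le (2 * h.1.1); have l2 := tau_per_ge2 h.1.1.
apply/andP; split.
  apply: (@le_trans _ _ (11 / 10)); first by lra.
  by rewrite -[leLHS]lnK ?posrE ?divr_gt0// ler_expR ltW.
apply: le_trans l2; rewrite -[leRHS]lnK ?posrE// ler_expR ltW//.
Qed.

(** For each tile t of T and each precision, T' contains h t for some h near the identity, with a
    fixed interior point q of t still interior to h t. If some such h1 is not 1, a finer precision
    gives h2 different from h1; then h1 t and h2 t are distinct tiles of T' sharing the interior
    point q. *)
Lemma close_eq (S S' : tiling a b) :
  (forall eps : R, 0 < eps -> close eps S S') -> S = S'.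
Proof.
suff H (T T' : tiling a b) : (forall eps : R, 0 < eps -> close eps T T') ->
    tiles T `<=` tiles T'.
  move=> SS'; apply: tiling_eq; apply/seteqP; split; apply: H => // eps e0.
  by apply: close_sym => //; exact: SS'.
move=> TT' t Tt; have [tr _ _] := tilingP T; have [g0 [c tE]] := tr _ Tt.
have [q qt] := tile_interior.
have {}qt : nbhs (g0 * q)%g t.1.
  have qt' : nbhs (g0^-1 * (g0 * q))%g (tile a b) by rewrite mulgA mulVg mul1g.
  have : nbhs (g0 * q)%g [set x | tile a b (g0^-1 * x)%g] by exact: continuous_mulg qt'.
  apply: filterS => x /= xt.
  by rewrite tE /=; exists (g0^-1 * x)%g => //; rewrite mulgA mulgV mul1g.
move: (g0 * q)%g qt => {}q qt.
have [c0 c0q] : exists c0, @box R a b c0 q.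
  exists (`|q.1.1| + `|q.1.2| + `|q.2| + 1); split; have := normr_ge0 q.1.1;
  have := normr_ge0 q.1.2; have := normr_ge0 q.2; lra.
have key (U : set Sol) : nbhs (1%g : Sol) U ->
    exists h, [/\ U h, tiles T' (dltrans h t) & nbhs q (ltrans h t.1)].
  move=> U1.
  have nq : nbhs (1%g : Sol) [set h | nbhs (h^-1 * q)%g t.1].
    have : (h^-1 * q : Sol)%g @[h --> (1%g : Sol)] --> (1^-1 * q : Sol)%g.
      by apply: cvg_solM; [exact: cvg_solV|exact: cvg_cst].
    rewrite invg1 mul1g => H; apply: (H [set x | nbhs x t.1]).
    exact: nbhs_interior.
  have : ((x.1^-1 * x.2)%g : Sol) @[x --> ((1%g, 1%g) : Sol * Sol)] --> (1^-1 * 1 : Sol)%g.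
    by apply: cvg_solM; [apply: cvg_solV; exact: cvg_fst|exact: cvg_snd].
  have {nq}UN : nbhs (1%g : Sol) (U `&` [set h | nbhs (h^-1 * q)%g t.1]) by exact: filterI.
  rewrite mulVg => H; have [[A B] [nA nB] sAB] := H _ UN.
  have /nbhs1P[d d0 dU] : nbhs (1%g : Sol) (A `&` B `&` box 1).
    by apply: filterI; [exact: filterI|exact: nbhs_box].
  have [r r0 rd] := @sol_ball_small _ a b a0 _ d0.
  have [C CC] := @box_mul_bounded _ a b a0 c0.
  have [r' r'0 r'C] := @box_ball_large _ a b a0 C.
  pose e := Num.min r r'^-1.
  have e0 : 0 < e by rewrite lt_min r0 invr_gt0.
  have er : e <= r by rewrite ge_min lexx.
  have er' : r' <= e^-1.
    by rewrite -[r']invrK lef_pV2 ?posrE ?invr_gt0// /e ge_min lexx orbT.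
  have [g [g' [/(sol_ball_le er)/rd/dU [[Ag Bg] g1]
    /(sol_ball_le er)/rd/dU [[Ag' Bg'] g'1] sn]]] := TT' _ e0.
  have [/= Ugg' ngg'] := sAB (g', g) (conj Ag' Bg).
  exists (g'^-1 * g)%g; split=> //.
    rewrite dltransM; apply/ltiling_tiles/sn; last by exists t.
    exists (g * q)%g; split; first by exists q => //; exact: nbhs_singleton.
    apply/(sol_ball_le er')/r'C; have := CC 1%g g q.
    by rewrite invg1 mulg1; apply=> //; split; rewrite /= normr0.
  have : nbhs q [set x | t.1 ((g'^-1 * g)^-1 * x)%g] by exact: continuous_mulg ngg'.
  by apply: filterS => x /= xt; exists ((g'^-1 * g)^-1 * x)%g => //; rewrite mulgA mulgV mul1g.
have [h1 [_ Th1 qh1]] := key setT filterT.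
suff h11 : h1 = 1%g by move: Th1; rewrite h11 dltrans1.
apply: contrapT => h1N.
have [c1 c10 c1h] : exists2 c1 : R, 0 < c1 & ~ box c1 h1.
  apply: contrapT => Hn; apply: h1N.
  have B (f : Sol -> R) : (forall c, box c h1 -> `|f h1| < c) -> f h1 = 0.
    move=> fb; apply/eqP; rewrite -normr_le0 leNgt; apply/negP => f0.
    have [/fb|nb] := pselect (box `|f h1| h1); first by rewrite ltxx.
    by apply: Hn; exists `|f h1|.
  have := B (fun h => h.1.1); have := B (fun h => h.1.2); have := B snd.
  case: (h1) => [[x y] z] /= -> => [->|? []//]; last by move=> ? [].
  by move=> ->// ? [].
have [h2 [h2U Th2 qh2]] := key _ (nbhs_box c10).
have [_ _ disj] := tilingP T'.
have [E|] := pselect (dltrans h1 t = dltrans h2 t).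
  move: E; rewrite tE -!dltransM => /dltrans_inj[/mulIg E _].
  by apply: c1h; rewrite E.
move=> /(disj _ _ Th1 Th2) => D.
by have : ((dltrans h1 t).1^° `&` (dltrans h2 t).1^°) q by []; rewrite D.
Qed.
End Tile.

(** * Solenoids *)

Section Lattice.
Context {R : realFieldType}.
Implicit Types (q x y : R) (u v : int -> R) (i j m : int) (N : nat).

Definition latt q i x := exists k : int, x = q ^ i * k%:~R.

Lemma latt0 q i : latt q i 0. Proof. by exists 0; rewrite mulr0. Qed.

Lemma lattD q i x y : latt q i x -> latt q i y -> latt q i (x + y).
Proof. by move=> [k ->] [l ->]; exists (k + l); rewrite intrD mulrDr. Qed.

Lemma lattN q i x : latt q i x -> latt q i (- x).
Proof. by move=> [k ->]; exists (- k); rewrite intrN mulrN. Qed.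

Lemma lattBC q i x y : latt q i (x - y) -> latt q i (y - x).
Proof. by move=> /lattN; rewrite opprB. Qed.

Lemma latt_trans q i x y z : latt q i (x - y) -> latt q i (y - z) -> latt q i (x - z).
Proof. by move=> xy yz; have := lattD xy yz; rewrite addrA subrK. Qed.

Lemma lattZ q i m x : q != 0 -> latt q i x -> latt q (m + i) (q ^ m * x).
Proof. by move=> q0 [k ->]; exists k; rewrite expfzDr// mulrA. Qed.

Lemma lattV q i x : latt q^-1 (- i) x <-> latt q i x.
Proof. by rewrite /latt; split=> -[k ->]; exists k; rewrite exprz_inv opprK. Qed.

Lemma latt_le N i j x : (0 < N)%N -> i <= j -> latt N%:R j x -> latt N%:R i x.
Proof.
move=> N0 ij [k ->].
have [n ->] : exists n : nat, j = i + n%:Z by exists `|j - i|%N; lia.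
exists ((N ^ n)%N%:Z * k); rewrite expfzDr ?pnatr_eq0 -?lt0n// intrM mulrA.
by congr (_ * _ * _); rewrite -exprnP -pmulrn natrX.
Qed.

(** A point of a solenoid, given by real representatives. For an integer q the sum of the two
    lattices is q^i Z, for the inverse of an integer it is q^(i+1) Z; this symmetric form serves
    both cases. *)
Definition compat q u := forall i, exists k l : int,
  u (i + 1) - u i = q ^ i * k%:~R + q ^ (i + 1) * l%:~R.

Lemma compatB q u v : compat q u -> compat q v -> compat q (fun i => u i - v i).
Proof.
move=> cu cv i; have [k [l ui]] := cu i; have [k' [l' vi]] := cv i.
exists (k - k'), (l - l'); rewrite !intrB.
transitivity ((u (i + 1) - u i) - (v (i + 1) - v i)); first by ring.
by rewrite ui vi; ring.
Qed.

Lemma compat0 q : compat q (fun=> 0).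
Proof. by move=> i; exists 0, 0; rewrite !mulr0 subrr addr0. Qed.

Lemma compat_shift q u x m : q != 0 -> compat q u ->
  compat q (fun i => x + q ^ m * u (i - m)).
Proof.
move=> q0 cu i; have [k [l ui]] := cu (i - m); exists k, l.
have -> : i + 1 - m = i - m + 1 by ring.
transitivity (q ^ m * (u (i - m + 1) - u (i - m))); first by ring.
rewrite ui mulrDr !mulrA -!expfzDr//; congr (q ^ _ * _ + q ^ _ * _); ring.
Qed.

Lemma compat_opp q u : compat q u -> compat q^-1 (fun i => u (- i)).
Proof.
move=> cu i; have [k [l ui]] := cu (- (i + 1)); exists (- l), (- k).
rewrite !exprz_inv -opprB [u _ - _](_ : _ = u (- (i + 1) + 1) - u (- (i + 1))).
  by rewrite ui (_ : - (i + 1) + 1 = - i); ring.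
by congr (u _ - _); ring.
Qed.

(** The lattices N^i Z decrease as i grows, so a single value of u determines all earlier ones
    modulo their lattices. *)
Lemma compat_le N u i j : (0 < N)%N -> compat N%:R u -> i <= j ->
  latt N%:R i (u j - u i).
Proof.
move=> N0 cu ij.
have [n ->] : exists n : nat, j = i + n%:Z by exists `|j - i|%N; lia.
elim: n => [|n IH]; first by rewrite addr0 subrr; exact: latt0.
apply: latt_trans IH; have -> : i + n.+1%:Z = i + n%:Z + 1 by lia.
apply: (@latt_le _ _ (i + n%:Z)) => //; first by lia.
have [k [l ->]] := cu (i + n%:Z); apply: lattD; first by exists k.
by apply: (@latt_le _ _ (i + n%:Z + 1)) => //; [lia|exists l].
Qed.

(* The y-scale of the layers is N or 1/N according to the sign of b; reflecting the layer
   index exchanges the two cases. *)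
Definition ratio N (s : bool) : R := if s then N%:R else N%:R^-1.

Lemma ratio_neq0 N s : (0 < N)%N -> ratio N s != 0.
Proof. by rewrite lt0n => N0; case: s; rewrite /= ?invr_eq0 pnatr_eq0. Qed.

Lemma ratio_latt0 N s x : (1 < N)%N -> (forall i, latt (ratio N s) i x) -> x = 0.
Proof.
move=> N1 H; apply: contrapT => /eqP x0.
have {}H i : latt N%:R i x.
  by case: s H => H; [exact: H|apply/lattV; exact: (H (- i))].
have [k0 xk0] := H 0.
(* The exponent is chosen so that N^(|k0|+1) > |k0|, while it divides k0. *)
have [k xk] := H (`|k0|%N).+1%:Z.
move: x0; rewrite xk => x0.
have kN0 : k != 0 by apply: contraNneq x0 => ->; rewrite mulr0.
have : k0 = ((N ^ `|k0|.+1)%N : int) * k.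
  apply: (@intr_inj R); rewrite intrM -pmulrn natrX exprnP -xk xk0 expr0z mul1r//.
have := ltn_expl `|k0|.+1 N1.
move: (N ^ _)%N => A A0 E; have : (`|k0| = A * `|k|)%N by rewrite E abszM.
have : (0 < `|k|)%N by rewrite absz_gt0.
nia.
Qed.

(** In a finite window of layers, the value of u where the lattice is sparsest represents all the
    others: the layer M for ratio N, the layer - M for ratio 1/N. *)
Lemma compat_approx N s u (M : nat) : (0 < N)%N -> compat (ratio N s) u ->
  exists x, forall i, `|i| <= M%:Z -> latt (ratio N s) i (x - u i).
Proof.
case: s => /= N0 cu.
  by exists (u M%:Z) => i iM; apply: compat_le => //; lia.
move/compat_opp : cu; rewrite invrK => cu; exists (u (- M%:Z)) => i iM.
apply/lattV; rewrite invrK; have := @compat_le N _ (- i) M%:Z N0 cu.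
by rewrite opprK; apply; lia.
Qed.

Implicit Types e : nat -> nat.

(** The truncations of the N-adic integer with digits e. For i < 0 the lattice N^i Z contains the
    integers, so 0 is a representative. *)
Definition natdigits N e i : R :=
  if i is Posz m then (\sum_(k < m) e k * N ^ k)%N%:R else 0.

Definition digits N s e i : R := natdigits N e (if s then i else - i).

Lemma natdigitsS N e (m : nat) :
  natdigits N e m.+1%:Z = natdigits N e m%:Z + N%:R ^+ m * (e m)%:R.
Proof. by rewrite /= big_ord_recr/= natrD natrM natrX mulrC. Qed.

Lemma natdigits_compat N e : compat N%:R (natdigits N e).
Proof.
case=> [m|[|m]].
- exists (e m)%:Z, 0; rewrite mulr0 addr0 (_ : Posz m + 1 = m.+1%:Z); last by lia.
  by rewrite natdigitsS addrC addKr.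
- by exists 0, 0; rewrite /= big_ord0 !mulr0 subrr addr0.
- exists 0, 0; rewrite (_ : Negz m.+1 + 1 = Negz m); last by lia.
  by rewrite /= !mulr0 subrr addr0.
Qed.

Lemma digits_compat N s e : compat (ratio N s) (digits N s e).
Proof.
case: s; first exact: natdigits_compat.
exact/compat_opp/natdigits_compat.
Qed.

Lemma natdigits_exist N u : (0 < N)%N -> compat N%:R u -> latt N%:R 0 (u 0) ->
  exists2 e, (forall k, e k < N)%N & forall i, latt N%:R i (u i - natdigits N e i).
Proof.
move=> N0 cu u0; have [c0] := u0; rewrite expr0z mul1r => u0E.
have /choice[c cE] : forall m : nat, exists k : int,
    u m.+1%:Z - u m%:Z = N%:R ^+ m * k%:~R.
  by move=> m; have [|k kE] := @compat_le N u m%:Z m.+1%:Z N0 cu; [lia|exists k].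
(* Division with carry, with the invariant u m - natdigits N e m = N^m t m: adding the increment N^m
   c m and removing the digit e m leaves a multiple of N^(m+1). *)
pose t := fix t n := if n is n'.+1 then ((t n' + c n') %/ N%:Z)%Z else c0.
pose e (m : nat) := `|((t m + c m) %% N%:Z)%Z|%N.
have NZ : N%:Z != 0 by rewrite eqz_nat -lt0n.
have eE (m : nat) : ((e m)%:Z = (t m + c m) %% N%:Z)%Z by rewrite gez0_abs// modz_ge0.
exists e => [k|[m|m]].
- by rewrite -ltz_nat eE ltz_pmod// ltz_nat.
- exists (t m); rewrite -exprnP; elim: m => [|m IH].
    by rewrite /= big_ord0 subr0 u0E expr0 mul1r.
  rewrite natdigitsS opprD addrA.
  have -> : u m.+1%:Z = u m%:Z + N%:R ^+ m * (c m)%:~R by rewrite -cE addrC subrK.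
  rewrite (addrAC (u m%:Z)) IH exprSr -mulrA -!mulrDr -mulrBr; congr (_ * _).
  rewrite -[(e m)%:R]/((e m)%:Z%:~R) eE -intrD -[N%:R]/(N%:Z%:~R) -intrM -intrB.
  by congr _%:~R; rewrite /= {1}(divz_eq (t m + c m) N%:Z); ring.
- rewrite subr0 -[u _](subrK (u 0)); apply: lattD.
    by apply: lattBC; apply: compat_le.
  by apply: latt_le u0.
Qed.

Lemma digits_exist N s u : (0 < N)%N -> compat (ratio N s) u ->
  latt (ratio N s) 0 (u 0) ->
  exists2 e, (forall k, e k < N)%N & forall i, latt (ratio N s) i (u i - digits N s e i).
Proof.
move=> N0; case: s => /= cu u0; first exact: natdigits_exist.
move: (compat_opp cu) (u0); rewrite -lattV invrK oppr0 => cu' u0'.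
have [|e eN eE] := natdigits_exist N0 cu'; first by rewrite oppr0.
exists e => // i; apply/lattV; rewrite invrK; have := eE (- i).
by rewrite opprK.
Qed.

(** Modulo N^(k+1), once the lower digits agree, e k - e' k is a multiple of N smaller than N in
    absolute value. *)
Lemma natdigits_inj N e e' (M : nat) : (forall k, e k < N)%N -> (forall k, e' k < N)%N ->
  (forall i, `|i| <= M%:Z -> latt N%:R i (natdigits N e i - natdigits N e' i)) ->
  forall k, (k < M)%N -> e k = e' k.
Proof.
move=> eN e'N H; elim/ltn_ind => k IH kM.
have [l] : latt N%:R k.+1%:Z (natdigits N e k.+1%:Z - natdigits N e' k.+1%:Z).
  by apply: H; rewrite lez_nat.
have E : natdigits N e k%:Z = natdigits N e' k%:Z.
  by congr _%:R; apply: eq_bigr => j _; rewrite IH//; apply: ltn_trans kM.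
rewrite !natdigitsS E opprD addrACA subrr add0r -mulrBr -exprnP exprSr -mulrA.
have N0 : (0 < N)%N by apply: leq_ltn_trans (eN k).
move/mulfI => /(_ _) H'; have {H'} : (e k)%:R - (e' k)%:R = N%:R * l%:~R :> R.
  by apply: H'; rewrite expf_neq0// pnatr_eq0 -lt0n.
rewrite -[(e k)%:R]/((e k)%:Z%:~R) -[(e' k)%:R]/((e' k)%:Z%:~R) -[N%:R]/(N%:Z%:~R).
rewrite -intrB -intrM => /intr_inj.
have e1 := eN k; have e2 := e'N k => E'.
have : l = 0.
  have [l0|l0|//] := ltrgtP l 0; exfalso.
    have : N%:Z * l <= N%:Z * -1 by rewrite ler_wpM2l//; lia.
    lia.
  have : N%:Z * 1 <= N%:Z * l by rewrite ler_wpM2l//; lia.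
  lia.
by move=> l0; move: E'; rewrite l0 mulr0; lia.
Qed.

Lemma digits_inj N s e e' (M : nat) : (forall k, e k < N)%N -> (forall k, e' k < N)%N ->
  (forall i, `|i| <= M%:Z -> latt (ratio N s) i (digits N s e i - digits N s e' i)) ->
  forall k, (k < M)%N -> e k = e' k.
Proof.
move=> eN e'N H; apply: (natdigits_inj eN e'N) => i iM.
case: s H => [|H]; first exact.
by apply/lattV; have := H (- i); rewrite /digits opprK normrN; apply.
Qed.

Lemma digits_eq N s e e' (M : nat) : (forall k, (k < M)%N -> e k = e' k) ->
  forall i, `|i| <= M%:Z -> digits N s e i = digits N s e' i.
Proof.
move=> H i iM; rewrite /digits; 
have : `|if s then i else - i| <= M%:Z by case: s; rewrite ?normrN.
move: (if s then i else - i) => j jM.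
case: j jM => //= m; rewrite lez_nat => mM; congr _%:R; apply: eq_bigr => k _.
by rewrite H//; apply: leq_trans mM.
Qed.

End Lattice.

(** * Layered tilings *)

Lemma expR_intl (R : realType) (x : R) (i : int) : expR (i%:~R * x) = expR x ^ i.
Proof.
case: i => n; first by rewrite -exprnP -expRM_natl.
by rewrite NegzE intrN mulNr expRN -exprnN -expRM_natl.
Qed.

Lemma int_eq_itv01 (R : realType) (x y : R) (k : int) :
  0 < x < 1 -> 0 < y < 1 -> x = y + k%:~R -> x = y.
Proof.
move=> /andP[x0 x1] /andP[y0 y1] E.
have : (-1 : int)%:~R < k%:~R :> R by rewrite intrN; lra.
have : k%:~R < (1 : int)%:~R :> R by lra.
rewrite !ltr_int => k1 k_1; have k0 : k = 0 by lia.
by rewrite E k0 addr0.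
Qed.

(** For the top of layer j and the bottom of layer k, which is the top of layer k - 1: either they
    are the same curve, or the ranges [2^(i+1), 2^(i+2)) of the tops are in order. *)
Lemma int_lt_pred (j k : int) : j < k -> j = k - 1 \/ j + 2 <= k - 1 + 1.
Proof. lia. Qed.

Section Layers.
Context {R : realType} {a b : R} {N : nat} {s : bool}.
Hypothesis a0 : 0 < a.
Hypothesis N0 : (0 < N)%N.
Local Notation lam := (ln 2 / a).
Local Notation nu := (ratio N s : R).
Hypothesis nuE : expR (- b * lam) = nu.
Local Notation Sol := (Sol a b).
Implicit Types (u v : int -> R) (g h p : Sol) (i j k m : int) (eta : int -> bool).

Definition layer_point (x y : R) m : Sol := (x, y, m%:~R * lam).

Lemma lam_gt0 : 0 < lam.
Proof. by rewrite divr_gt0// ln_gt0// ltr1n. Qed.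

Lemma nu_neq0 : nu != 0. Proof. exact: ratio_neq0. Qed.

Let z2 i : (2 : R) ^ i != 0. Proof. by rewrite expfz_neq0. Qed.
Let z2_gt0 i : 0 < (2 : R) ^ i. Proof. exact: exprz_gt0. Qed.

Lemma expR_layer_x i : expR (a * (i%:~R * lam)) = 2 ^ i.
Proof. by rewrite mulrCA expR_intl mulrCA divff ?gt_eqF// mulr1 lnK// posrE. Qed.

Lemma expR_layer_y i : expR (- b * (i%:~R * lam)) = nu ^ i.
Proof. by rewrite mulrCA expR_intl nuE. Qed.

Lemma expR_layer_xN i : expR (- a * (i%:~R * lam)) = 2 ^ (- i).
Proof. by rewrite -expR_layer_x intrN; congr expR; ring. Qed.

Lemma expR_layer_yN i : expR (b * (i%:~R * lam)) = nu ^ (- i).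
Proof. by rewrite -expR_layer_y intrN; congr expR; ring. Qed.

Definition on_layer u v i g :=
  [/\ latt 2 i (g.1.1 - u i), latt nu i (g.1.2 - v i) & g.2 = i%:~R * lam].

(* Layer i has colour eta i, and its tiles are placed at the points of a translate by
   (u i, v i) of the lattice 2^i Z x nu^i Z. *)
Definition layers eta u v : set (dtile a b) :=
  [set t | exists i g, on_layer u v i g /\ t = dltrans g (tile a b, eta i)].

Lemma layersP eta u v g c : layers eta u v (dltrans g (tile a b, c)) <->
  exists i, on_layer u v i g /\ c = eta i.
Proof.
split; last by move=> [i [gi ->]]; exists i, g.
by move=> [i [h [hi /(dltrans_inj a0) [-> ->]]]]; exists i.
Qed.

Lemma on_layer_translate u v i (x y : R) m g : on_layer u v i g <->
  on_layer (fun j => x + 2 ^ m * u (j - m)) (fun j => y + nu ^ m * v (j - m)) (i + m)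
    (layer_point x y m * g)%g.
Proof.
rewrite /on_layer sol_mulE /= expR_layer_x expR_layer_y addrK.
have -> : x + 2 ^ m * g.1.1 - (x + 2 ^ m * u i) = 2 ^ m * (g.1.1 - u i) by ring.
have -> : y + nu ^ m * g.1.2 - (y + nu ^ m * v i) = nu ^ m * (g.1.2 - v i) by ring.
rewrite (addrC i m) intrD mulrDl; split.
  by move=> [gx gy ->]; split; [exact: lattZ|apply: lattZ => //; exact: nu_neq0|].
move=> [gx gy /addrI gz]; split=> //.
  by have := @lattZ _ 2 _ (- m) _ (z2 1) gx; rewrite mulrA -expfzDr// addNr expr0z mul1r addrA addNr add0r.
by have := @lattZ _ nu _ (- m) _ nu_neq0 gy; rewrite mulrA -expfzDr ?nu_neq0// addNr expr0z mul1r addrA addNr add0r.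
Qed.

Lemma layers_translate eta u v (x y : R) m :
  dltrans (layer_point x y m) @` layers eta u v =
  layers (fun i => eta (i - m)) (fun j => x + 2 ^ m * u (j - m)) (fun j => y + nu ^ m * v (j - m)).
Proof.
set g0 := layer_point x y m; apply/seteqP; split.
  move=> _ [_ [i [g [gi ->]] <-]]; exists (i + m), (g0 * g)%g; split.
    exact/(on_layer_translate u v i x y m g).
  by rewrite -dltransM addrK.
move=> _ [i [g [gi ->]]]; exists (dltrans (g0^-1 * g)%g (tile a b, eta (i - m))).
  exists (i - m), (g0^-1 * g)%g; split=> //; apply/(on_layer_translate _ _ _ x y m).
  by rewrite -/g0 mulgA mulgV mul1g subrK.
by rewrite -dltransM mulgA mulgV mul1g.
Qed.

Lemma eq_layers eta eta' u v u' v' : eta =1 eta' ->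
  (forall i, latt 2 i (u i - u' i)) -> (forall i, latt nu i (v i - v' i)) ->
  layers eta u v = layers eta' u' v'.
Proof.
move=> ee uu vv.
have H p u1 v1 u2 v2 i : latt 2 i (u1 i - u2 i) -> latt nu i (v1 i - v2 i) ->
    on_layer u1 v1 i p -> on_layer u2 v2 i p.
  by move=> ui vi [px py pz]; split=> //; [exact: latt_trans ui|exact: latt_trans vi].
apply/seteqP; split=> t [i [p [pi ->]]]; exists i, p; rewrite ?ee; split=> //.
- exact: H pi.
- by apply: H pi; exact: lattBC.
Qed.

Let X u i (x : R) := 2 ^ (- i) * (x - u i).
(** The top of layer i over the abscissa x, measured in the height variable e^(a z). *)
Let H u i (x : R) := 2 ^ i * tau_per (X u i x).

(** Compatibility of the x-offsets enters here: it makes the bottom curve of a tile of layer i equal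
    to the top curve of layer i - 1, since the two arguments of [tau_per] differ by an integer. *)
Let tileE u v i p h : compat 2 u -> on_layer u v i p ->
  (ltrans p (tile a b) h <-> [/\ 0 <= 2 ^ (- i) * (h.1.1 - p.1.1) <= 1,
    0 <= nu ^ (- i) * (h.1.2 - p.1.2) <= 1 &
    H u (i - 1) h.1.1 <= expR (a * h.2) <= H u i h.1.1]).
Proof.
move=> cu [[k px] _ pz].
have -> : ltrans p (tile a b) h <-> tile a b (p^-1 * h)%g.
  split=> [[h' th' <-]|th]; first by rewrite mulgA mulVg mul1g.
  by exists (p^-1 * h)%g => //; rewrite mulgA mulgV mul1g.
rewrite tileP// sol_divE /= pz expR_layer_xN expR_layer_yN.
have -> : expR (a * (h.2 - i%:~R * lam)) = expR (a * h.2) * 2 ^ (- i).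
  by rewrite mulrBr expRD -expR_layer_xN mulNr.
have i1 : 2 ^ i = 2 * 2 ^ (i - 1) :> R by rewrite expfzDr// exprN1 mulrCA divff// mulr1.
have e1 : 2 ^ (- i) * 2 ^ i = 1 :> R by rewrite -expfzDr// addNr.
have e2 : 2 ^ (- (i - 1)) = 2 * 2 ^ (- i) :> R.
  by rewrite opprB addrC expfzDr// expr1z mulrC.
have -> : tau_per (2 ^ (- i) * (h.1.1 - p.1.1)) = tau_per (X u i h.1.1).
  rewrite -[RHS](@tau_perD _ _ (- k)) /X intrN; congr tau_per.
  transitivity (2 ^ (- i) * (h.1.1 - u i) - 2 ^ (- i) * (p.1.1 - u i)); first by ring.
  by rewrite px mulrA e1 mul1r.
have -> : tau_per (2 * (2 ^ (- i) * (h.1.1 - p.1.1))) = tau_per (X u (i - 1) h.1.1).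
  have [k' [l']] := cu (i - 1); rewrite subrK => uE.
  rewrite -[RHS](@tau_perD _ _ (- (2 * k) - (k' + 2 * l'))) /X; congr tau_per.
  rewrite e2 intrB intrN intrM intrD intrM.
  have e3 : 2 * 2 ^ (- i) * 2 ^ (i - 1) = 1 :> R by rewrite mulrAC -i1 mulrC.
  have px' : 2 ^ (- i) * (p.1.1 - u i) = k%:~R by rewrite px mulrA e1 mul1r.
  have uE' : (2 : R) * 2 ^ (- i) * (u i - u (i - 1)) = k'%:~R + 2 * l'%:~R.
    rewrite uE i1; transitivity ((2 : R) * 2 ^ (- i) * 2 ^ (i - 1) * (k'%:~R + 2 * l'%:~R)); first by ring.
    by rewrite e3 mul1r.
  transitivity ((2 : R) * 2 ^ (- i) * (h.1.1 - u (i - 1)) - 2 * (2 ^ (- i) * (p.1.1 - u i)) -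
     2 * 2 ^ (- i) * (u i - u (i - 1))); first by ring.
  by rewrite px' uE'; ring.
rewrite /H.
have -> : (tau_per (X u (i - 1) h.1.1) / 2 <= expR (a * h.2) * 2 ^ (- i)) =
  (2 ^ (i - 1) * tau_per (X u (i - 1) h.1.1) <= expR (a * h.2)).
  rewrite -(ler_pM2l (z2_gt0 i)) [RHS](_ : _ = (2 ^ (i - 1) * tau_per (X u (i - 1) h.1.1) <= expR (a * h.2) * (2 ^ (- i) * 2 ^ i))).
    by congr (_ <= _); [rewrite i1; field|ring].
  by rewrite e1 mulr1.
have -> : (expR (a * h.2) * 2 ^ (- i) <= tau_per (X u i h.1.1)) =
  (expR (a * h.2) <= 2 ^ i * tau_per (X u i h.1.1)).
  rewrite -(ler_pM2l (z2_gt0 i)); congr (_ <= _).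
  by rewrite mulrCA (mulrC (2 ^ i)) e1 mulr1.
by [].
Qed.

Let H_itv u i x : 2 ^ (i + 1) <= H u i x < 2 ^ (i + 2).
Proof.
rewrite /H !expfzDr//; apply/andP; split.
  by rewrite ler_pM2l// tau_per_ge2.
by rewrite ltr_pM2l//; apply: le_lt_trans (tau_per_le _) _; rewrite -exprnP; lra.
Qed.

Lemma layers_is_tiling eta u v : compat 2 u -> is_tiling (layers eta u v).
Proof.
move=> cu; split.
- by move=> _ [i [g [_ ->]]]; exists g, (eta i).
- apply/seteqP; split=> // h _.
  (* A point with 2^m <= e^(a z) < 2^(m+1) is above the top of layer m - 2 and below that of layer
     m, so it lies in layer m - 1 or m. *)
  pose m := Num.floor (h.2 / lam).
  have [m1 m2] : 2 ^ m <= expR (a * h.2) /\ expR (a * h.2) < 2 ^ (m + 1).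
    rewrite -!expR_layer_x ler_expR ltr_expR ler_pM2l// ltr_pM2l//.
    rewrite -ler_pdivlMr ?lam_gt0// -ltr_pdivrMr ?lam_gt0//; split; first exact: floor_le.
    exact: floorD1_gt.
  have [i iP] : exists i, H u (i - 1) h.1.1 <= expR (a * h.2) <= H u i h.1.1.
    have /andP[_ h1] := H_itv u (m - 1 - 1) h.1.1.
    have /andP[h2 _] := H_itv u m h.1.1.
    have [le|/ltW le] := lerP (expR (a * h.2)) (H u (m - 1) h.1.1).
      exists (m - 1); rewrite le andbT; apply/ltW/(lt_le_trans h1).
      by rewrite (_ : m - 1 - 1 + 2 = m); last by lia.
    by exists m; rewrite le/=; apply/ltW/(lt_le_trans m2).
  pose jx := Num.floor (2 ^ (- i) * (h.1.1 - u i)).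
  pose jy := Num.floor (nu ^ (- i) * (h.1.2 - v i)).
  pose p : Sol := (u i + 2 ^ i * jx%:~R, v i + nu ^ i * jy%:~R, i%:~R * lam).
  have pi : on_layer u v i p.
    by split; rewrite //= addrAC subrr add0r; [exists jx|exists jy].
  exists (dltrans p (tile a b, eta i)); first by exists i, p.
  apply/(tileE _ cu pi); split=> //=.
  + have /andP[h1 /ltW h2] := floor_itv01 (2 ^ (- i) * (h.1.1 - u i)).
    rewrite opprD addrA mulrBr mulrA -expfzDr// addNr expr0z mul1r.
    by apply/andP.
  + have /andP[h1 /ltW h2] := floor_itv01 (nu ^ (- i) * (h.1.2 - v i)).
    rewrite opprD addrA mulrBr mulrA -expfzDr ?nu_neq0// addNr expr0z mul1r.
    by apply/andP.
(* Interior points satisfy strict inequalities: they can be moved both ways in x and y, and both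
   ways in z. The two moves are separate because the curves [H] depend on x. *)
- have strict i p h : on_layer u v i p -> (ltrans p (tile a b))^° h ->
      [/\ 0 < 2 ^ (- i) * (h.1.1 - p.1.1) < 1, 0 < nu ^ (- i) * (h.1.2 - p.1.2) < 1 &
      H u (i - 1) h.1.1 < expR (a * h.2) < H u i h.1.1].
    move=> pi hp.
    have c0 (c : R) : c + d @[d --> (0 : R)] --> c.
      by rewrite -[X in _ --> X]addr0; apply: cvgD; [exact: cvg_cst|exact: cvg_id].
    have c1 : ((h.1.1 + d, h.1.2 + d, h.2) : Sol) @[d --> (0 : R)] --> h.
      by apply: cvg_sol => //=; exact: cvg_cst.
    have c2 : ((h.1.1, h.1.2, h.2 + d) : Sol) @[d --> (0 : R)] --> h.
      by apply: cvg_sol => //=; exact: cvg_cst.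
    have /nbhs_ballP [e /= e0 he] : \forall d \near (0 : R),
        ltrans p (tile a b) (h.1.1 + d, h.1.2 + d, h.2) /\
        ltrans p (tile a b) (h.1.1, h.1.2, h.2 + d).
      by apply: filterI; [exact: c1 hp|exact: c2 hp].
    have e2 : 0 < e / 2 by rewrite divr_gt0.
    have /he [/(tileE _ cu pi)/= [x1 y1 _] /(tileE _ cu pi)/= [_ _ z1]] : ball 0 e (e / 2).
      by rewrite /ball/= sub0r normrN gtr0_norm// ltr_pdivrMr// mulr_natr mulr2n ltrDl.
    have /he [/(tileE _ cu pi)/= [x2 y2 _] /(tileE _ cu pi)/= [_ _ z2']] : ball 0 e (- (e / 2)).
      by rewrite /ball/= sub0r opprK gtr0_norm// ltr_pdivrMr// mulr_natr mulr2n ltrDl.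
    have n0 : 0 < nu by rewrite -nuE expR_gt0.
    have aux (c x y : R) : 0 < c -> 0 <= c * (x + e / 2 - y) <= 1 -> 0 <= c * (x + - (e / 2) - y) <= 1 ->
        0 < c * (x - y) < 1.
      move=> cc /andP[_ A1] /andP[A2 _]; have ce : 0 < c * (e / 2) by rewrite mulr_gt0.
      move: A1 A2; rewrite !mulrDr !mulrN; move: ce.
      by move: (c * (e / 2)) (c * x) (c * y) => *; apply/andP; split; lra.
    split; [exact: aux x1 x2|by apply: aux y1 y2; exact: exprz_gt0|].
    case/andP: z1 => _ z1; case/andP: z2' => z2' _; apply/andP; split.
      by apply: (le_lt_trans z2'); rewrite ltr_expR ltr_pM2l// gtrDl oppr_lt0.
    by apply: lt_le_trans z1; rewrite ltr_expR ltr_pM2l// ltrDl.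
  move=> _ _ [i [p [pi ->]]] [i' [p' [pi' ->]]] ne; apply/seteqP; split=> // h [].
  move=> /(strict _ _ _ pi)[x1 y1 /andP[z1 z1']] /(strict _ _ _ pi')[x2 y2 /andP[z2' z2'']].
  have Hlt j k : j < k -> H u j h.1.1 <= H u (k - 1) h.1.1.
    move=> /int_lt_pred [-> //|jk].
    have /andP[_ /ltW A] := H_itv u j h.1.1; have /andP[B _] := H_itv u (k - 1) h.1.1.
    apply: (le_trans A); apply: le_trans B.
    by rewrite -!expR_layer_x ler_expR ler_pM2l// ler_pM2r ?lam_gt0// ler_int.
  have ii : i = i'.
    have [/Hlt L|/Hlt L|//] := ltgtP i i'; exfalso.
      by have := lt_trans z1' (le_lt_trans L z2'); rewrite ltxx.
    by have := lt_trans z2'' (le_lt_trans L z1); rewrite ltxx.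
  subst i'; apply: ne; congr dltrans.
  case: pi pi' => [[k px] [l py] pz] [[k' px'] [l' py'] pz'].
  have E q x y y' w (j j' : int) : q != 0 -> 0 < q ^ (- i) * (x - y) < 1 -> 0 < q ^ (- i) * (x - y') < 1 ->
      y - w = q ^ i * j%:~R -> y' - w = q ^ i * j'%:~R -> y = y' :> R.
    move=> q0 X1 X2 yE y'E.
    have qi : q ^ (- i) != 0 by rewrite expfz_neq0.
    have : q ^ (- i) * (x - y) = q ^ (- i) * (x - y').
      apply: (@int_eq_itv01 _ _ _ (j' - j)) => //.
      have -> : y = w + q ^ i * j%:~R by rewrite -yE addrC subrK.
      have -> : y' = w + q ^ i * j'%:~R by rewrite -y'E addrC subrK.
      rewrite !mulrBr !mulrDr !mulrA -!expfzDr// addNr expr0z !mul1r intrB; ring.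
    by move=> /(mulfI qi)/addrI/oppr_inj.
  have Ex := E 2 _ _ _ _ _ _ (z2 1) x1 x2 px px'.
  have Ey := E nu _ _ _ _ _ _ nu_neq0 y1 y2 py py'.
  have Ez : p.2 = p'.2 by rewrite pz pz'.
  by case: (p) (p') Ex Ey Ez => [[? ?] ?] [[? ?] ?] /= -> -> ->.
Qed.

Lemma expgz_coord g (f : int -> Sol) i : f 0 = 1%g -> (forall j, (f j * g)%g = f (j + 1)) ->
  expgz g i = f i.
Proof.
move=> f0 fS.
have P (n : nat) : (g ^+ n)%g = f n%:Z.
  elim: n => [|n IH]; first by rewrite expg0 f0.
  by rewrite expgSr IH fS; congr f; lia.
have fN (n : nat) : (f (- n%:Z) * g ^+ n)%g = 1%g.
  elim: n => [|n IH]; first by rewrite expg0 mulg1 oppr0.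
  rewrite expgS mulgA fS -IH; congr (f _ * _)%g; lia.
case: i => n //=; rewrite NegzE; apply: (@mulIg _ (g ^+ n.+1)%g).
by rewrite mulVg fN.
Qed.

Lemma decorated_tilingE eta : decorated_tiling a b eta = layers eta (fun=> 0) (fun=> 0).
Proof.
have E i j k : (expgz (gen_R a b) i * expgz (gen_S a b) j * gen_T a b k%:~R)%g =
    (2 ^ i * j%:~R, nu ^ i * k%:~R, i%:~R * lam) :> Sol.
  rewrite (@expgz_coord _ (fun i => (0, 0, i%:~R * lam) : Sol)); first last.
  - move=> l; rewrite sol_mulE /= !mulr0 !addr0 intrD mulrDl mul1r.
    by [].
  - by rewrite mul0r.
  rewrite (@expgz_coord _ (fun j => (j%:~R, 0, 0) : Sol)); first last.
  - by move=> l; rewrite sol_mulE /= !mulr0 expR0 !addr0 mul1r intrD.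
  - by [].
  rewrite !sol_mulE /= !addr0 expR_layer_x expR_layer_y.
  by rewrite !mulr0 !add0r addr0.
apply/seteqP; split => t.
  move=> [i [j [k ->]]]; exists i, (2 ^ i * j%:~R, nu ^ i * k%:~R, i%:~R * lam).
  by rewrite E; split=> //; split; rewrite /= ?subr0//; [exists j|exists k].
move=> [i [[[x y] z] [[/= [j]]]]]; rewrite !subr0 => -> [k ->] -> ->.
by exists i, j, k; rewrite E.
Qed.

End Layers.

(** * Codes *)

(* The k-th symbol of a code lists the colours of the layers k and -1 - k, the k-th binary
   digit of the x-offset and the k-th digit in base M.+1 of the y-offset. *)
Definition symbol (M : nat) : Type := (bool * bool * bool * 'I_M.+1)%type.
HB.instance Definition _ M := Finite.on (symbol M).
HB.instance Definition _ M := isPointed.Build (symbol M) (false, false, false, ord0).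

Definition code M := tree_of (fun _ : nat => symbol M : pointedType).
HB.instance Definition _ M := Pointed.on (code M).
HB.instance Definition _ M := Uniform.on (code M).
HB.instance Definition _ (R : realType) M : @PseudoMetric R _ := @PseudoMetric.on (code M).

Section Code.
Context {M : nat}.
Implicit Types (x y : code M) (A U : set (code M)) (n : nat).

Definition cylinder x n : set (code M) := [set y | forall k, (k < n)%N -> y k = x k].

Lemma cylinder_le x n m : (n <= m)%N -> cylinder x m `<=` cylinder x n.
Proof. by move=> nm y H k kn; apply: H; apply: leq_trans nm. Qed.

Let symbols := fun _ : nat => discrete_topology (symbol M).

Lemma nbhs_cylinder x n : nbhs x (cylinder x n).
Proof.
elim: n => [|n IH]; first by apply: filterS filterT.
have pn : nbhs x (@proj _ symbols n @^-1` [set x n]).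
  apply: open_nbhs_nbhs; split=> //.
  apply: (@open_comp (prod_topology symbols)); last exact: discrete_open.
  by move=> + _; exact: proj_continuous.
apply: filterS (filterI IH pn) => y [H yn] k; rewrite ltnS leq_eqVlt => /predU1P[->//|].
exact: H.
Qed.

(** Convergence in a product is coordinatewise, and a cylinder of depth i + 1 fixes the coordinate
    i. *)
Lemma nbhs_codeP x U : nbhs x U <-> exists n, cylinder x n `<=` U.
Proof.
split; last by move=> [n nU]; apply: filterS nU (nbhs_cylinder x n).
pose F : set_system (code M) := filter_from setT (cylinder x).
have FF : Filter F.
  apply: filter_from_filter; first by exists 0%N.
  move=> n m _ _; exists (maxn n m) => // y ym.
  by split; apply: cylinder_le ym; rewrite ?leq_maxl ?leq_maxr.
suff : F --> x by move=> /[apply] -[n _ nU]; exists n.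
suff : F --> (x : prod_topology symbols) by [].
apply/cvg_sup => i; apply/cvg_image.
  apply/seteqP; split=> // z _; exists (dfwith (x : prod_topology symbols) i z) => //.
move=> V Vx; exists (@proj _ symbols i @^-1` V).
  exists i.+1 => // y /(_ i (ltnSn i)) yi; rewrite /= /proj yi.
  exact: nbhs_singleton Vx.
apply/seteqP; split=> [z [y Vy <-]//|z Vz].
exists (dfwith (x : prod_topology symbols) i z); last by rewrite dfwithin.
by rewrite /= /proj dfwithin.
Qed.

Lemma code_compact : compact [set: code M].
Proof.
have fin (n : nat) : finite_set [set: symbols n] by exact: (@finite_finset (symbol M)).
have := tychonoff (fun n => finite_compact (fin n)).
by set A := (X in compact X -> _); rewrite (_ : A = setT)//; apply/seteqP.
Qed.

Lemma code_hausdorff : hausdorff_space (code M).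
Proof.
apply: (@hausdorff_product _ symbols) => n.
by apply: discrete_hausdorff; exact: discrete_space_discrete.
Qed.

Lemma code_neqP x y : x <> y -> exists n, x n <> y n.
Proof.
move=> xy; apply: contrapT => H; apply: xy; apply: functional_extensionality_dep => n.
by apply: contrapT => xyn; apply: H; exists n.
Qed.

(* The last clause says that [h] is open onto [A]. *)
Lemma cantor_parametrization (R : realType) A : closed A -> A !=set0 ->
  (forall x n, A x -> exists y, [/\ A y, cylinder x n y & y <> x]) ->
  exists h : cantor_space -> code M,
    [/\ continuous h, forall t, A (h t), injective h, forall x, A x -> exists t, h t = x
    & forall (t : cantor_space) (U : set cantor_space), nbhs t U -> exists n, forall y, A y -> cylinder (h t) n y ->
        exists2 t', U t' & h t' = y].
Proof.
move=> cA [x0 Ax0] noiso.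
have pA : isPointed (set_type A) := isPointed.Build (set_type A) (exist _ x0 (mem_set Ax0)).
pose T : pseudoPMetricType R := HB.pack_for (pseudoPMetricType R) (set_type A) pA.
pose vl : T -> code M := set_val.
have vlA (y : T) : A (vl y) by exact: set_valP.
have vl_inj : injective vl by exact: val_inj.
have vlS x : A x -> exists y : T, vl y = x.
  by move=> Ax; exists (exist _ x (mem_set Ax)).
have vl_cont : continuous vl by exact: initial_continuous.
have nbhsT (y : T) V : nbhs y V -> exists n, forall z, cylinder (vl y) n (vl z) -> V z.
  move=> [W [[W' oW' <-] /= W'y] W'V].
  have /nbhs_codeP[n nW] : nbhs (vl y) W' by exact: (open_nbhs_nbhs (conj oW' W'y)).
  by exists n => z /nW ?; exact: W'V.
have cyl_clopen (y : T) n : clopen (vl @^-1` cylinder (vl y) n).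
  split.
    rewrite openE => z /= yz; apply: vl_cont; apply: filterS (nbhs_cylinder (vl z) n).
    by move=> t zt k kn; rewrite zt// yz.
  rewrite -openC openE => z /= yz; apply: (@vl_cont z (~` cylinder (vl y) n)); apply: filterS (nbhs_cylinder (vl z) n).
  by move=> t zt ty; apply: yz => k kn; rewrite -zt// ty.
(* Brouwer's characterization of the Cantor set: perfect, compact, Hausdorff, with points separated
   by clopen sets. *)
have TC : cantor_like T.
  split.
  - apply/perfectTP => y oy.
    have /nbhsT[n nV] : nbhs y [set y] by apply: open_nbhs_nbhs.
    have [z [/vlS[z' <-] yz zy]] := noiso _ n (vlA y).
    by apply: zy; congr vl; exact: nV.
  - have cA' : compact A by apply: (subclosed_compact cA code_compact).
    move=> G PG _.
    have GA : (vl @ G) A.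
      by apply: (@filterS _ G _ setT) => [y _|]; [exact: vlA|exact: filterT].
    have [z [Az zG]] := cA' (vl @ G) _ GA.
    have [z' z'z] := vlS z Az; exists z'; split=> // V W GV /nbhsT[n nW].
    have [||u [[u' Vu' <-] /nW Wu]] := zG (vl @` V) (cylinder (vl z') n).
    + by apply: (@filterS _ G _ V) => // u Vu; exists u.
    + by rewrite z'z; exact: nbhs_cylinder.
    by exists u'; split.
  - move=> y z yz; apply: vl_inj; apply: code_hausdorff => V W Vy Wz.
    have [u [Vu Wu]] := yz _ _ (@vl_cont y V Vy) (@vl_cont z W Wz).
    by exists (vl u).
  - move=> y z yz; have [|n yzn] := @code_neqP (vl y) (vl z).
      by move=> /vl_inj E; move: yz; rewrite E eqxx.
    exists (vl @^-1` cylinder (vl y) n.+1); split=> // /(_ n (ltnSn n)) E.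
    by apply: yzn.
have [f [cf clf]] := @homeomorphism_cantor_like R T TC.
exists (vl \o f); split.
- move=> t; apply: continuous_comp; [exact: cf|exact: vl_cont].
- by move=> t; exact: vlA.
- by move=> t t' /vl_inj; apply: (@inj _ _ setT f); rewrite inE.
- move=> x /vlS [y <-]; have [t _ <-] := @surj _ _ _ _ f y I; by exists t.
- move=> t U; rewrite nbhsE => -[V0 [oV0 V0t] V0U].
  (* As f is a closed bijection, removing the image of the complement of V0 leaves an open set
     contained in the image of V0. *)
  have oV : open (~` (f @` (~` V0))) by apply: closed_openC; apply: clf; exact: open_closedC.
  have /nbhsT[n nV] : nbhs (f t) (~` (f @` (~` V0))).
    apply: open_nbhs_nbhs; split; first exact: oV.
    move=> [t' nV0t' E]; apply: nV0t'.
    by have -> : t' = t by apply: (@inj _ _ setT f); rewrite ?inE.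
  exists n => y /vlS[y' <-] /nV ny; have [t' _ E] := @surj _ _ _ _ f y' I.
  exists t'; last by rewrite /= E.
  by apply: V0U; apply: contrapT => nO; apply: ny; exists t'.
Qed.
End Code.

(** * Recurrence and aperiodicity of the colour sequences *)

Definition subshift (w : int -> bool) : set (int -> bool) :=
  [set eta | forall n : nat, exists m : int, forall i : int, `|i| <= n%:Z -> eta i = w (i + m)].

(** Uniform recurrence. It suffices to ask it of the central windows, since every finite word of w
    lies in one of them. *)
Definition recurrent (w : int -> bool) := forall n : nat, exists L : nat, forall s : int,
  exists2 t : int, s <= t <= s + L%:Z & forall i : int, `|i| <= n%:Z -> w (i + t) = w i.

Definition aperiodic (w : int -> bool) := forall m : int, m != 0 -> exists i, w (i + m) <> w i.

Section Subshift.
Variable w : int -> bool.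
Implicit Types (eta : int -> bool).

Lemma subshift_refl : subshift w w.
Proof. by move=> n; exists 0 => i _; rewrite addr0. Qed.

Lemma subshift_shift eta (m : int) : subshift w eta -> subshift w (fun i => eta (i - m)).
Proof.
move=> we n; have [k kE] := we (n + `|m|)%N; exists (k - m) => i iN.
by rewrite kE ?addrA; [congr w; ring|lia].
Qed.

Hypothesis wrec : recurrent w.

(** A window of eta of size n + L is a window of w, long enough to contain a return of the central
    word of w. *)
Lemma subshift_recurrent eta (n : nat) : subshift w eta ->
  exists t : int, forall i : int, `|i| <= n%:Z -> eta (i + t) = w i.
Proof.
move=> we; have [L LP] := wrec n; have [k kE] := we (n + L)%N.
have [t tL tE] := LP k; exists (t - k) => i iN.
by rewrite kE; [rewrite addrA subrK tE|lia].
Qed.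

(** Minimality of the subshift: a word of eta occurs in w, hence inside a central window of w, and
    that window occurs in eta'. *)
Lemma subshift_return eta eta' (n : nat) : subshift w eta -> subshift w eta' ->
  exists m : int, forall i : int, `|i| <= n%:Z -> eta' (i - m) = eta i.
Proof.
move=> we we'; have [k kE] := we n.
have [t tE] := subshift_recurrent (n + `|k|)%N we'.
exists (- (k + t)) => i iN; rewrite opprK addrA tE; last by lia.
by rewrite kE.
Qed.

(** A failure of the period m in w is visible in a finite window, which recurs in eta. *)
Lemma subshift_aperiodic eta : aperiodic w -> subshift w eta -> aperiodic eta.
Proof.
move=> wap we m /wap[i0 i0m].
have [t tE] := subshift_recurrent (`|i0| + `|m|)%N we.
by exists (i0 + t); rewrite addrAC !tE//; lia.
Qed.

End Subshift.

Lemma aperiodicP (w : int -> bool) :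
  (forall m : nat, (0 < m)%N -> ~ forall i, w (i + m%:Z) = w i) -> aperiodic w.
Proof.
move=> H m m0; apply: contrapT => /forallNP P.
have {}P i : w (i + m) = w i by apply: contrapT; exact: P.
case: m m0 P => m m0 P; first by apply: (H m) => //; lia.
by apply: (H m.+1) => // i; rewrite -(P (i + m.+1%:Z)); congr w; lia.
Qed.

(** * The Morse sequence *)

Section Morse.

Let bit_sum (K i : nat) := (\sum_(k < K) (i %/ 2 ^ k) %% 2)%N.

Let bit_sum_le (i K : nat) : (i <= K)%N -> bit_sum K i = bit_sum i i.
Proof.
move=> iK; rewrite -(subnKC iK) /bit_sum big_split_ord /= [X in (_ + X)%N]big1 ?addn0// => k _.
by rewrite divn_small// (leq_trans (ltn_expl _ (ltnSn 1)))// leq_exp2l// leq_addr.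
Qed.

Lemma thue_morse_double (n : nat) (c : bool) : thue_morse (n.*2 + c) = c (+) thue_morse n.
Proof.
have H (K : nat) : bit_sum K.+1 (n.*2 + c) = (c + bit_sum K n)%N.
  rewrite /bit_sum big_ord_recl /= divn1; congr (_ + _)%N.
    by rewrite -muln2 modnMDl; case: c.
  apply: eq_bigr => k _; rewrite /bump /= add1n expnS divnMA.
  by rewrite -muln2 divnMDl//; case: c; rewrite addn0.
rewrite /thue_morse -/(bit_sum _ _) -/(bit_sum _ _).
have := H (n.*2 + c)%N; rewrite [LHS]bit_sum_le// => ->.
by rewrite oddD oddb bit_sum_le//; lia.
Qed.

Lemma thue_morse_block (k a r : nat) : (r < 2 ^ k)%N ->
  thue_morse (a * 2 ^ k + r) = thue_morse a (+) thue_morse r.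
Proof.
elim: k r => [|k IH] r; first by rewrite ltnS leqn0 muln1 => /eqP ->; rewrite addn0 /thue_morse big_ord0 addbF.
have [h [c ->]] : exists h (c : bool), r = (h.*2 + c)%N.
  by exists r./2, (odd r); rewrite addnC odd_double_half.
rewrite expnS => rk.
have -> : (a * (2 * 2 ^ k) + (h.*2 + c) = (a * 2 ^ k + h).*2 + c)%N.
  by rewrite -!muln2; ring.
rewrite (thue_morse_double (a * 2 ^ k + h)%N c) (thue_morse_double h c).
have hk : (h < 2 ^ k)%N by move: rk; clear; move: (2 ^ k)%N => X; case: c; lia.
by rewrite (IH _ hk); exact: addbCA.
Qed.

(** Passing from r to 2^k - 1 - r complements k binary digits, which changes the parity of their sum
    by k. Even k is what suits the mirror image on the negative side. *)
Lemma thue_morse_rev (k r : nat) : (r < 2 ^ k)%N ->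
  thue_morse (2 ^ k - 1 - r) = odd k (+) thue_morse r.
Proof.
elim: k r => [|k IH] r; first by rewrite ltnS leqn0 => /eqP ->.
have [h [c ->]] : exists h (c : bool), r = (h.*2 + c)%N.
  by exists r./2, (odd r); rewrite addnC odd_double_half.
rewrite expnS => rk.
have -> : (2 * 2 ^ k - 1 - (h.*2 + c) = (2 ^ k - 1 - h).*2 + ~~ c)%N.
  by move: rk; clear; move: (2 ^ k)%N => X; case: c; lia.
rewrite (thue_morse_double (2 ^ k - 1 - h)%N (~~ c)) (thue_morse_double h c).
have hk : (h < 2 ^ k)%N by move: rk; clear; move: (2 ^ k)%N => X; case: c; lia.
rewrite (IH _ hk).
by rewrite /=; case: c {rk}; case: (odd k); case: (thue_morse _).
Qed.

Lemma morse_neg (i : int) : morse (- 1 - i) = morse i.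
Proof. by case: i => n; [rewrite (_ : -1 - _ = Negz n)|rewrite (_ : -1 - _ = Posz n)] => //; lia. Qed.

(* Around a multiple 2^k * n of an even power 2^k, the sequence reads as around 0 as soon as
   the two letters t_{n-1} and t_n vanish. *)
Let good (n : nat) := [/\ (0 < n)%N, thue_morse n.-1 = false & thue_morse n = false].

(** One of 2c and 2c + 1 is a d with t_d = 1; then t vanishes at 4d + 1 and at 4d + 2. *)
Let goodP (c : nat) : exists2 n : nat, (8 * c <= n < 8 * c + 8)%N & good n.
Proof.
have [d dc td] : exists2 d, (2 * c <= d <= 2 * c + 1)%N & thue_morse d = true.
  exists (c.*2 + ~~ thue_morse c)%N; first by case: (thue_morse c) => /=; lia.
  by rewrite thue_morse_double; case: (thue_morse c).
exists (4 * d + 2)%N; first by lia.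
split; first by lia.
  have -> : ((4 * d + 2).-1 = (d.*2 + false).*2 + true)%N by lia.
  by rewrite (thue_morse_double (d.*2 + false) true) (thue_morse_double d false) td.
have -> : (4 * d + 2 = (d.*2 + true).*2 + false)%N by lia.
by rewrite (thue_morse_double (d.*2 + true) false) (thue_morse_double d true) td.
Qed.

(** Non-negative i fall into the n-th block of length 2^k. Negative ones fall into the block n - 1,
    read backwards from its end, and for even k the reversal changes nothing. *)
Let good_shift (k n : nat) (i : int) : ~~ odd k -> good n -> `|i| < (2 ^ k)%N%:Z ->
  morse (i + (2 ^ k * n)%N%:Z) = morse i.
Proof.
move=> ek [n0 n1 n2]; move: (leqnn (2 ^ k)); case: i => i ik iK.
  by rewrite -PoszD /= addnC mulnC thue_morse_block ?n2.
have ik' : (i < 2 ^ k)%N by lia.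
have -> : Negz i + (2 ^ k * n)%N%:Z = (n.-1 * 2 ^ k + (2 ^ k - 1 - i))%N%:Z.
  by case: n n0 {n1 n2} => // n _; rewrite mulnS /=; lia.
by rewrite /= thue_morse_block ?n1 ?thue_morse_rev ?(negbTE ek)//; lia.
Qed.

Let good_shiftN (k n : nat) (i : int) : ~~ odd k -> good n -> `|i| + 1 < (2 ^ k)%N%:Z ->
  morse (i - (2 ^ k * n)%N%:Z) = morse i.
Proof.
move=> ek gn ik; rewrite -morse_neg -[RHS]morse_neg -(@good_shift k n (-1 - i))//; last by lia.
by congr morse; ring.
Qed.

Lemma morse_recurrent : recurrent morse.
Proof.
move=> n; pose k := n.+1.*2; pose B := (2 ^ k)%N.
have nB : (n.+1 < B)%N.
  by apply: leq_trans (ltn_expl _ (ltnSn 1)) _; rewrite leq_exp2l// /k; lia.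
have ek : ~~ odd k by rewrite /k odd_double.
have pos (s : nat) : exists2 m : nat, good m & (s <= B * m <= s + 16 * B)%N.
  have B0 : (0 < 8 * B)%N by rewrite muln_gt0 /B expn_gt0.
  have [m mc gm] := goodP (s %/ (8 * B)).+1; exists m => //.
  have := divn_eq s (8 * B); have := ltn_pmod s B0.
  move: (s %/ _)%N (s %% _)%N mc => q r /andP[m1 m2] r8 ->.
  by apply/andP; split; nia.
(* On each side of 0 the good multiples of B occur within every stretch of length 16 B; a window
   that contains 0 uses the shift 0. *)
exists (16 * B)%N => s.
have [s0|s0] := lerP 0 s.
  have [m gm ms] := pos `|s|%N; exists (B * m)%N%:Z; first by lia.
  by move=> i iN; apply: good_shift => //; rewrite -/B; lia.
have [s1|s1] := lerP (- (16 * B)%N%:Z) s.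
  by exists 0; [lia|move=> i _; rewrite addr0].
have [m gm ms] := pos (`|s| - 16 * B)%N; exists (- (B * m)%N%:Z); first by lia.
by move=> i iN; apply: good_shiftN => //; rewrite -/B; lia.
Qed.

(** Descent on the period, on non-negative indices. An even period can be halved. An odd period 2q +
    1, applied to t_(2j) and t_(2j+1), gives t_(j+q) = t_(j+q+1) for all j, which fails at j = q
    since t_(2q) and t_(2q+1) differ. *)
Lemma morse_aperiodic : aperiodic morse.
Proof.
apply: aperiodicP => m m0 P.
have {P} : forall i : nat, thue_morse (i + m) = thue_morse i.
  by move=> i; have := P i%:Z; rewrite -PoszD.
elim/ltn_ind: m m0 => m IH m0 P.
case: (boolP (odd m)) => om; last first.
  apply: (IH m./2); [lia|lia|move=> i].
  have := thue_morse_double (i + m./2) false; rewrite /= => <-.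
  have -> : ((i + m./2).*2 + false = (i.*2 + false) + m)%N by lia.
  by rewrite P thue_morse_double.
pose q := m./2.
have H j : thue_morse (j + q) = thue_morse (j + q).+1.
  have h1 : thue_morse (j.*2 + false + m) = ~~ thue_morse (j + q).
    have -> : (j.*2 + false + m = (j + q).*2 + true)%N by rewrite /q; lia.
    by rewrite thue_morse_double.
  have h2 : thue_morse (j.*2 + true + m) = thue_morse (j + q).+1.
    have -> : (j.*2 + true + m = (j + q).+1.*2 + false)%N by rewrite /q; lia.
    by rewrite thue_morse_double.
  move: h1 h2; rewrite !P !thue_morse_double; case: (thue_morse j) => /= h1 <-; by rewrite -[LHS]negbK -h1.
have := H q; rewrite (_ : (q + q = q.*2 + false)%N); last by lia.
rewrite (_ : (q.*2 + false).+1 = q.*2 + true)%N; last by lia.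
by rewrite !thue_morse_double; case: (thue_morse q).
Qed.

End Morse.

(** * Oxtoby sequences *)

Section Oxtoby.
Variable R : realType.
Variable (w : int -> bool) (p : nat -> nat).
Hypothesis p_ge3 : forall i, (1 <= i)%N -> (3 <= p i)%N /\ (p i %| p i.+1)%N.
Hypothesis p_sum : (\sum_(1 <= i <oo) ((p i)%:R / (p i.+1)%:R : R)%:E <= (12^-1)%:E)%E.
Hypothesis wE : forall m : int, exists i : nat, [/\ (1 <= i)%N, oxtoby_set p i m,
  forall j, (1 <= j < i)%N -> ~ oxtoby_set p j m & w m = odd i].

(** A single term of the series is at most its sum. *)
Let p12 i : (1 <= i)%N -> (12 * p i <= p i.+1)%N.
Proof.
move=> i1; have [p3 _] := p_ge3 i1; have [p3' _] := @p_ge3 i.+1 isT.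
have t0 (j : nat) : (0 <= ((p j)%:R / (p j.+1)%:R : R)%:E)%E by rewrite lee_fin divr_ge0.
have : ((p i)%:R / (p i.+1)%:R : R) <= 12^-1.
  rewrite -lee_fin; apply: le_trans p_sum.
  apply: le_trans (nneseries_lim_ge i.+1 (fun j _ _ => t0 j)).
  by rewrite big_nat_recr//= leeDr// sume_ge0.
have p0 : (0 : R) < (p i.+1)%:R by rewrite ltr0n (leq_trans _ p3').
rewrite (ler_pdivrMr _ _ p0) mulrC ler_pdivlMr// -natrM ler_nat mulnC.
exact.
Qed.

Let p_dvd j i : (1 <= j <= i)%N -> (p j %| p i)%N.
Proof.
move=> /andP[j1]; elim: i => [|i IH]; first by rewrite leqn0 => /eqP E; rewrite E in j1.
rewrite leq_eqVlt => /predU1P[->//|]; rewrite ltnS => ji.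
by apply: dvdn_trans (IH ji) _; have [] := @p_ge3 i (leq_trans j1 ji).
Qed.

Let p_ge i : (1 <= i)%N -> (i <= p i)%N.
Proof.
case: i => // i _; elim: i => [|i IH]; first by have [] := @p_ge3 1 isT; lia.
by have := @p12 i.+1 isT; lia.
Qed.

Let E_per j i (m k : int) : (1 <= j <= i)%N ->
  oxtoby_set p j (m + k * (p i.+1)%:Z) <-> oxtoby_set p j m.
Proof.
move=> ji; have /dvdnP[c pE] : (p j.+1 %| p i.+1)%N by apply: p_dvd; lia.
rewrite pE /oxtoby_set /=; split=> -[l lE]; [exists (l - k * c%:Z)|exists (l + k * c%:Z)];
  apply: le_trans lE; rewrite le_eqVlt; apply/orP; left; apply/eqP; congr `|_|; rewrite PoszM; ring.
Qed.

Let wE_uniq m i : (1 <= i)%N -> oxtoby_set p i m ->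
  (forall j, (1 <= j < i)%N -> ~ oxtoby_set p j m) -> w m = odd i.
Proof.
move=> i1 Ei Ej; have [i' [i'1 Ei' Ej' ->]] := wE m.
have [ii|ii|-> //] := ltngtP i' i; first by case: (@Ej i'); rewrite ?i'1.
by case: (@Ej' i); rewrite ?i1.
Qed.

(** Such an m lies in the i-th set, so its letter is decided by the sets of index at most i, all of
    which are invariant under p (i + 1). *)
Let w_per i (m k : int) : (1 <= i)%N -> `|m| <= (p i)%:Z -> w (m + k * (p i.+1)%:Z) = w m.
Proof.
move=> i1 mi; have [j [j1 Ej El ->]] := wE m.
have ji : (j <= i)%N.
  rewrite leqNgt; apply/negP => ij; case: (El i); first by rewrite i1.
  by exists 0; rewrite mul0r subr0.
apply: wE_uniq => //; first by apply/E_per; rewrite ?j1.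
by move=> l lj /E_per H; apply: (El l lj); apply: H; lia.
Qed.

Lemma oxtoby_recurrent_aux : recurrent w.
Proof.
move=> n; pose i := n.+1; have ni : (n <= p i)%N by have := @p_ge i isT; rewrite /i; lia.
exists (p i.+1) => s; pose P := (p i.+1)%:Z.
have P0 : 0 < P by have [] := @p_ge3 i.+1 isT; rewrite /P; lia.
exists (s - (s %% P)%Z + P).
  have := modz_ge0 s (lt0r_neq0 P0); have := ltz_pmod s P0; rewrite -/P; lia.
move=> l lN; rewrite {1}(divz_eq s P) addrK.
have -> : (s %/ P)%Z * P + P = ((s %/ P)%Z + 1) * P by ring.
by apply: w_per => //; lia.
Qed.

(* This integer lies outside the first i sets, since its residue modulo each period p (j + 1)
   is between 2 p j and 3 p j. *)
Let hole := fix hole i := if i is i'.+1 then (hole i' + 2 * p i)%N else 0%N.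

Let hole_itv i : (1 <= i)%N -> (2 * p i <= hole i <= 3 * p i)%N.
Proof.
case: i => // i _; elim: i => [|i IH]; first by rewrite /=; lia.
have := @p12 i.+1 isT; rewrite [hole _]/= -/(hole i.+1); lia.
Qed.

Let hole_mod j i : (1 <= j <= i)%N -> exists k : int, (hole i)%:Z = (hole j)%:Z + k * (p j.+1)%:Z.
Proof.
move=> /andP[j1]; elim: i => [|i IH]; first by rewrite leqn0 => /eqP E; rewrite E in j1.
rewrite leq_eqVlt => /predU1P[<-|]; first by exists 0; rewrite mul0r addr0.
rewrite ltnS => ji; have [k kE] := IH ji.
have /dvdnP[c cE] : (p j.+1 %| p i.+1)%N by apply: p_dvd; lia.
exists (k + 2 * c%:Z); rewrite [hole _]/= PoszD kE -/(p i.+1) cE; ring.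
Qed.

Let hole_notin j i : (1 <= j <= i)%N -> ~ oxtoby_set p j (hole i)%:Z.
Proof.
move=> ji; have [k ->] := hole_mod ji.
have j1 : (1 <= j)%N by lia.
have jj : (1 <= j <= j)%N by rewrite j1 leqnn.
move=> /(E_per _ _ jj) [l lE].
have := hole_itv j1; have := p12 j1; have [p3 _] := p_ge3 j1 => pp hh.
have [l0|l0] := lerP l 0.
  have : l * (p j.+1)%:Z <= 0 by rewrite mulr_le0_ge0.
  lia.
have : 1 * (p j.+1)%:Z <= l * (p j.+1)%:Z by rewrite ler_wpM2r//; lia.
lia.
Qed.

(** For a supposed period i, the points hole i and hole i + 2 p (i + 1) enter the sets first at the
    indices i + 1 and i + 2, so they carry different letters. But the period moves hole i to a
    residue within p i of 0, where a translation by a multiple of p (i + 1) preserves the letter. *)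
Lemma oxtoby_aperiodic_aux : aperiodic w.
Proof.
apply: aperiodicP => i m0 P.
have mp : (i <= p i)%N by exact: p_ge.
have h := hole_itv m0; have q1 := p12 m0; have q2 := @p12 i.+1 isT.
have [p3 _] := p_ge3 m0.
have Pk k x : w (x + k * i%:Z) = w x.
  case: k => k; elim: k => [|k IH]; first by rewrite mul0r addr0.
  - by rewrite -[RHS]IH -[RHS]P; congr w; rewrite -addn1 PoszD; ring.
  - by rewrite -[LHS]P; congr w; lia.
  - by rewrite -[RHS]IH -[LHS]P; congr w; rewrite !NegzE -(addn1 k.+1) PoszD; ring.
have e1 : w (hole i)%:Z = odd i.+1.
  apply: wE_uniq => //; last by move=> j ji; apply: hole_notin; lia.
  by exists 0; rewrite mul0r subr0; lia.
have e2 : w ((hole i)%:Z + 2 * (p i.+1)%:Z) = odd i.+2.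
  apply: wE_uniq => //.
    by exists 0; rewrite mul0r subr0; lia.
  move=> j /andP[j1]; rewrite ltnS leq_eqVlt => /predU1P[->|]; last first.
    by rewrite ltnS => ji /E_per H; apply: (@hole_notin j i); [|apply: H]; rewrite j1.
  move=> [l lE].
  have [l0|l0] := lerP l 0.
    have : l * (p i.+2)%:Z <= 0 by rewrite mulr_le0_ge0.
    lia.
  have : 1 * (p i.+2)%:Z <= l * (p i.+2)%:Z by rewrite ler_wpM2r//; lia.
  lia.
(* The residue satisfies r < i <= p i, as [w_per] requires. *)
pose r := ((hole i)%:Z %% i%:Z)%Z; pose l := ((hole i)%:Z %/ i%:Z)%Z.
have hE : (hole i)%:Z = r + l * i%:Z by rewrite {1}(divz_eq (hole i)%:Z i%:Z) addrC.
have rp : `|r| <= (p i)%:Z.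
  have : 0 <= r by apply: modz_ge0; lia.
  have : r < i%:Z by apply: ltz_pmod; lia.
  lia.
move: e2; rewrite hE -addrAC Pk w_per// -(Pk l) -hE e1 /=.
by case: (odd i).
Qed.

End Oxtoby.

Lemma oxtoby_recurrent (R : realType) w : oxtoby R w -> recurrent w.
Proof. by move=> [p [p3 ps wE]]; exact: oxtoby_recurrent_aux p3 ps wE. Qed.

Lemma oxtoby_aperiodic (R : realType) w : oxtoby R w -> aperiodic w.
Proof. by move=> [p [p3 ps wE]]; exact: oxtoby_aperiodic_aux p3 ps wE. Qed.

(** * The chart of the hull *)

Section CodeData.
Context {M : nat}.
Implicit Types (x y : code M) (n k : nat) (i : int).

Definition color x i : bool :=
  match i with Posz n => (x n).1.1.1 | Negz n => (x n).1.1.2 end.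
Definition xdigit x k : nat := (x k).1.2.
Definition ydigit x k : nat := (x k).2.

Lemma xdigit_lt x k : (xdigit x k < 2)%N.
Proof. by rewrite /xdigit; case: (_.2). Qed.

Lemma ydigit_lt x k : (ydigit x k < M.+1)%N.
Proof. exact: ltn_ord. Qed.

Lemma code_build (eta : int -> bool) (e f : nat -> nat) :
  (forall k, e k < 2)%N -> (forall k, f k < M.+1)%N ->
  exists x, [/\ color x =1 eta, xdigit x =1 e & ydigit x =1 f].
Proof.
move=> e2 fM.
exists (fun k => (eta k%:Z, eta (Negz k), e k == 1%N, Ordinal (fM k))); split=> //.
- by case.
- by move=> k; rewrite /xdigit /=; case: (e k) (e2 k) => [|[]].
Qed.

Lemma cylinder_color x y n i : cylinder x n.+1 y -> `|i| <= n%:Z -> color y i = color x i.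
Proof. by move=> xy; case: i => i iN; rewrite /= xy//; lia. Qed.

Lemma cylinderP x y n : (forall i, `|i| <= n%:Z -> color y i = color x i) ->
  (forall k, (k < n)%N -> xdigit y k = xdigit x k) ->
  (forall k, (k < n)%N -> ydigit y k = ydigit x k) -> cylinder x n y.
Proof.
move=> cE eE fE k kn.
have h1 := cE k%:Z; have h2 := cE (Negz k); have h3 := eE k kn; have h4 := fE k kn.
have {}h1 := h1 ltac:(lia). have {}h2 := h2 ltac:(lia).
move: h1 h2 h3 h4; rewrite /color /xdigit /ydigit.
case: (y k) (x k) => [[[y1 y2] y3] y4] [[[x1 x2] x3] x4] /= -> -> h3 h4.
congr (_, _, _, _); last exact: val_inj.
by move: h3; case: y3; case: x3.
Qed.

End CodeData.

Section Phi.
Context {R : realType} {a b : R} {M : nat} {s : bool} {w : int -> bool}.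
Hypothesis a0 : 0 < a.
Local Notation N := M.+1.
Local Notation lam := (ln 2 / a).
Local Notation nu := (ratio N s : R).
Hypothesis nuE : expR (- b * lam) = nu.
Local Notation Sol := (Sol a b).
Local Notation on_layer := (@on_layer R a b N s).
Local Notation layers := (@layers R a b N s).
Implicit Types (u v : int -> R) (g h p : Sol) (i j k m : int) (eta : int -> bool) (x y : code M)
  (n : nat).

Let N0 : (0 < N)%N. Proof. by []. Qed.
Let lam0 : 0 < lam. Proof. exact: lam_gt0. Qed.

Definition xoffset x : int -> R := digits 2 true (xdigit x).
Definition yoffset x : int -> R := digits N s (ydigit x).

Lemma xoffset_compat x : compat 2 (xoffset x). Proof. exact: (digits_compat 2 true). Qed.
Lemma yoffset_compat x : compat nu (yoffset x). Proof. exact: digits_compat. Qed.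

Definition layered x : tiling a b :=
  Tiling (layers_is_tiling a0 N0 nuE (color x) (yoffset x) (xoffset_compat x)).

Definition Phi p x : tiling a b := ltiling p (layered x).

Definition code_set : set (code M) := [set x | subshift w (color x)].

Lemma tiles_Phi p x : tiles (Phi p x) = dltrans p @` layers (color x) (xoffset x) (yoffset x).
Proof. by []. Qed.

Lemma PhiM g p x : ltiling g (Phi p x) = Phi (g * p)%g x.
Proof. by rewrite /Phi ltilingM. Qed.

Lemma near_layer (C Z : R) : exists n, forall p i u v g c, `|p.2| <= Z -> on_layer u v i g ->
  (dltrans (p * g)%g (tile a b, c)).1 `&` box C !=set0 -> `|i| <= n%:Z.
Proof.
(* The term 2 lam is the bound on the height of a tile. *)
pose B := (`|C| + `|Z| + 2 * lam) / lam.
exists (absz (Num.floor B + 1)) => p i u v g c pZ [_ _ gz] [h [[q /(tile_bound a0) [_ _ /andP[q0 q1]] <-] [_ _]]].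
rewrite !sol_mulE /= gz => hC.
have iB : `|i%:~R| <= B.
  have iE : `|i%:~R| * lam = `|i%:~R * lam| by rewrite normrM (gtr0_norm lam0).
  rewrite ler_pdivlMr// iE.
  have := ler_norm C; have := ler_norm Z; have := ler_normB (p.2 + i%:~R * lam + q.2) (p.2 + q.2).
  rewrite (_ : p.2 + i%:~R * lam + q.2 - (p.2 + q.2) = i%:~R * lam); last by ring.
  have := ler_normD p.2 q.2; have : `|q.2| = q.2 by apply: ger0_norm.
  by lra.
have iF : `|i| <= Num.floor B by rewrite floor_ge_int intr_norm.
lia.
Qed.

Lemma agree_layers n p eta u v eta' u' v' t :
  (forall i, `|i| <= n%:Z -> [/\ eta i = eta' i, latt 2 i (u i - u' i) & latt nu i (v i - v' i)]) ->
  (forall i g, on_layer u v i g -> t = dltrans (p * g)%g (tile a b, eta i) -> `|i| <= n%:Z) ->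
  (dltrans p @` layers eta u v) t -> (dltrans p @` layers eta' u' v') t.
Proof.
move=> H nl [_ [i [g [gi ->]]]]; rewrite -dltransM => tE.
have [ei ui vi] := H i (nl i g gi (esym tE)); rewrite -tE.
exists (dltrans g (tile a b, eta i)); last by rewrite dltransM.
exists i, g; rewrite ei; split=> //; case: gi => gx gy gz; split=> //.
- exact: latt_trans ui.
- exact: latt_trans vi.
Qed.

(** The bridge between the topology and the data of the layers: for a fixed p, only finitely many
    layers meet a given ball. *)
Lemma same_near_layers (eps : R) p : 0 < eps -> exists n, forall (S S' : tiling a b) eta u v eta' u' v',
  tiles S = dltrans p @` layers eta u v -> tiles S' = dltrans p @` layers eta' u' v' ->
  (forall i, `|i| <= n%:Z -> [/\ eta i = eta' i, latt 2 i (u i - u' i) & latt nu i (v i - v' i)]) ->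
  same_near eps^-1 S S'.
Proof.
move=> e0; have [C C0 CB] := @sol_ball_bounded R a b a0 eps^-1.
have [n nP] := near_layer C `|p.2|; exists n => S S' eta u v eta' u' v' SE S'E H t tB.
have tC : t.1 `&` box C !=set0 by case: tB => z [tz /CB]; exists z.
rewrite SE S'E; split; apply: (@agree_layers n) => [i iN|i g gi E].
- exact: H.
- by apply: (nP p i u v g (eta i) (lexx _) gi); rewrite -E.
- by have [-> ui vi] := H i iN; split=> //; exact: lattBC.
- by apply: (nP p i u' v' g (eta' i) (lexx _) gi); rewrite -E.
Qed.

Lemma xoffset_cylinder x y n i : cylinder x n y -> `|i| <= n%:Z -> xoffset y i = xoffset x i.
Proof. by move=> xy; apply: digits_eq => k kn; rewrite /xdigit xy. Qed.

Lemma yoffset_cylinder x y n i : cylinder x n y -> `|i| <= n%:Z -> yoffset y i = yoffset x i.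
Proof. by move=> xy; apply: digits_eq => k kn; rewrite /ydigit xy. Qed.

(** Closeness permits a translation by p p'^-1, which gives the second tiling the same placement p
    as the first; the codes then have to agree on finitely many layers only. *)
Lemma Phi_continuous : continuous (fun px : Sol * code M => Phi px.1 px.2).
Proof.
move=> [p x] U /= /(nbhs_closeP a0)[eps e0 eU].
have [n nP] := same_near_layers p e0.
have [c c0 cB] := @box_ball_small R a b a0 _ e0.
have V : nbhs p [set p' | box c (p * p'^-1)%g].
  have : (p * p'^-1 : Sol)%g @[p' --> p] --> (p * p^-1 : Sol)%g.
    by apply: cvg_solM; [exact: cvg_cst|exact: cvg_solV].
  by rewrite mulgV => H; apply: H; exact: nbhs_box.
(* The colour of layer n is read in the symbol of index n, whence depth n + 1; depth n is enough for
   the offsets. *)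
exists ([set p' | box c (p * p'^-1)%g], cylinder x n.+1).
  by split=> //; exact: nbhs_cylinder.
move=> [p' y] /= [Vp' xy]; apply: eU; exists 1%g, (p * p'^-1)%g; split.
- exact: sol_ball1.
- exact: cB.
- have xy' : cylinder x n y by apply: cylinder_le xy.
  rewrite ltiling1 PhiM -mulgA mulVg mulg1; apply: (nP _ _ _ _ _ _ _ _ (tiles_Phi p x) (tiles_Phi p y)) => i iN.
  rewrite (cylinder_color xy)// (xoffset_cylinder xy')// (yoffset_cylinder xy')//.
  by rewrite !subrr; split=> //; exact: latt0.
Qed.

(** Any tile can be taken as the base: moving its origin g to the identity shifts the layers by - m
    and makes the offsets of layer 0 integers, so that both solenoid points acquire digits. *)
Lemma renormalize eta u v m g : compat 2 u -> compat nu v -> on_layer u v m g ->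
  exists2 x, (forall i, color x i = eta (i + m)) &
    dltrans g^-1%g @` layers eta u v = layers (color x) (xoffset x) (yoffset x).
Proof.
move=> cu cv gm; have [_ _ gz] := gm.
pose gx := (g^-1%g : Sol).1.1; pose gy := (g^-1%g : Sol).1.2.
have gE : (g^-1)%g = layer_point gx gy (- m) :> Sol.
  by rewrite /layer_point intrN mulNr -gz /gx /gy; case: (g) => [[]].
have g1 : on_layer (fun j => gx + 2 ^ (- m) * u (j - - m))
    (fun j => gy + nu ^ (- m) * v (j - - m)) 0 1%g.
  have := (on_layer_translate a0 N0 nuE u v m gx gy (- m) g).1 gm.
  by rewrite -gE mulVg subrr.
have cu' := @compat_shift _ 2 u gx (- m) (@ratio_neq0 R 2 true isT) cu.
have cv' := @compat_shift _ nu v gy (- m) (@ratio_neq0 R N s N0) cv.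
have [||e e2 eP] := @digits_exist R 2 true _ _ cu' => //.
  by case: g1 => H _ _; have := lattN H; rewrite sub0r opprK.
have [||f fN fP] := @digits_exist R N s _ _ cv' => //.
  by case: g1 => _ H _; have := lattN H; rewrite sub0r opprK.
have [x [xc xe xf]] := code_build (fun i => eta (i + m)) e2 fN.
exists x => //; rewrite gE (layers_translate a0 N0 nuE); apply: eq_layers => i.
- by rewrite opprK xc.
- by rewrite /xoffset (functional_extensionality_dep xe).
- by rewrite /yoffset (functional_extensionality_dep xf).
Qed.

Lemma layer_index i j : i%:~R * lam = j%:~R * lam -> i = j.
Proof. by move=> /(mulIf (lt0r_neq0 lam0))/intr_inj. Qed.

Lemma layered_on x g c : layers (color x) (xoffset x) (yoffset x) (dltrans g (tile a b, c)) ->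
  exists i, on_layer (xoffset x) (yoffset x) i g /\ c = color x i.
Proof. by move=> /(layersP a0). Qed.

Definition layer_origin x i : Sol := (xoffset x i, yoffset x i, i%:~R * lam).

Lemma layer_origin_on x i : on_layer (xoffset x) (yoffset x) i (layer_origin x i).
Proof. by split; rewrite /= ?subrr//; exact: latt0. Qed.

Lemma layer_origin0 x : layer_origin x 0 = 1%g.
Proof.
by rewrite /layer_origin /xoffset /yoffset /digits oppr0; case: s; rewrite /= !big_ord0 mul0r.
Qed.

(** One tile in each layer reveals its colour and its offset modulo the lattice, hence the
    digits. *)
Lemma cylinder_layers x y n :
  (forall i, `|i| <= n%:Z -> layers (color y) (xoffset y) (yoffset y)
     (dltrans (layer_origin x i) (tile a b, color x i))) -> cylinder x n y.
Proof.
move=> H; have {}H i : `|i| <= n%:Z -> [/\ color y i = color x i,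
    latt 2 i (xoffset y i - xoffset x i) & latt nu i (yoffset y i - yoffset x i)].
  move=> /H /layered_on [j [[jx jy /= /layer_index E] ->]]; rewrite -E in jx jy *.
  by split=> //; exact: lattBC.
apply: cylinderP => [i /H[]//||].
- apply: (@digits_inj R 2 true) => [k|k|i /H[]//]; exact: xdigit_lt.
- apply: (@digits_inj R N s) => [k|k|i /H[]//]; exact: ydigit_lt.
Qed.

(** The displacement d is the origin of a tile of [layered x]. Its height is a multiple of lam
    smaller than lam in absolute value, so it lies in layer 0, whose origins are the integer points;
    hence d = 1. The codes are then compared layer by layer. *)
Lemma Phi_inj p p' x x' : Phi p x = Phi p' x' ->
  `|(p^-1 * p')%g.1.1| < 1 -> `|(p^-1 * p')%g.1.2| < 1 -> `|(p^-1 * p')%g.2| < lam ->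
  p = p' /\ x = x'.
Proof.
move=> E; set d : Sol := (p^-1 * p')%g => dx dy dz.
have {}E : layered x = ltiling d (layered x').
  rewrite /d ltilingM -/(Phi p' x') -E /Phi -ltilingM mulVg ltiling1//.
have in' i : tiles (layered x) (dltrans (d * layer_origin x' i)%g (tile a b, color x' i)).
  rewrite E; exists (dltrans (layer_origin x' i) (tile a b, color x' i)); last by rewrite -dltransM.
  by exists i, (layer_origin x' i); split=> //; exact: layer_origin_on.
have d1 : d = 1%g.
  have := in' 0; rewrite layer_origin0 mulg1 => /layered_on [i [[ix iy iz] _]].
  have i0 : i = 0.
    move: dz; rewrite iz normrM (gtr0_norm lam0) gtr_pMl// -intr_norm (ltr_int _ _ 1); lia.
  have o0 := layer_origin0 x; case: o0 => ox oy _.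
  move: ix iy iz; rewrite i0 ox oy !subr0 => -[kx dxE] [ky dyE] dzE.
  move: dx dy; rewrite dxE dyE !expr0z !mul1r -!intr_norm !(ltr_int _ _ 1) => kx1 ky1.
  have kx0 : kx = 0 by lia.
  have ky0 : ky = 0 by lia.
  move: dxE dyE dzE; rewrite kx0 ky0 !mulr0 mul0r.
  by case: (d) => [[? ?] ?] /= -> -> ->.
split; first by rewrite -[p]mulg1 -d1 /d mulgA mulgV mul1g.
apply: contrapT => /code_neqP[n]; apply.
have := @cylinder_layers x' x n.+1; move=> /(_ _)/(_ n (ltnSn n)); apply => i _.
by have := in' i; rewrite d1 mul1g.
Qed.

Hypothesis M0 : (0 < M)%N.
Hypothesis wrec : recurrent w.
Hypothesis wap : aperiodic w.

Lemma Phi_free p x g : code_set x -> ltiling g (Phi p x) = Phi p x -> g = 1%g.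
Proof.
move=> wx E; pose d : Sol := (p^-1 * g * p)%g.
have {}E : ltiling d (layered x) = layered x.
  rewrite /d !ltilingM -/(Phi p x) E /Phi -ltilingM mulVg ltiling1//.
have in' i : tiles (layered x) (dltrans (d * layer_origin x i)%g (tile a b, color x i)).
  rewrite -{1}E; exists (dltrans (layer_origin x i) (tile a b, color x i)); last by rewrite -dltransM.
  by exists i, (layer_origin x i); split=> //; exact: layer_origin_on.
suff d1 : d = 1%g.
  have -> : g = (p * d * p^-1)%g by rewrite /d !mulgA mulgV mul1g mulgK.
  by rewrite d1 mulg1 mulgV.
have := in' 0; rewrite layer_origin0 mulg1 => /layered_on [m [[_ _ dz] _]].
have m0 : m = 0.
  apply: contrapT => /eqP /(subshift_aperiodic wrec wap wx) [i]; apply.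
  have /layered_on [j [[_ _ jz] ->]] := in' i; congr color.
  by apply: layer_index; rewrite -jz -[RHS]/(d.2 + i%:~R * lam) dz intrD mulrDl addrC.
have dz0 : d.2 = 0 by rewrite dz m0 mul0r.
have dl i : latt 2 i d.1.1 /\ latt nu i d.1.2.
  have /layered_on [j [[jx jy jz] _]] := in' i.
  have ji : j = i by apply: layer_index; rewrite -jz -[LHS]/(d.2 + i%:~R * lam) dz0 add0r.
  rewrite ji in jx jy.
  have {}jx : latt 2 i (d.1.1 + expR (a * d.2) * xoffset x i - xoffset x i) := jx.
  have {}jy : latt nu i (d.1.2 + expR (- b * d.2) * yoffset x i - yoffset x i) := jy.
  by move: jx jy; rewrite dz0 !mulr0 expR0 !mul1r !addrK => jx jy; split.
have dx0 : d.1.1 = 0 by apply: (@ratio_latt0 R 2 true) => // i; have [] := dl i.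
have dy0 : d.1.2 = 0 by apply: (@ratio_latt0 R N s) => // i; have [] := dl i.
by move: dx0 dy0 dz0; case: (d) => [[? ?] ?] /= -> -> ->.
Qed.

End Phi.

(** * The hull as the image of the chart *)

Section TilingSpace.
Context {R : realType} {a b : R}.
Hypothesis a0 : 0 < a.

Lemma tiling_hausdorff : hausdorff_space (tiling a b).
Proof.
move=> S S' SS'; apply: (close_eq a0) => eps e0.
have [d d0 dE] := @close_trans R a b a0 _ e0.
have nS (T : tiling a b) : nbhs T [set T' | close d T T'] by apply/(nbhs_closeP a0); exists d.
have [T [ST S'T]] := SS' _ _ (nS S) (nS S').
by apply: dE ST _; exact: close_sym.
Qed.

End TilingSpace.

Lemma affine_shift (K : comRingType) (d e o r f : K) :
  d + e * (o + r * - f) = d + e * o - f * (e * r).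
Proof. ring. Qed.

Section Hull.
Context {R : realType} {a b : R} {M : nat} {s : bool} {w : int -> bool}.
Hypothesis a0 : 0 < a.
Local Notation N := M.+1.
Local Notation lam := (ln 2 / a).
Local Notation nu := (ratio N s : R).
Hypothesis nuE : expR (- b * lam) = nu.
Hypothesis wrec : recurrent w.
Local Notation Sol := (Sol a b).
Local Notation on_layer := (@on_layer R a b N s).
Local Notation layers := (@layers R a b N s).
Local Notation Phi := (Phi a0 nuE).
Local Notation code_set := (@code_set M w).
Local Notation xoffset := (@xoffset R M).
Local Notation layer_origin := (@layer_origin R a b M s).
Local Notation yoffset := (@yoffset R M s).
Implicit Types (u v : int -> R) (g h p : Sol) (i j k m : int) (eta : int -> bool) (x y : code M)
  (n : nat).

Let N0 : (0 < N)%N. Proof. by []. Qed.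
Let lam0 : 0 < lam. Proof. exact: lam_gt0. Qed.

Lemma renormalize_tiling (S : tiling a b) p eta u v m g : compat 2 u -> compat nu v ->
  subshift w eta -> tiles S = dltrans p @` layers eta u v -> on_layer u v m g ->
  exists2 x, code_set x & S = Phi (p * g)%g x.
Proof.
move=> cu cv we SE gm; have [x xc xE] := renormalize a0 nuE eta cu cv gm.
exists x.
  have := subshift_shift (- m) we; rewrite /code_set /=.
  by congr subshift; apply/funext => i; rewrite xc opprK.
apply: tiling_eq; rewrite tiles_Phi -xE image_comp SE.
by apply: eq_imagel => t _; rewrite /= -dltransM -mulgA mulgV mulg1.
Qed.

(** A bound for the spacings e^(a z) and e^(- b z) between the origins of the tiles of a layer at
    height 0 <= z <= lam. *)
Definition domain_bound : R := expR ((a + `|b|) * lam).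

Definition domain : set Sol :=
  [set g | [/\ 0 <= g.1.1 <= domain_bound, 0 <= g.1.2 <= domain_bound & 0 <= g.2 <= lam]].

Lemma domain_compact : compact domain.
Proof.
have H (c : R) : compact [set x : R | 0 <= x <= c].
  have -> : [set x : R | 0 <= x <= c] = `[0, c]%classic by apply/funext => x; rewrite /= in_itv.
  exact: segment_compact.
have := compact_setX (compact_setX (H domain_bound) (H domain_bound)) (H lam).
congr (@compact (space3 R)); apply/seteqP; split=> -[[x y] z].
  by move=> [[]].
by move=> [].
Qed.

(** The layer m is chosen with its height in [0, lam); the origins of its tiles then form a lattice
    whose spacings are at most [domain_bound], so one of them lies in [domain], and the tiling is
    based there. *)
Lemma domainP (S : tiling a b) p eta u v : compat 2 u -> compat nu v ->
  subshift w eta -> tiles S = dltrans p @` layers eta u v ->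
  exists (k : Sol) x, [/\ domain k, code_set x & S = Phi k x].
Proof.
move=> cu cv we SE; pose m := - Num.floor (p.2 / lam).
pose z := p.2 + m%:~R * lam.
have zE : z = (p.2 / lam - (Num.floor (p.2 / lam))%:~R) * lam.
  by rewrite /z /m intrN mulrBl mulfVK ?gt_eqF// mulNr.
have z01 : 0 <= z < lam.
  have /andP[f0 f1] := floor_itv01 (p.2 / lam).
  by rewrite zE mulr_ge0 ?(ltW lam0)//= gtr_pMl.
have [z0 z1] := andP z01.
have fit (c d q o : R) : q != 0 -> expR (c * p.2) * q ^ m = expR (c * z) -> `|c| <= a + `|b| ->
    exists l : int, 0 <= d + expR (c * p.2) * (o + q ^ m * l%:~R) <= domain_bound.
  move=> q0 qE cab; pose B := expR (c * z); pose A := d + expR (c * p.2) * o.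
  have B0 : 0 < B by exact: expR_gt0.
  have BD : B <= domain_bound.
    rewrite ler_expR; apply: (le_trans (ler_norm _)); rewrite normrM ler_pM//.
    by rewrite ger0_norm// ltW.
  exists (- Num.floor (A / B)).
  have -> : d + expR (c * p.2) * (o + q ^ m * (- Num.floor (A / B))%:~R) =
      (A / B - (Num.floor (A / B))%:~R) * B.
    rewrite mulrBl divfK ?gt_eqF// intrN.
    by rewrite affine_shift qE.
  have /andP[f0 f1] := floor_itv01 (A / B).
  rewrite mulr_ge0 ?(ltW B0)//=; apply: le_trans BD.
  by rewrite ger_pMl// ltW.
have ez c : expR (c * p.2) * expR (c * (m%:~R * lam)) = expR (c * z).
  by rewrite -expRD -mulrDr.
have [|||j jP] := @fit a p.1.1 2 (u m).
- by rewrite pnatr_eq0.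
- by rewrite -(expR_layer_x a0) ez.
- by rewrite gtr0_norm// lerDl.
have [|||k kP] := @fit (- b) p.1.2 nu (v m).
- exact: ratio_neq0.
- by rewrite -(expR_layer_y nuE) ez.
- by rewrite normrN lerDr ltW.
pose g : Sol := (u m + 2 ^ m * j%:~R, v m + nu ^ m * k%:~R, m%:~R * lam).
have gm : on_layer u v m g.
  by split; rewrite //= addrAC subrr add0r; [exists j|exists k].
have [x wx ->] := renormalize_tiling cu cv we SE gm.
exists (p * g)%g, x; split=> //; split=> //=.
by rewrite z0 ltW.
Qed.

Lemma code_set_closed : closed code_set.
Proof.
rewrite -openC openE => x /=; rewrite /code_set /= /subshift /=.
move=> /existsNP [n] Hn; apply/nbhs_codeP; exists n.+1 => y xy Hy; apply: Hn.
have [m mE] := Hy n; exists m => i iN; rewrite -mE//.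
by rewrite (cylinder_color xy).
Qed.

Definition Phi_image : set (tiling a b) := [set S | exists (k : Sol) x, [/\ domain k, code_set x & S = Phi k x]].

Lemma Phi_image_compact : compact Phi_image.
Proof.
have := compact_setX domain_compact (subclosed_compact code_set_closed code_compact (@subsetT _ _)).
move=> /(continuous_compact (continuous_subspaceT (@Phi_continuous R a b M s a0 nuE))).
congr compact; apply/seteqP; split=> S.
  by move=> [[k x] [Dk wx] <-]; exists k, x.
by move=> [k [x [Dk wx ->]]]; exists (k, x).
Qed.

Lemma Phi_image_Phi p x : code_set x -> Phi_image (Phi p x).
Proof.
move=> wx; apply: domainP wx (tiles_Phi a0 nuE p x).
- exact: xoffset_compat.
- exact: yoffset_compat.
Qed.

(** Once the colours agree on a window after a shift by m, the differences of the offsets are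
    solenoid points, each replaced on that window by one translation. Applied to the model it shows
    that every [Phi p x] with a code in [code_set] is in the hull; applied to a point of the hull it
    gives the density of its orbit. *)
Lemma approx_orbit (eps : R) p x (S : tiling a b) p' eta u v : 0 < eps -> code_set x ->
  compat 2 u -> compat nu v -> subshift w eta -> tiles S = dltrans p' @` layers eta u v ->
  exists g, close eps (Phi p x) (ltiling g S).
Proof.
move=> e0 wx cu cv we SE.
have [n nP] := @same_near_layers R a b M s a0 eps p e0.
have [m mE] := subshift_return wrec n wx we.
pose u1 i := 2 ^ m * u (i - m); pose v1 i := nu ^ m * v (i - m).
have cu1 : compat 2 (fun i => xoffset x i - u1 i).
  apply: (@compatB R 2 (xoffset x) u1); first exact: xoffset_compat.
  have := @compat_shift _ 2 u 0 m (@ratio_neq0 R 2 true isT) cu.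
  by under eq_fun do rewrite add0r.
have cv1 : compat nu (fun i => yoffset x i - v1 i).
  apply: (@compatB R nu (yoffset x) v1); first exact: yoffset_compat.
  have := @compat_shift _ nu v 0 m (@ratio_neq0 R N s N0) cv.
  by under eq_fun do rewrite add0r.
have [X XP] := @compat_approx R 2 true _ n isT cu1.
have [Y YP] := @compat_approx R N s _ n isT cv1.
exists (p * layer_point X Y m * p'^-1)%g; exists 1%g, 1%g; split; try exact: sol_ball1.
rewrite !ltiling1; apply: (nP _ _ _ _ _ _ _ _ (tiles_Phi a0 nuE p x)
  (_ : _ = dltrans p @` layers (fun i => eta (i - m)) (fun i => X + u1 i) (fun i => Y + v1 i))).
  rewrite /= SE -(layers_translate a0 N0 nuE) !image_comp; apply: eq_imagel => t _.
  by rewrite /= -!dltransM -!mulgA mulVg mulg1.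
move=> i iN; rewrite mE//; split=> //.
  by have := lattN (XP i iN); congr latt; ring.
by have := lattN (YP i iN); congr latt; ring.
Qed.

Lemma model_orbitP (S : tiling a b) : model_orbit w S <->
  exists g, tiles S = dltrans g @` layers w (fun=> 0) (fun=> 0).
Proof.
rewrite /model_orbit (decorated_tilingE a0 N0 nuE); split=> -[g gE]; first by exists g^-1%g.
by exists g^-1%g; rewrite invgK.
Qed.

(** The image is compact in a Hausdorff space, hence closed, and contains the model orbit;
    conversely [approx_orbit] approximates each of its points by that orbit. *)
Lemma hullE : hull a b w = Phi_image.
Proof.
apply/seteqP; split.
  have cl : closed Phi_image := compact_closed (tiling_hausdorff a0) Phi_image_compact.
  rewrite /hull [X in _ `<=` X](closure_id _).1//; apply: closure_subset.
  move=> S /model_orbitP[g gE].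
  by apply: domainP gE; [exact: compat0|exact: compat0|exact: subshift_refl].
move=> _ [p [x [_ wx ->]]] U /(nbhs_closeP a0)[eps e0 eU].
pose S : tiling a b := Tiling (layers_is_tiling a0 N0 nuE w (fun=> 0) (@compat0 R 2)).
have [g /eU gU] : exists g, close eps (Phi p x) (ltiling g S).
  apply: (@approx_orbit _ _ _ _ 1%g w (fun=> 0) (fun=> 0)) => //.
  - exact: compat0.
  - exact: compat0.
  - exact: subshift_refl.
  - by under eq_imagel do rewrite dltrans1; rewrite image_id.
by exists (ltiling g S); split=> //; apply/model_orbitP; exists g.
Qed.

Lemma hull_Phi p x : code_set x -> hull a b w (Phi p x).
Proof. by move=> wx; rewrite hullE; exact: Phi_image_Phi. Qed.

(** A tiling of the hull close to [Phi p x] contains, up to the small element g'^-1 g, the origin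
    tiles of the layers |i| <= n. Based at the one of layer 0, it is [Phi p' x'] with p' = g'^-1 g p
    near p, and the other tiles force x' into the cylinder. *)
Lemma Phi_open p x (V : set Sol) n : code_set x -> nbhs p V ->
  exists2 eps : R, 0 < eps & forall S', hull a b w S' -> close eps (Phi p x) S' ->
    exists p' x', [/\ V p', code_set x', cylinder x n x' & S' = Phi p' x'].
Proof.
move=> wx pV.
have [c c0 cV] : exists2 c : R, 0 < c & forall g g' : Sol, box c g -> box c g' -> V (g'^-1 * g * p)%g.
  have : ((q.1^-1 * q.2 * p)%g : Sol) @[q --> ((1%g, 1%g) : Sol * Sol)] --> (1^-1 * 1 * p : Sol)%g.
    apply: cvg_solM; last exact: cvg_cst.
    by apply: cvg_solM; [apply: cvg_solV; exact: cvg_fst|exact: cvg_snd].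
  rewrite mulVg mul1g => H; have [[A B] [nA nB] sAB] := H _ pV.
  have /nbhs1P[c c0 cU] : nbhs (1%g : Sol) (A `&` B) by exact: filterI.
  exists c => // g g' /cU[_ Bg] /cU[Ag' _].
  exact: (sAB (g', g) (conj Ag' Bg)).
have [C CP] : exists C, forall g i, box 1 g -> `|i| <= n%:Z -> box C (g * p * layer_origin x i)%g.
  pose f (q : Sol) : R := `|q.1.1| + `|q.1.2| + `|q.2| + 1.
  (* The sum over the 2 n + 1 layers dominates each coordinate of each origin. *)
  pose D := \sum_(j < n.*2.+1) f (p * layer_origin x (j%:Z - n%:Z))%g.
  have [C CE] := @box_mul_bounded R a b a0 D.
  exists C => g i g1 iN; have := CE 1%g g (p * layer_origin x i)%g.
  rewrite invg1 mulg1 mulgA; apply=> //; first by split; rewrite /= normr0.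
  have jn : (absz (i + n%:Z)%R < n.*2.+1)%N by lia.
  have f0 q : 0 <= f q by rewrite /f !addr_ge0.
  have : f (p * layer_origin x i)%g <= D.
    rewrite /D (bigD1 (Ordinal jn))//= (_ : _ - _ = i); last by lia.
    by rewrite lerDl sumr_ge0.
  move: (p * layer_origin x i)%g => q; rewrite /f => qD.
  have := normr_ge0 q.1.1; have := normr_ge0 q.1.2; have := normr_ge0 q.2 => *; split; lra.
have [r r0 rB] := @box_ball_large R a b a0 C.
have c1 : 0 < Num.min c 1 by rewrite lt_min c0 ltr01.
have [d d0 dB] := @sol_ball_small R a b a0 _ c1.
pose eps := Num.min d r^-1.
have e0 : 0 < eps by rewrite lt_min d0 invr_gt0.
have er : r <= eps^-1.
  by rewrite -[r]invrK lef_pV2 ?posrE ?invr_gt0// /eps ge_min lexx orbT.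
have ed : eps <= d by rewrite ge_min lexx.
have lec : @box R a b (Num.min c 1) `<=` box c by apply: box_le; rewrite ge_min lexx.
have le1 : @box R a b (Num.min c 1) `<=` box 1 by apply: box_le; rewrite ge_min lexx orbT.
exists eps => // S'; rewrite hullE => -[p0 [y [_ wy S'E]]].
move=> [g [g' [/(sol_ball_le ed)/dB gd /(sol_ball_le ed)/dB gd' sn]]].
pose p' : Sol := (g'^-1 * g * p)%g.
have in' i : `|i| <= n%:Z -> tiles S' (dltrans (p' * layer_origin x i)%g (tile a b, color x i)).
  move=> iN; have : tiles (ltiling g (Phi p x)) (dltrans (g * p * layer_origin x i)%g (tile a b, color x i)).
    rewrite PhiM tiles_Phi; exists (dltrans (layer_origin x i) (tile a b, color x i)); last by rewrite -dltransM.
    by exists i, (layer_origin x i); split=> //; exact: layer_origin_on.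
  move/sn => H; have {}H : tiles (ltiling g' S') (dltrans (g * p * layer_origin x i)%g (tile a b, color x i)).
    apply: H; exists (g * p * layer_origin x i)%g; split.
      by exists 1%g; [exact: tile1|rewrite mulg1].
    by apply/(sol_ball_le er)/rB/CP => //; exact: le1.
  by move/ltiling_tiles : H; rewrite -dltransM !mulgA.
pose d0' : Sol := (p0^-1 * p')%g.
have p'E : p' = (p0 * d0')%g by rewrite /d0' mulgA mulgV mul1g.
have [m [mP _]] : exists m, on_layer (xoffset y) (yoffset y) m d0' /\ color x 0 = color y m.
  apply: (layered_on a0); have n0 : `|0 : int| <= n%:Z by [].
  have := in' 0 n0; rewrite (@layer_origin0 R a b M s x) mulg1 p'E dltransM S'E.
  by move=> /ltiling_tiles; rewrite -!dltransM mulgA mulVg mul1g.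
have [x' wx' S'E'] := renormalize_tiling (xoffset_compat y) (yoffset_compat y) wy
  (etrans (congr1 (@tiles R a b) S'E) (tiles_Phi a0 nuE p0 y)) mP.
have Vp' : V p' := cV _ _ (lec _ gd) (lec _ gd').
exists p', x'; split; [exact: Vp'|exact: wx'| |by rewrite p'E].
apply: (@cylinder_layers R a b M s a0 x x' n) => i iN; have := in' i iN; rewrite S'E' -p'E.
by move=> /ltiling_tiles; rewrite -dltransM mulgA mulVg mul1g.
Qed.

End Hull.

(** * Metrizability *)

Section Metrizable.
Context {R : realType} {M : topologicalType} (near : R -> M -> M -> Prop).
Hypothesis near_refl : forall e x, 0 < e -> near e x x.
Hypothesis near_sym : forall e x y, near e x y -> near e y x.
Hypothesis near_le : forall e e' x y, 0 < e -> e <= e' -> near e x y -> near e' x y.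
Hypothesis near_trans : forall e, 0 < e -> exists2 d, 0 < d &
  forall x y z, near d x y -> near d y z -> near e x z.
Hypothesis nbhs_nearP : forall x (U : set M), nbhs x U <->
  exists2 e, 0 < e & forall y, near e x y -> U y.
Hypothesis near_eq : forall x y, (forall e, 0 < e -> near e x y) -> x = y.

Let ent : set_system (M * M) := [set A | exists2 e, 0 < e & forall x y, near e x y -> A (x, y)].

Let ent_filter : Filter ent.
Proof.
split; first by exists 1.
  move=> A B [e e0 eA] [d d0 dB]; exists (Num.min e d); first by rewrite lt_min e0.
  have m0 : 0 < Num.min e d by rewrite lt_min e0.
  move=> x y xy; split.
    by apply/eA/(near_le m0 _ xy); rewrite ge_min lexx.
  by apply/dB/(near_le m0 _ xy); rewrite ge_min lexx orbT.
by move=> A B AB [e e0 eA]; exists e => // x y /eA/AB.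
Qed.

Let ent_diag A : ent A -> diagonal `<=` A.
Proof. by move=> [e e0 eA] [x y] /= xy; apply: eA; rewrite -[y]xy; exact: near_refl. Qed.

Let ent_inv A : ent A -> ent (A^-1)%relation.
Proof. by move=> [e e0 eA]; exists e => // x y /near_sym/eA. Qed.

Let ent_split A : ent A -> exists2 B, ent B & (B \; B `<=` A)%relation.
Proof.
move=> [e e0 eA]; have [d d0 dE] := near_trans e0.
exists [set xy | near d xy.1 xy.2]; first by exists d.
by move=> [x y] [z /= xz zy]; apply: eA; exact: dE zy.
Qed.

Let ent_nbhs : nbhs = nbhs_ ent.
Proof.
apply/funext => x; apply/seteqP; split => U.
  move=> /nbhs_nearP[e e0 eU]; exists [set xy | near e xy.1 xy.2]; first by exists e.
  by move=> y /xsectionP/eU.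
by move=> [A [e e0 eA] AU]; apply/nbhs_nearP; exists e => // y /eA ?; apply/AU/xsectionP.
Qed.

(** The relations near of radius 1/(n+1) generate a uniformity with a countable base, hence given by
    a pseudometric structure. The distance is the infimum of the radii of the balls joining two
    points, and [near_eq] separates points. *)
Lemma metrizable_near : metrizable R M.
Proof.
pose U : uniformType := HB.pack_for uniformType M
  (Nbhs_isUniform_mixin.Build M ent_filter ent_diag ent_inv ent_split ent_nbhs).
have cnt : @countable_uniformity U.
  apply/countable_uniformityP.
  exists (fun n => [set xy | near n.+1%:R^-1 xy.1 xy.2]); last first.
    by move=> n; exists n.+1%:R^-1; rewrite ?invr_gt0.
  move=> A [e e0 eA]; have [n _ ne] := near_infty_natSinv_lt (PosNum e0).
  exists n => -[x y] /= xy; apply: eA; apply: near_le xy; first by rewrite invr_gt0.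
  exact: ltW (ne n (leqnn n)).
pose T : pseudoMetricType R := @countable_uniform.type U cnt.
have T_nbhs (x : T) (V : set T) : nbhs x V <-> @nbhs M M x V by [].
pose radii (x y : T) := [set e : R | 0 < e /\ ball x e y].
have radii_inf x y : has_inf (radii x y).
  (* Every ball of radius 2 is the whole space, so the set of radii is never empty. *)
  split; first by exists 2; split=> //; exact: countable_uniform.countable_uniform_bounded.
  by exists 0 => e [/ltW].
pose d (x y : T) : R := inf (radii x y).
have d_ball x y e : 0 < e -> ball x e y -> d x y <= e.
  by move=> e0 xy; apply: inf_lbound; [exact: (radii_inf x y).2|].
have ball_d x y e : d x y < e -> ball x e y.
  by move=> /(inf_lt (radii_inf x y).1)[f [f0 xy] /ltW fe]; exact: le_ball xy.
have d0 x y : 0 <= d x y.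
  by apply: lb_le_inf; [exact: (radii_inf x y).1|move=> e [/ltW]].
have dxx x : d x x = 0.
  apply/eqP; rewrite eq_le d0 andbT; apply/ler_addgt0Pl => e e0; rewrite addr0.
  by apply: d_ball => //; exact: ballxx.
have dpos x y : d x y = 0 -> x = y.
  move=> xy0; apply: near_eq => e e0.
  have /nbhs_ballP[r /= r0 rE] : nbhs (x : T) [set z | near e x z].
    by apply/T_nbhs/nbhs_nearP; exists e.
  by apply: rE; apply: ball_d; rewrite xy0.
have dsym x y : d x y = d y x.
  by congr inf; apply/seteqP; split=> e [e0 /ball_sym xy].
have dtri y x z : d x z <= d x y + d y z.
  apply/ler_addgt0Pl => e e0.
  have e2 : 0 < e / 2 by rewrite divr_gt0.
  have h1 : ball x (d x y + e / 2) y by apply: ball_d; rewrite ltrDl.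
  have h2 : ball y (d y z + e / 2) z by apply: ball_d; rewrite ltrDl.
  have := ball_triangle h1 h2; rewrite addrACA -splitr addrC => h.
  by apply: d_ball h; rewrite ltr_pwDl// addr_ge0.
pose X : metricType R := HB.pack_for (metricType R) (M : Type) (Choice.class M)
  (@isMetric.Build R M d dxx dpos dsym dtri).
exists X, id, id; split=> //.
- move=> x V /nbhs_ballP[e /= e0 eV].
  have : nbhs (x : T) (ball (x : T) (e / 2)) by apply: nbhsx_ballx; rewrite divr_gt0.
  move/T_nbhs; apply: filterS => y xy; apply: eV.
  rewrite ballEmdist /=; apply: le_lt_trans (d_ball _ _ _ _ xy) _; first by rewrite divr_gt0.
  by rewrite ltr_pdivrMr// mulr_natr mulr2n ltrDl.
- move=> x V xV; have xV' : nbhs (x : T) V by apply/T_nbhs.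
  have [e /= e0 eV] := (nbhs_ballP _ _).1 xV'.
  apply/(@nbhs_ballP _ X x); exists e => // y; rewrite ballEmdist /= => xy.
  by apply: eV; exact: ball_d.
Qed.

End Metrizable.

(** * Flow boxes *)

Section Smooth.
Context {R : realType} {a b : R}.
Local Notation Sol := (Sol a b).

Definition exp_affine (l c k d : R) (pr : space3 R -> R) (x : space3 R) : R :=
  l * pr x + c * expR (k * x.2) + d.

(** Along the line through x of direction v the function has one real variable, and its derivative
    at 0 is computed there. *)
Lemma exp_affine_derive l c k d (pr : space3 R -> R) (x v : space3 R) :
  (forall h : R, pr (h *: v + x) = h * pr v + pr x) ->
  (h^-1 *: (exp_affine l c k d pr (h *: v + x) - exp_affine l c k d pr x)) @[h --> (0 : R)^'] -->
  exp_affine 0 (c * (k * v.2)) k (l * pr v) pr x.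
Proof.
move=> prl.
pose phi (h : R) := l * (h * pr v + pr x) + c * expR (k * (h * v.2 + x.2)) + d.
have dphi : is_derive (0 : R) 1 phi (exp_affine 0 (c * (k * v.2)) k (l * pr v) pr x).
  rewrite /phi; apply: is_derive_eq.
  rewrite /GRing.scale/= /exp_affine !(mul0r, mulr0, mulr1, mul1r, addr0, add0r).
  by ring.
have := @ex_derive _ _ _ _ _ _ _ dphi; have := @derive_val _ _ _ _ _ _ _ dphi.
rewrite /derive /derivable => <-; apply: cvg_trans; apply: near_eq_cvg; near=> h.
have -> : exp_affine l c k d pr (h *: v + x) = phi h by rewrite /exp_affine prl.
have -> : exp_affine l c k d pr x = phi 0 by rewrite /phi !mul0r !add0r.
by rewrite /= addr0 /GRing.scale/= mulr1.
Unshelve. all: by end_near. Qed.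

(* A family of maps stable under directional derivatives and containing the right translations. *)
Definition exp_affine3 (l c d : R * R * R) (x : space3 R) : space3 R :=
  (exp_affine l.1.1 c.1.1 a d.1.1 (fun x => x.1.1) x,
   exp_affine l.1.2 c.1.2 (- b) d.1.2 (fun x => x.1.2) x,
   exp_affine l.2 c.2 0 d.2 snd x).

Lemma exp_affine3_derive l c d (x v : space3 R) : exists l' c' d', forall x,
  is_derive x v (exp_affine3 l c d) (exp_affine3 l' c' d' x).
Proof.
exists 0, (c.1.1 * (a * v.2), c.1.2 * (- b * v.2), c.2 * (0 * v.2)),
  (l.1.1 * v.1.1, l.1.2 * v.1.2, l.2 * v.2) => {}x.
set df := exp_affine3 _ _ _ x.
suff H : (h^-1 *: ((exp_affine3 l c d \o shift x) (h *: v) - exp_affine3 l c d x)) @[h --> (0 : R)^'] --> df.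
  by apply: DeriveDef; [apply/cvg_ex; exists df|exact: cvg_lim].
have h1 := @exp_affine_derive l.1.1 c.1.1 a d.1.1 (fun x => x.1.1) x v (fun=> erefl).
have h2 := @exp_affine_derive l.1.2 c.1.2 (- b) d.1.2 (fun x => x.1.2) x v (fun=> erefl).
have h3 := @exp_affine_derive l.2 c.2 0 d.2 snd x v (fun=> erefl).
exact: (cvg_pair (cvg_pair h1 h2) h3).
Qed.

Lemma exp_affine3_continuous l c d : continuous (exp_affine3 l c d).
Proof.
have H l' c' k d' (pr : space3 R -> R) : continuous pr -> continuous (exp_affine l' c' k d' pr).
  move=> cp x; apply: cvgD; last exact: cvg_cst.
  apply: cvgD; first by apply: cvgM; [exact: cvg_cst|exact: cp].
  apply: cvgM; first exact: cvg_cst.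
  apply: continuous_cvg; first exact: continuous_expR.
  by apply: cvgM; [exact: cvg_cst|exact: cvg_snd].
move=> x.
have h1 : continuous (fun x : space3 R => x.1.1).
  by move=> y; apply: (@cvg_comp _ _ _ fst fst); exact: cvg_fst.
have h2 : continuous (fun x : space3 R => x.1.2).
  by move=> y; apply: (@cvg_comp _ _ _ fst snd); [exact: cvg_fst|exact: cvg_snd].
have h3 : continuous (fun x : space3 R => x.2) by move=> y; exact: cvg_snd.
exact: (cvg_pair (cvg_pair (H _ _ _ _ _ h1 x) (H _ _ _ _ _ h2 x)) (H _ _ _ _ _ h3 x)).
Qed.

(** Since U is open, a directional derivative at a point of U depends only on the values on U, where
    every iterated derivative has a closed form in the family [exp_affine3]. *)
Lemma smooth_on_translation (U : set (space3 R)) (f : space3 R -> space3 R) (d : Sol) :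
  open U -> (forall x, U x -> f x = ((x : Sol) * d)%g) -> smooth_on U f.
Proof.
move=> oU fE.
have near_U (g1 g2 : space3 R -> space3 R) x : U x -> (forall y, U y -> g1 y = g2 y) ->
    \near x, g1 x = g2 x.
  by move=> Ux g12; apply: filterS g12 _; exact: open_nbhs_nbhs.
have H vs : exists l c d', forall x, U x -> iter_derive vs f x = exp_affine3 l c d' x.
  elim: vs => [|v vs [l [c [d' IH]]]].
    exists (1, 1, 1), (d.1.1, d.1.2, 0), (0, 0, d.2) => x /fE /= ->.
    rewrite sol_mulE /exp_affine3 /exp_affine /= !mul1r !addr0 !mul0r addr0.
    by congr (_, _, _); ring.
  have [l' [c' [d'' dE]]] := exp_affine3_derive l c d' 0 v.
  exists l', c', d'' => x Ux /=.
  rewrite (near_eq_derive _ (near_U _ _ _ Ux IH)).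
  exact: (@derive_val _ _ _ _ _ _ _ (dE x)).
move=> vs x Ux; have [l [c [d' E]]] := H vs; split.
  move=> V; rewrite /= E// => /exp_affine3_continuous; apply: filterS2 (near_U _ _ _ Ux E).
  by move=> y /= ->.
move=> v; have [l' [c' [d'' dE]]] := exp_affine3_derive l c d' 0 v.
apply: near_eq_derivable (@ex_derive _ _ _ _ _ _ _ (dE x)).
by apply: near_U => // y /E ->.
Qed.

End Smooth.

Section SpaceBall.
Context {R : realType}.
Implicit Types (c x : space3 R) (r : R).

Lemma space_ball_coord c r x : 0 < r -> space_ball c r x ->
  [/\ `|x.1.1 - c.1.1| < r, `|x.1.2 - c.1.2| < r & `|x.2 - c.2| < r].
Proof.
move=> r0; rewrite /space_ball /= => H.
have sq (t : R) : t ^+ 2 < r ^+ 2 -> `|t| < r.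
  by rewrite -(real_normK (num_real t)) ltr_sqr ?nnegrE// ltW.
have := sqr_ge0 (x.1.1 - c.1.1); have := sqr_ge0 (x.1.2 - c.1.2); have := sqr_ge0 (x.2 - c.2).
by split; apply: sq; lra.
Qed.

Lemma space_ball_center c r : 0 < r -> space_ball c r c.
Proof. by move=> r0; rewrite /space_ball /= !subrr expr0n /= !addr0 exprn_gt0. Qed.

Lemma space_ball_open c r : open (space_ball c r).
Proof.
have h1 : continuous (fun x : space3 R => x.1.1).
  by move=> y; apply: (@cvg_comp _ _ _ fst fst); exact: cvg_fst.
have h2 : continuous (fun x : space3 R => x.1.2).
  by move=> y; apply: (@cvg_comp _ _ _ fst snd); [exact: cvg_fst|exact: cvg_snd].
have h3 : continuous (fun x : space3 R => x.2) by move=> y; exact: cvg_snd.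
have sq (f : space3 R -> R) d : continuous f -> continuous (fun x => (f x - d) ^+ 2).
  move=> cf x; have : (f y - d) @[y --> x] --> f x - d by apply: cvgB; [exact: cf|exact: cvg_cst].
  by move=> H; exact: (cvgM H H).
pose F (x : space3 R) := (x.1.1 - c.1.1) ^+ 2 + (x.1.2 - c.1.2) ^+ 2 + (x.2 - c.2) ^+ 2.
have cF : continuous F.
  move=> x; apply: cvgD; last exact: (sq _ c.2 h3 x).
  by apply: cvgD; [exact: (sq _ c.1.1 h1 x)|exact: (sq _ c.1.2 h2 x)].
by rewrite openE => x xc; exact: (cvgr_lt _ (cF x)).
Qed.

End SpaceBall.

(** * A common radius for the charts *)

Section SmallCharts.
Context {R : realType} {a b : R}.
Local Notation Sol := (Sol a b).

(** The second factor splits into a difference of displacements, at most 4 r, and an error from the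
    height, at most 2 eps B. The constants 16 and 8 make each contribution at most 1/4. *)
Let coordinate_bound (E B eps r c z x1 x2 y1 y2 zeta : R) : 0 < r -> 1 <= B -> 0 < E ->
  expR z <= E -> `|1 - expR (c * zeta)| <= eps -> 8 * E * eps * B <= 1 -> 16 * E * r <= 1 ->
  `|x1 - x2| < 2 * r -> `|y1 - y2| < 2 * r -> `|x2 - y2| <= 2 * B ->
  `|expR z * (x1 - y1 - expR (c * zeta) * (x2 - y2))| < 1.
Proof.
move=> r0 B1 E0 zE ze eB Er x12 y12 xy.
rewrite (_ : x1 - y1 - expR (c * zeta) * (x2 - y2) =
  (x1 - x2) - (y1 - y2) + (1 - expR (c * zeta)) * (x2 - y2)); last by ring.
set Q := _ + _; have Qb : `|Q| <= 4 * r + eps * (2 * B).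
  apply: (le_trans (ler_normD _ _)); apply: lerD; last by rewrite normrM ler_pM.
  by apply: (le_trans (ler_normB _ _)); lra.
rewrite normrM (ger0_norm (expR_ge0 _)).
apply: (@le_lt_trans _ _ (E * (4 * r + eps * (2 * B)))).
  by rewrite ler_pM// expR_ge0.
have -> : E * (4 * r + eps * (2 * B)) = 16 * E * r / 4 + 8 * E * eps * B / 4 by field.
lra.
Qed.

Let dist_lt2 (r x y z : R) : `|x - z| < r -> `|y - z| < r -> `|x - y| < 2 * r.
Proof.
move=> xz yz; rewrite (_ : x - y = (x - z) - (y - z)); last by ring.
by apply: (le_lt_trans (ler_normB _ _)); lra.
Qed.

Let norm_le_near (D r x z : R) : r <= 1 -> `|x - z| < r -> 0 <= z <= D -> `|x| <= D + 1.
Proof.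
move=> r1; rewrite ltr_norml ler_norml => /andP[x1 x2] /andP[z1 z2].
by apply/andP; split; lra.
Qed.

(* If p T = p' T' and p2 T = p2' T2', then g is the group element carrying T2' to T'. *)
Lemma small_radius (D l : R) : 0 <= D -> 0 < l -> exists2 r : R, 0 < r & forall (c c' p p2 p' p2' g : Sol),
  [/\ 0 <= c.1.1 <= D, 0 <= c.1.2 <= D & 0 <= c.2 <= D] ->
  [/\ 0 <= c'.1.1 <= D, 0 <= c'.1.2 <= D & 0 <= c'.2 <= D] ->
  space_ball c r p -> space_ball c r p2 -> space_ball c' r p' -> space_ball c' r p2' ->
  g = (p'^-1 * (p * p2^-1) * p2')%g ->
  [/\ `|g.1.1| < 1, `|g.1.2| < 1 & `|g.2| < l].
Proof.
move=> D0 l0; pose K := `|a| + `|b|; pose E := expR (K * (D + 1)); pose B := D + 1.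
have E0 : 0 < E by exact: expR_gt0.
have B1 : 1 <= B by rewrite lerDr.
pose eps := (8 * E * B)^-1.
have eps0 : 0 < eps by rewrite invr_gt0 !mulr_gt0//; exact: lt_le_trans B1.
have ce (c : R) : \forall t \near (0 : R), `|1 - expR (c * t)| < eps.
  have : expR (c * t) @[t --> (0 : R)] --> expR (c * 0).
    apply: continuous_cvg; first exact: continuous_expR.
    by apply: cvgM; [exact: cvg_cst|exact: cvg_id].
  by rewrite mulr0 expR0 => /cvgrPdist_lt /(_ _ eps0).
have /nbhs_ballP[rho /= rho0 rhoE] : \forall t \near (0 : R),
    `|1 - expR (a * t)| < eps /\ `|1 - expR (- b * t)| < eps.
  by apply: filterI; exact: ce.
(* The four bounds: 1 keeps the points within D + 1 of 0 in each coordinate; rho / 2 makes the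
   difference of two heights less than rho; l / 4 controls the height of g, a difference of two such
   differences; the last one is the condition on r in [coordinate_bound]. *)
pose r := Num.min (Num.min 1 (rho / 2)) (Num.min (l / 4) (16 * E)^-1).
have r0 : 0 < r by rewrite !lt_min ltr01 !divr_gt0// invr_gt0 mulr_gt0.
have r1 : r <= 1 by rewrite /r !ge_min lexx.
have rrho : r <= rho / 2 by rewrite /r !ge_min lexx !orbT.
have rl : r <= l / 4 by rewrite /r !ge_min lexx !orbT.
have rE : 16 * E * r <= 1.
  rewrite mulrC -ler_pdivlMr ?mulr_gt0// mul1r.
  by rewrite /r !ge_min lexx !orbT.
have eB : 8 * E * eps * B <= 1.
  by rewrite mulrAC /eps divff// gt_eqF// !mulr_gt0//; exact: lt_le_trans B1.
exists r => // c c' p p2 p' p2' g [cx cy cz] [cx' cy' cz'].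
move=> /(space_ball_coord r0)[px py pz] /(space_ball_coord r0)[p2x p2y p2z].
move=> /(space_ball_coord r0)[px' py' pz'] /(space_ball_coord r0)[p2x' p2y' p2z'].
have far (x y z z' : R) : `|x - z| < r -> `|y - z'| < r -> 0 <= z <= D -> 0 <= z' <= D ->
    `|x - y| <= 2 * B.
  move=> xz yz zD zD'; apply: (le_trans (ler_normB _ _)); rewrite mulr_natl mulr2n.
  by apply: lerD; apply: norm_le_near r1 _ _; eassumption.
have zeta : ball (0 : R) rho (p.2 - p2.2).
  rewrite /ball/= sub0r normrN; apply: lt_le_trans (dist_lt2 pz p2z) _.
  by rewrite mulrC -ler_pdivlMr.
have [/ltW ea /ltW eb] := rhoE _ zeta.
have eE (d : R) : `|d| <= K -> expR (d * p'.2) <= E.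
  move=> dK; rewrite ler_expR (le_trans (ler_norm _))// normrM ler_pM//.
  exact: norm_le_near r1 pz' cz'.
have ex : expR (- a * p'.2) <= E by apply: eE; rewrite normrN lerDl.
have ey : expR (b * p'.2) <= E by apply: eE; rewrite lerDr.
move=> gE.
have gx : g.1.1 = expR (- a * p'.2) * (p.1.1 - p'.1.1 - expR (a * (p.2 - p2.2)) * (p2.1.1 - p2'.1.1)).
  rewrite gE -mulgA -mulgA sol_divE sol_mulE sol_divE /=; congr (_ * _).
  have -> : expR (a * (p.2 - p2.2)) = expR (a * p.2) * expR (- a * p2.2).
    by rewrite -expRD; congr expR; ring.
  ring.
have gy : g.1.2 = expR (b * p'.2) * (p.1.2 - p'.1.2 - expR (- b * (p.2 - p2.2)) * (p2.1.2 - p2'.1.2)).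
  rewrite gE -mulgA -mulgA sol_divE sol_mulE sol_divE /=; congr (_ * _).
  have -> : expR (- b * (p.2 - p2.2)) = expR (- b * p.2) * expR (b * p2.2).
    by rewrite -expRD; congr expR; ring.
  ring.
have gz : g.2 = (p.2 - p2.2) - (p'.2 - p2'.2).
  by rewrite gE -mulgA -mulgA sol_divE sol_mulE sol_divE /=; ring.
split.
- rewrite gx; apply: (@coordinate_bound E B eps r) => //.
  + exact: dist_lt2 px p2x.
  + exact: dist_lt2 px' p2x'.
  + exact: far p2x p2x' cx cx'.
- rewrite gy; apply: (@coordinate_bound E B eps r) => //.
  + exact: dist_lt2 py p2y.
  + exact: dist_lt2 py' p2y'.
  + exact: far p2y p2y' cy cy'.
- rewrite gz; apply: (le_lt_trans (ler_normB _ _)).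
  apply: (lt_le_trans (ltrD (dist_lt2 pz p2z) (dist_lt2 pz' p2z'))).
  by move: rl; clear; lra.
Qed.

End SmallCharts.

(** * From an open chart to an atlas of flow boxes *)

Section Lamination.
Context {R : realType} {a b : R} {H : topologicalType}.
Local Notation Sol := (Sol a b).
Variables (Psi : space3 R * cantor_space -> H) (D l : R) (orb : H -> set H).
Hypothesis D0 : 0 <= D.
Hypothesis l0 : 0 < l.

Let dom : set Sol := [set c | [/\ 0 <= c.1.1 <= D, 0 <= c.1.2 <= D & 0 <= c.2 <= D]].

Hypothesis Psi_cont : continuous Psi.
Hypothesis Psi_open : forall p t (W : set (space3 R * cantor_space)), nbhs (p, t) W ->
  nbhs (Psi (p, t)) (Psi @` W).
Hypothesis Psi_surj : forall q, exists2 c, dom c & exists t, Psi (c, t) = q.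
Hypothesis Psi_inj : forall (p p' : Sol) t t', Psi (p, t) = Psi (p', t') ->
  `|(p^-1 * p')%g.1.1| < 1 -> `|(p^-1 * p')%g.1.2| < 1 -> `|(p^-1 * p')%g.2| < l ->
  p = p' /\ t = t'.
Hypothesis Psi_mul : forall (g p p' : Sol) t t', Psi (p, t) = Psi (p', t') ->
  Psi ((g * p)%g, t) = Psi ((g * p')%g, t').
Hypothesis orbP : forall p t q, orb (Psi (p, t)) q <-> exists g : Sol, q = Psi ((g * p)%g, t).

Let rE := cid2 (@small_radius R a b D l D0 l0).
Let r := projT1 rE.
Let r0 : 0 < r. Proof. by rewrite /r; case: rE. Qed.
Let small (c c' p p2 p' p2' g : Sol) : dom c -> dom c' ->
  space_ball c r p -> space_ball c r p2 -> space_ball c' r p' -> space_ball c' r p2' ->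
  g = (p'^-1 * (p * p2^-1) * p2')%g ->
  [/\ `|g.1.1| < 1, `|g.1.2| < 1 & `|g.2| < l].
Proof. by rewrite /r; case: rE => r' r'0 H'; exact: H'. Qed.

Let Psi_inj_ball (c p p' : Sol) t t' : dom c -> space_ball c r p -> space_ball c r p' ->
  Psi (p, t) = Psi (p', t') -> p = p' /\ t = t'.
Proof.
move=> dc cp cp' /Psi_inj; have := small dc dc cp cp cp cp' erefl.
by rewrite mulgV mulg1 => -[gx gy gz]; apply.
Qed.

(** Left multiplication of the first equality by p2 p^-1 gives Psi (p2, t) a second expression with
    transversal coordinate t', which local injectivity identifies with (p2', t2'). So the
    transversal coordinate is constant along the plaque, and the change of coordinates is the right
    translation by p^-1 p'. *)
Let Psi_change (c c' p p2 p' p2' : Sol) t t' t2' : dom c -> dom c' ->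
  space_ball c r p -> space_ball c r p2 -> space_ball c' r p' -> space_ball c' r p2' ->
  Psi (p, t) = Psi (p', t') -> Psi (p2, t) = Psi (p2', t2') ->
  t' = t2' /\ p2' = (p2 * (p^-1 * p'))%g.
Proof.
move=> dc dc' cp cp2 cp' cp2' E E2.
have := Psi_mul (p2 * p^-1)%g E; rewrite -mulgA mulVg mulg1 E2 => /esym/Psi_inj.
have := small dc dc' cp cp2 cp' cp2' erefl.
rewrite (_ : (p2 * p^-1 * p')^-1 * p2' = p'^-1 * (p * p2^-1) * p2')%g; last first.
  by rewrite !invgM invgK !mulgA.
by move=> [gx gy gz] /(_ gx gy gz) [<- ->]; rewrite !mulgA.
Qed.

Let dom_open (c : Sol) : open (Psi @` (space_ball c r `*` setT)).
Proof.
rewrite openE => _ [[p t] [/= cp _] <-]; apply: Psi_open.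
exists (space_ball c r, setT) => //=; split; last exact: filterT.
by apply: open_nbhs_nbhs; split=> //; exact: space_ball_open.
Qed.

Let atlas : set (flow_box R H) := [set B | [/\ dom (fb_center B), fb_radius B = r,
  fb_trans B = setT, fb_inv B = Psi & fb_dom B = Psi @` (space_ball (fb_center B) r `*` setT)]].

(** The coordinate map is a chosen inverse of [Psi] on the ball; its continuity is the openness of
    [Psi]. *)
Let box_exists (c : Sol) : dom c -> exists2 B, atlas B & fb_center B = c.
Proof.
move=> dc; pose P := space_ball c r `*` [set: cantor_space].
pose f q : space3 R * cantor_space := xget (c : space3 R, point : cantor_space) [set pt | P pt /\ Psi pt = q].
have fP q : (Psi @` P) q -> P (f q) /\ Psi (f q) = q.
  move=> [pt Ppt ptq]; have := @xgetPex _ (c : space3 R, point : cantor_space) [set pt | P pt /\ Psi pt = q].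
  by apply; exists pt.
have fK pt : P pt -> f (Psi pt) = pt.
  move=> Ppt; have [Pf E] := fP (Psi pt) (imageP Psi Ppt).
  move: Pf E; case: (f _) => p t; case: pt Ppt => p' t' [/= cp' _] [/= cp _] E.
  by have [-> ->] := Psi_inj_ball dc cp cp' E.
have fcont : {within Psi @` P, continuous f}.
  rewrite continuous_open_subspace; last exact: dom_open.
  move=> q /set_mem qP; have [Pf E] := fP q qP.
  move=> W fW; have : nbhs (f q) (W `&` P).
    apply: filterI => //; apply: open_nbhs_nbhs; split=> //.
    rewrite openE => -[p t] [/= cp _]; exists (space_ball c r, setT) => //=.
    split; last exact: filterT.
    by apply: open_nbhs_nbhs; split=> //; exact: space_ball_open.
  rewrite [f q]surjective_pairing => /Psi_open; rewrite -surjective_pairing E.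
  by apply: filterS => _ [pt [Wpt Ppt] <-]; rewrite /= fK.
have inv_fun : set_fun P (Psi @` P) Psi by move=> pt Ppt; exists pt.
have map_fun : set_fun (Psi @` P) P f by move=> q /fP[].
have mapK : {in Psi @` P, cancel f Psi} by move=> q /set_mem/fP[].
have invK : {in P, cancel Psi f} by move=> pt /set_mem; exact: fK.
exists (@FlowBox R H _ c r setT f Psi (dom_open c) r0 openT map_fun inv_fun mapK invK fcont
  (continuous_subspaceT Psi_cont)) => //.
Qed.

Let atlas_map B q : atlas B -> fb_dom B q ->
  space_ball (fb_center B) r (fb_map B q).1 /\ Psi (fb_map B q) = q.
Proof.
move=> [dc rB tB iB dB] qB; have := fb_map_fun qB; rewrite rB => -[/= ? _]; split=> //.
by rewrite -iB fb_mapK// inE.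
Qed.

Let atlas_compatible B B' : atlas B -> atlas B' -> compatible B B'.
Proof.
move=> AB AB'; have [dc rB tB iB dB] := AB; have [dc' rB' tB' iB' dB'] := AB'.
split.
  move=> q q2 /set_mem[qB qB'] /set_mem[q2B q2B'] tt.
  have [cp E] := atlas_map AB qB; have [cp2 E2] := atlas_map AB q2B.
  have [cp' E'] := atlas_map AB' qB'; have [cp2' E2'] := atlas_map AB' q2B'.
  move: tt cp E cp2 E2 cp' E' cp2' E2'.
  case: (fb_map B q) (fb_map B q2) (fb_map B' q) (fb_map B' q2) =>
    [p t] [p2 t2] [p' t'] [p2' t2'] /= <- cp E cp2 E2 cp' E' cp2' E2'.
  by have [] := Psi_change dc dc' cp cp2 cp' cp2' (etrans E (esym E')) (etrans E2 (esym E2')).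
move=> t _; set U := [set x | _].
have [->|/set0P[x0 [cx0 Bx0]]] := eqVneq U set0; first by move=> ? ? [].
have oU : open U.
  rewrite openE => x [cx Bx].
  have h1 : nbhs x (space_ball (fb_center B) (fb_radius B)).
    by apply: open_nbhs_nbhs; split=> //; exact: space_ball_open.
  have h2 : nbhs (Psi (x, t)) (fb_dom B').
    by apply: open_nbhs_nbhs; split; [exact: fb_dom_open|rewrite -iB].
  have h3 : nbhs x [set y | fb_dom B' (Psi (y, t))].
    have c3 : Psi (y, t) @[y --> x] --> Psi (x, t).
      apply: (@cvg_comp _ _ _ (fun y => (y, t)) Psi _ (nbhs (x, t))); last exact: Psi_cont.
      exact: (cvg_pair (@cvg_id _ _) (cvg_cst _)).
    exact: c3 h2.
  by apply: filterS (filterI h1 h3) => y [? ?]; split=> //; rewrite iB.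
rewrite iB rB in cx0 Bx0.
have [cp0 E0] := atlas_map AB' Bx0.
apply: (@smooth_on_translation R a b U _ ((x0 : Sol)^-1 * (fb_map B' (Psi (x0, t))).1)%g) => // x [cx Bx].
rewrite iB in Bx *; rewrite rB in cx.
have [cp E] := atlas_map AB' Bx.
move: cp0 E0 cp E; case: (fb_map B' (Psi (x0, t))) (fb_map B' (Psi (x, t))) => [p0 t0] [p' t'] /= cp0 E0 cp E.
by have [_] := Psi_change dc dc' cx0 cx cp0 cp (esym E0) (esym E).
Qed.

Let orb_trans q q1 q2 : orb q q1 -> orb q1 q2 -> orb q q2.
Proof.
have [c dc [t <-]] := Psi_surj q; move=> /orbP[g ->] /orbP[h ->].
by apply/orbP; exists (h * g)%g; rewrite mulgA.
Qed.

Let orb_refl q : orb q q.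
Proof.
by have [c dc [t <-]] := Psi_surj q; apply/orbP; exists 1%g; rewrite mul1g.
Qed.

Lemma lamination_of_chart : transversely_Cantor_lamination R orb.
Proof.
have orb_leaf q0 q : leaf atlas q0 q -> orb q0 q.
  elim=> [|B t q1 q2 _ IH [dc rB tB iB dB] _ [x _ xq1] [x' _ xq2]]; first exact: orb_refl.
  apply: orb_trans IH _; rewrite -xq1 -xq2 iB; apply/orbP.
  by exists ((x' : Sol) * (x : Sol)^-1)%g; rewrite -mulgA mulVg mulg1.
(* A point and its image under a small group element lie in one plaque, namely in a flow box centred
   at a representative of the point in [dom]. *)
have leaf_near q0 (p : Sol) t : \forall h \near (1%g : Sol),
    leaf atlas q0 (Psi ((h * p)%g, t)) <-> leaf atlas q0 (Psi (p, t)).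
  have [c dc [t' E]] := Psi_surj (Psi (p, t)).
  have [B AB cB] := box_exists dc; have [dB rB tB iB _] := AB.
  have : (h * c : Sol)%g @[h --> (1%g : Sol)] --> (1 * c : Sol)%g.
    by apply: cvg_solM; [exact: cvg_id|exact: cvg_cst].
  rewrite mul1g => hc; have : nbhs c (space_ball c r).
    by apply: open_nbhs_nbhs; split; [exact: space_ball_open|exact: space_ball_center].
  move=> cn; have : \forall h \near (1%g : Sol), space_ball c r (h * c)%g by exact: hc cn.
  apply: filterS => h cph; rewrite -E -(Psi_mul h E).
  have plq x : space_ball c r x -> plaque B t' (Psi (x, t')).
    by move=> cx; exists x; rewrite ?iB// cB rB.
  have tB' : fb_trans B t' by rewrite tB.
  by split=> L; apply: leaf_plaque L AB tB' _ _; apply: plq => //; exact: space_ball_center.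
exists atlas; split.
- apply/seteqP; split=> // q _; have [c dc [t <-]] := Psi_surj q.
  have [B AB cB] := box_exists dc; exists B => //; have [_ _ _ _ ->] := AB.
  by exists (c, t) => //; split=> //=; rewrite cB; exact: space_ball_center.
- move=> B t [dB rB tB iB _] _; exists (Psi (fb_center B, t)) => _ [x _ <-].
  rewrite iB; apply/orbP; exists ((x : Sol) * (fb_center B : Sol)^-1)%g.
  by rewrite -mulgA mulVg mulg1.
- exact: atlas_compatible.
- move=> q; apply/seteqP; split=> q'; first exact: orb_leaf.
  have [c dc [t <-]] := Psi_surj q; move=> /orbP[g ->].
  (* Any path from the identity to g would serve: the parameters at which it stays in the leaf form
     an open and closed set containing 0, and the real line is connected. *)
  pose line (s : R) : Sol := (s * g.1.1, s * g.1.2, s * g.2).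
  have cline : continuous line.
    move=> s; have H' (x : R) : s0 * x @[s0 --> s] --> s * x.
      by apply: cvgM; [exact: cvg_id|exact: cvg_cst].
    by apply: cvg_sol => /=.
  pose L := [set s | leaf atlas (Psi (c, t)) (Psi ((line s * c)%g, t))].
  have Lnear s : \forall s' \near s, L s' <-> L s.
    have : (line s' * (line s)^-1 : Sol)%g @[s' --> s] --> (line s * (line s)^-1 : Sol)%g.
      by apply: cvg_solM; [exact: cline|exact: cvg_cst].
    rewrite mulgV => H'; have : \forall s' \near s,
        leaf atlas (Psi (c, t)) (Psi ((line s' * (line s)^-1 * (line s * c))%g, t)) <->
        leaf atlas (Psi (c, t)) (Psi ((line s * c)%g, t)).
      exact: H' (leaf_near (Psi (c, t)) (line s * c)%g t).
    by apply: filterS => s'; rewrite !mulgA -(mulgA (line s')) mulVg mulg1.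
  have oL : open L by rewrite openE => s Ls; apply: filterS (Lnear s) => s' [_]; exact.
  have cL : closed L.
    rewrite -openC openE => s nLs; apply: filterS (Lnear s) => s' [H1 _] /H1; exact: nLs.
  have := (connected_intervalP [set: R]).2 (fun _ _ _ _ _ _ => I).
  move=> /(_ L) E.
  have LT : L = setT.
    apply: E; [|by exists L; rewrite ?setTI|by exists L; rewrite ?setTI].
    by exists 0; rewrite /L /= /line !mul0r mul1g; exact: leaf_refl.
  have : L 1 by rewrite LT.
  by rewrite /L /= /line !mul1r; case: (g) => [[]].
Qed.

End Lamination.

(** * The dynamics of the hull *)

Section HullSpace.
Context {R : realType} {a b : R} {w : int -> bool}.
Hypothesis a0 : 0 < a.
Local Notation H := (hull a b w).

Lemma nbhs_hullP (q : H) (U : set H) : nbhs q U <->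
  exists2 eps : R, 0 < eps & forall q' : H, close eps (set_val q) (set_val q') -> U q'.
Proof.
split.
  move=> [W [[W' oW' <-] /= W'q] W'U].
  have /(nbhs_closeP a0)[e e0 eW] : nbhs (set_val q) W' by exact: (open_nbhs_nbhs (conj oW' W'q)).
  by exists e => // q' /eW ?; exact: W'U.
move=> [e e0 eU]; have qe : nbhs (set_val q) [set S | close e (set_val q) S].
  by apply/(nbhs_closeP a0); exists e.
have vc : {for q, continuous (set_val : H -> tiling a b)} by exact: initial_continuous.
have : \forall q' \near q, close e (set_val q) (set_val q') by exact: vc qe.
by apply: filterS => q'; exact: eU.
Qed.

Lemma hull_metrizable : metrizable R H.
Proof.
apply: (@metrizable_near R H (fun e q q' => close e (set_val q) (set_val q'))).
- by move=> e q e0; exact: close_refl.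
- by move=> e q q'; exact: close_sym.
- by move=> e e' q q'; exact: close_le.
- move=> e e0; have [d d0 dE] := @close_trans R a b a0 _ e0.
  by exists d => // q q' q''; exact: dE.
- exact: nbhs_hullP.
- by move=> q q' qq'; apply: val_inj; apply: (close_eq a0).
Qed.

End HullSpace.

Section HullChart.
Context {R : realType} {a b : R} {M : nat} {s : bool} {w : int -> bool}.
Hypothesis a0 : 0 < a.
Hypothesis M0 : (0 < M)%N.
Local Notation N := M.+1.
Local Notation lam := (ln 2 / a).
Hypothesis nuE : expR (- b * lam) = ratio N s.
Hypothesis wrec : recurrent w.
Hypothesis wap : aperiodic w.
Local Notation Sol := (Sol a b).
Local Notation H := (hull a b w).
Local Notation Phi := (Phi a0 nuE).
Local Notation code_set := (@code_set M w).

Lemma code_set_nonempty : code_set !=set0.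
Proof.
have [x [xw _ _]] := @code_build M w (fun=> 0%N) (fun=> 0%N) (fun=> isT) (fun=> isT).
exists x; rewrite /code_set /= (_ : color x = w); first exact: subshift_refl.
exact/funext.
Qed.

Lemma code_set_perfect (x : code M) n : code_set x ->
  exists y, [/\ code_set y, cylinder x n y & y <> x].
Proof.
move=> wx; pose y : code M := fun k =>
  if k == n then ((x k).1.1, ~~ (x k).1.2, (x k).2) else x k.
exists y; split.
- rewrite /code_set /= (_ : color y = color x)//; apply/funext => -[k|k] /=.
    by rewrite /y; case: ifP.
  by rewrite /y; case: ifP.
- by move=> k kn; rewrite /y ltn_eqF.
- move=> /(congr1 (fun z : code M => (z n).1.2)); rewrite /y eqxx /=.
  by case: ((x n).1.2).
Qed.

Lemma hull_free (S : tiling a b) g : hull a b w S -> ract S g = S -> g = 1%g.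
Proof.
rewrite (hullE a0 nuE wrec) => -[k [x [_ wx ->]]] /(Phi_free M0 wrec wap wx).
by move=> /(congr1 (fun h : Sol => h^-1)%g); rewrite invgK invg1.
Qed.

Lemma hull_invariant (S : tiling a b) g : hull a b w S -> hull a b w (ract S g).
Proof.
rewrite {1}(hullE a0 nuE wrec) => -[k [x [_ wx ->]]].
by rewrite /ract PhiM; exact: (hull_Phi wrec wx).
Qed.

Lemma hull_minimal (q : H) : dense (hull_orbit q).
Proof.
move=> U [q' Uq'] oU.
have /(nbhs_hullP a0)[e e0 eU] : nbhs q' U by apply: open_nbhs_nbhs.
have [p [x [_ wx q'E]]] : Phi_image a0 nuE (w := w) (set_val q').
  by rewrite -(hullE a0 nuE wrec); exact: set_valP.
have [p0 [x0 [_ wx0 qE]]] : Phi_image a0 nuE (w := w) (set_val q).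
  by rewrite -(hullE a0 nuE wrec); exact: set_valP.
have [g] := approx_orbit a0 nuE wrec p e0 wx (@xoffset_compat R M x0) (@yoffset_compat R M s x0) wx0
  (tiles_Phi a0 nuE p0 x0).
rewrite -q'E -qE => gc.
have hg : hull a b w (ract (set_val q) g^-1%g) by apply: hull_invariant; exact: set_valP.
pose q1 : H := exist _ (ract (set_val q) g^-1%g) (mem_set hg).
exists q1; split; last by exists g^-1%g.
have q1E : set_val q1 = ltiling g (set_val q) by rewrite -[LHS]/(ract _ _) /ract invgK.
by apply: (eU q1); rewrite q1E.
Qed.

Lemma hull_lamination : compact [set: H] /\ transversely_Cantor_lamination R (@hull_orbit R a b w).
Proof.
have [h [h_cont hA h_inj h_surj h_open]] :=
  cantor_parametrization R (@code_set_closed M w) code_set_nonempty code_set_perfect.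
pose Psi (pt : space3 R * cantor_space) : H :=
  exist _ (Phi pt.1 (h pt.2)) (mem_set (@hull_Phi R a b M s w a0 nuE wrec pt.1 (h pt.2) (hA pt.2))).
(* A single bound for the three coordinates of the centres, the form in which the radius of the
   charts is chosen. *)
pose D := Num.max (@domain_bound R a b) lam.
have domP (k : Sol) : domain k -> [/\ 0 <= k.1.1 <= D, 0 <= k.1.2 <= D & 0 <= k.2 <= D].
  move=> [/andP[x0 x1] /andP[y0 y1] /andP[z0 z1]].
  by rewrite x0 y0 z0 /D !le_max x1 y1 z1 orbT.
have lam0 : 0 < lam := lam_gt0 a0.
have D0 : 0 <= D by rewrite le_max (ltW lam0) orbT.
have Psi_cont : continuous Psi.
  move=> pt U /(nbhs_hullP a0)[e e0 eU].
  have pc : (fun pt : space3 R * cantor_space => (pt.1, h pt.2)) @ pt --> (pt.1, h pt.2).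
    have c1 : x.1 @[x --> pt] --> pt.1 by exact: cvg_fst.
    have c2 : h x.2 @[x --> pt] --> h pt.2.
      by apply: (@cvg_comp _ _ _ snd h _ (nbhs pt.2)); [exact: cvg_snd|exact: h_cont].
    exact: (cvg_pair c1 c2).
  have ne : nbhs (Phi pt.1 (h pt.2)) [set S | close e (Phi pt.1 (h pt.2)) S].
    by apply/(nbhs_closeP a0); exists e.
  have : \forall pt' \near pt, close e (Phi pt.1 (h pt.2)) (Phi pt'.1 (h pt'.2)).
    exact: pc (@Phi_continuous R a b M s a0 nuE (pt.1, h pt.2) _ ne).
  by apply: filterS => pt' c; exact: (eU (Psi pt')).
have Psi_surjD q : exists2 c : Sol, domain c & exists t, Psi (c, t) = q.
  have : Phi_image a0 nuE (w := w) (set_val q) by rewrite -(hullE a0 nuE wrec); exact: set_valP.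
  move=> [c [x [dc /h_surj[t <-] qE]]]; exists c => //; exists t.
  by apply: val_inj; rewrite /= -[RHS]/(set_val q) qE.
split.
  have := compact_setX (@domain_compact R a b) cantor_space_compact.
  move=> /(continuous_compact (continuous_subspaceT Psi_cont)).
  congr compact; apply/seteqP; split=> // q _.
  by have [c dc [t ct]] := Psi_surjD q; exists (c, t).
apply: (@lamination_of_chart R a b H Psi D lam) => //.
- move=> p t W [[V U] /= [pV tU] VUW].
  have [n nU] := h_open t U tU.
  have [e e0 eP] := Phi_open a0 nuE wrec n (hA t) pV.
  apply/(nbhs_hullP a0); exists e => // q' /(eP _ (set_valP q'))[p' [x' [Vp' wx' xx' q'E]]].
  have [t' Ut' tx'] := nU _ wx' xx'.
  exists (p', t'); first by apply: VUW.
  apply: val_inj; transitivity (Phi p' (h t')) => //.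
  by rewrite tx'; exact: esym q'E.
- by move=> q; have [c /domP dc ct] := Psi_surjD q; exists c.
- move=> p p' t t' /(congr1 set_val) E gx gy gz.
  have {}E : Phi p (h t) = Phi p' (h t') := E.
  by have [-> /h_inj ->] := Phi_inj E gx gy gz.
- move=> g p p' t t' /(congr1 set_val) E.
  have {}E : Phi p (h t) = Phi p' (h t') := E.
  apply: val_inj; rewrite -[LHS]/(Phi (g * p)%g (h t)) -[RHS]/(Phi (g * p')%g (h t')).
  by rewrite -!PhiM E.
- move=> p t q; split=> -[g gE].
    exists g^-1%g; apply: val_inj; rewrite -[RHS]/(Phi (g^-1 * p)%g (h t)) -PhiM.
    exact: gE.
  exists g^-1%g; rewrite gE /ract invgK.
  by rewrite -[LHS]/(Phi (g * p)%g (h t)) -PhiM.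
Qed.

End HullChart.

Theorem theorem1 (R : realType) (a b : R) (w : int -> bool)
    (a_gt0 : 0 < a) (b_neq0 : b != 0)
    (ab : exists2 n : nat, (2 <= n)%N &
            b / a = ln n%:R / ln 2 \/ - (b / a) = ln n%:R / ln 2)
    (w_seq : w = morse \/ oxtoby R w) :
  [/\ hull a b w !=set0, compact [set: hull a b w]
    & metrizable R (hull a b w)] /\
  [/\ forall (S : tiling a b) (g : Sol a b),
        hull a b w S -> hull a b w (ract S g),
      forall (S : tiling a b) (g : Sol a b),
        hull a b w S -> ract S g = S -> g = 1%g
    & forall S : hull a b w, dense (hull_orbit S)] /\
  transversely_Cantor_lamination R (@hull_orbit R a b w).
Proof.
have wrec : recurrent w.
  by case: w_seq => [->|]; [exact: morse_recurrent|exact: oxtoby_recurrent].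
have wap : aperiodic w.
  by case: w_seq => [->|]; [exact: morse_aperiodic|exact: oxtoby_aperiodic].
have ln2 : ln 2 != 0 :> R by rewrite gt_eqF// ln_gt0// ltr1n.
have [M M0 [s nuE]] : exists2 M, (0 < M)%N & exists s, expR (- b * (ln 2 / a)) = ratio M.+1 s :> R.
  case: ab => -[//|M] M2 ab; exists M => //.
  (* As e^(- b lam) = 2^(- b / a), the first case gives the ratio 1/n and the second the ratio n,
     where n = M + 1. *)
  case: ab => ab; [exists false|exists true] => /=.
    rewrite (_ : - b * (ln 2 / a) = - (b / a * ln 2)); last by ring.
    by rewrite ab divfK// expRN lnK// posrE ltr0n.
  rewrite (_ : - b * (ln 2 / a) = - (b / a) * ln 2); last by ring.
  by rewrite ab divfK// lnK// posrE ltr0n.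
have [cpt lam] := hull_lamination a_gt0 nuE wrec.
split; last split=> //.
- split=> //; last exact: hull_metrizable.
  have [x wx] := @code_set_nonempty M w.
  by exists (Phi a_gt0 nuE 1%g x); exact: (hull_Phi wrec wx).
- split.
  + by move=> S g; exact: hull_invariant nuE wrec _ _.
  + by move=> S g; exact: hull_free M0 nuE wrec wap _ _.
  + exact: hull_minimal nuE wrec.
Qed.
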